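(* Fix $m,n\ge1$, $\omega_{mn}=\exp(2\pi\mathrm k\sqrt{-1}/mn)$ with $\mathrm{k}\in\mathbb Z$, $\gcd(\mathrm k,n)=1$. Let $r\ge1$, $\mathbf p=(p_1,\dots,p_r)\in[mn]^r$, $\mathbf v=(v_1,\dots,v_r)\in((\hbar_1,\hbar_2)\mathbb C[[\hbar_1,\hbar_2]])^r$, and define $p'_k:=p_k\bmod m\in[m]$ and $u'_k:=\omega_{mn}^{-p_k}e^{nv_k}$, $\mathbf p'=(p'_k)$, $\mathbf u'=(u'_k)$. Assume that $\{u'_k\}$ and $\{v_k\}$ are not in resonance, so that the $\mathcal U^{(m),\omega_{mn}}_R$-module $F^{\mathbf p'}_R(\mathbf u')=F^{p_1'}_R(u_1')\otimes\cdots\otimes F^{p'_r}_R(u'_r)$ and the $\mathcal Y^{(mn)}_R$-module ${}^aF^{\mathbf p}_R(\mathbf v)={}^aF^{p_1}_R(v_1)\otimes\cdots\otimes{}^aF^{p_r}_R(v_r)$ are defined. Then there exists a unique collection of constants $c_{\boldsymbol\lambda}(m,n;\omega_{mn})\in R$, indexed by $r$-tuples of partitions $\boldsymbol\lambda$, such that $c_{\boldsymbol\emptyset}(m,n;\omega_{mn})=1$ and the corresponding $R$-linear isomorphism $$I\colon F^{\mathbf p'}_R(\mathbf u')\xrightarrow{\ \sim\ }{}^aF^{\mathbf p}_R(\mathbf v),\qquad|\boldsymbol\lambda\rangle\mapsto c_{\boldsymbol\lambda}(m,n;\omega_{mn})\cdot|\boldsymbol\lambda\rangle$$ satisfies $I(X(w))=\Phi^{\omega_{mn}}_{m,n}(X)(I(w))$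 for all $w\in F^{\mathbf p'}_R(\mathbf u')$ and all $X\in\{h_{i,k},e_{i,k},f_{i,k}\}_{i\in[m],k\in\mathbb Z}$.
   Context: **Ring $R$.** $\hbar_1,\hbar_2$ are formal variables, $\hbar_3:=-\hbar_1-\hbar_2$. $R$ is the localization of $\mathbb C[[\hbar_1,\hbar_2]]$ by the multiplicative set generated by all $\hbar_1-\nu\hbar_2$, $\nu\in\mathbb C$. The subscript $R$ on an algebra denotes $\otimes_{\mathbb C[[\hbar_1,\hbar_2]]}R$. **Indices.** For $N\ge1$, $[N]=\{0,\dots,N-1\}$ is viewed as the set of residues mod $N$. $a^{(N)}_{i,j}$ is the Cartan matrix of type $A^{(1)}_{N-1}$ for $N\ge2$ (off-diagonal entries $-2$ for $N=2$) and $0$ for $N=1$. $m^{(N)}_{i,j}=1$ if $N>2,j=i-1$; $=-1$ if $N>2,j=i+1$; $=0$ otherwise. $[a,b]_x:=ab-x\,ba$, $\{a,b\}:=ab+ba$, $\mathrm{Sym}$ is symmetrization over the indicated variables/indices, $[k]_q=\frac{q^k-q^{-k}}{q-q^{-1}}$, $\delta(z)=\sum_{k\in\mathbb Z}z^k$, $\delta^+(z)=\sum_{k\ge0}z^k$. **Formal quantum toroidal algebra $\mathcal U=\mathcal U^{(m),\omega_{mn}}_{\hbar_1,\hbar_2}$.** Put $q_1=\omega_{mn}e^{\hbar_1/m}$, $q_2=e^{\hbar_2/m}$, $q_3=\omega_{mn}^{-1}e^{\hbar_3/m}$, $q=e^{\hbar_2/2m}$, $d=q_1q$. Let $d_{i,j}=d^{\mp1}$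 if $m>2,j=i\pm1$; $-1$ if $m=2,j\ne i$; $1$ otherwise. Let $g_{i,j}(z,w)=z-q^{a_{i,j}}d^{-m_{i,j}}w$ if $m>2$; $z-q_2w$ if $m=2,i=j$; $(z-q_1w)(z-q_3w)$ if $m=2,i\neq j$; $(z-q_1w)(z-q_2w)(z-q_3w)$ if $m=1$ (here $a=a^{(m)}$, $m_{i,j}=m^{(m)}_{i,j}$). It is the unital associative $\mathbb C[[\hbar_1,\hbar_2]]$-algebra topologically generated by $e_{i,k},f_{i,k},h_{i,k}$ ($i\in[m],k\in\mathbb Z$) with relations, where $e_i(z)=\sum_k e_{i,k}z^{-k}$, $f_i(z)=\sum_kf_{i,k}z^{-k}$, $\psi_i^\pm(z)=\exp(\pm\frac{\hbar_2}{2m}h_{i,0})\exp(\pm(q-q^{-1})\sum_{r>0}h_{i,\pm r}z^{\mp r})$: - $[h_{i,k},h_{j,l}]=0$; - $[e_i(z),f_j(w)]=\frac{\delta_{i,j}}{q-q^{-1}}\delta(w/z)(\psi^+_i(w)-\psi^-_i(z))$; - $d_{i,j}g_{i,j}(z,w)e_i(z)e_j(w)=-g_{j,i}(w,z)e_j(w)e_i(z)$; - $d_{j,i}g_{j,i}(w,z)f_i(z)f_j(w)=-g_{i,j}(z,w)f_j(w)f_i(z)$; - $[h_{i,k},e_{j,l}]=b_m(i,j;k)e_{j,l+k}$, $[h_{i,k},f_{j,l}]=-b_m(i,j;k)f_{j,l+k}$, with $b_m(i,j;0)=a_{i,j}$ and for $k\ne0$: $b_m(i,j;k)=\frac{[ka_{i,j}]_q}{k}d^{-km_{i,j}}$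 if $m>2$; $\frac{[2k]_q}{k}\delta_{j,i}-\frac{[k]_q}{k}(d^k+d^{-k})\delta_{j,i+1}$ if $m=2$; $\frac{[k]_q}{k}(q^k+q^{-k}-d^k-d^{-k})$ if $m=1$; - Serre relations, for $e$ and the same for $f$: if $m>2$: $[e_i(z),e_j(w)]=0$ when $a_{i,j}=0$, and $\mathrm{Sym}_{z_1,z_2}[e_i(z_1),[e_i(z_2),e_{i\pm1}(w)]_q]_{q^{-1}}=0$; if $m=2$: $\mathrm{Sym}_{z_1,z_2,z_3}[e_i(z_1),[e_i(z_2),[e_i(z_3),e_{i+1}(w)]_{q^2}]]_{q^{-2}}=0$; if $m=1$: $\mathrm{Sym}_{z_1,z_2,z_3}\frac{z_2}{z_3}[e_0(z_1),[e_0(z_2),e_0(z_3)]]=0$. **Formal affine Yangian $\mathcal Y=\mathcal Y^{(N)}_{\hbar_1,\hbar_2}$, $N=mn$.** Put $h_s=\hbar_s/N$, $\beta=(h_1-h_3)/2$, $\sigma_2=h_1h_2+h_1h_3+h_2h_3$, $\sigma_3=h_1h_2h_3$. It is the unital associative $\mathbb C[[\hbar_1,\hbar_2]]$-algebra topologically generated by $x^\pm_{i,r},\xi_{i,r}$ ($i\in[N],r\in\mathbb N=\{0,1,\dots\}$) with relations $[\xi_{i,r},\xi_{j,s}]=0$, $[x^+_{i,r},x^-_{j,s}]=\delta_{i,j}\xi_{i,r+s}$ and the following, where $y_{i,r}$ stands for $x^\pm_{i,r}$ and also for $\xi_{i,r}$: - $N>2$: $[y_{i,r+1},x^\pm_{j,s}]-[y_{i,r},x^\pm_{j,s+1}]=-m_{i,j}\beta[y_{i,r},x^\pm_{j,s}]\pm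 a_{i,j}\frac{h_2}{2}\{y_{i,r},x^\pm_{j,s}\}$; $[\xi_{i,0},x^\pm_{j,s}]=\pm a_{i,j}x^\pm_{j,s}$; $\mathrm{Sym}_{r_1,r_2}[x^\pm_{i,r_1},[x^\pm_{i,r_2},x^\pm_{i\pm1,s}]]=0$ (for both neighbours of $i$); $[x^\pm_{i,r},x^\pm_{j,s}]=0$ if $a_{i,j}=0$. - $N=2$: $[y_{i,r+1},x^\pm_{i,s}]-[y_{i,r},x^\pm_{i,s+1}]=\pm h_2\{y_{i,r},x^\pm_{i,s}\}$; for $j\ne i$: $[y_{i,r+2},x^\pm_{j,s}]-2[y_{i,r+1},x^\pm_{j,s+1}]+[y_{i,r},x^\pm_{j,s+2}]=-h_1h_3[y_{i,r},x^\pm_{j,s}]\mp h_2(\{y_{i,r+1},x^\pm_{j,s}\}-\{y_{i,r},x^\pm_{j,s+1}\})$; $[\xi_{i,0},x^\pm_{j,s}]=\pm a_{i,j}x^\pm_{j,s}$; $[\xi_{i,1},x^\pm_{i+1,s}]=\mp(2x^\pm_{i+1,s+1}+h_2\{\xi_{i,0},x^\pm_{i+1,s}\})$; $\mathrm{Sym}_{r_1,r_2,r_3}[x^\pm_{i,r_1},[x^\pm_{i,r_2},[x^\pm_{i,r_3},x^\pm_{i+1,s}]]]=0$. - $N=1$: $[y_{0,r+3},x^\pm_{0,s}]-3[y_{0,r+2},x^\pm_{0,s+1}]+3[y_{0,r+1},x^\pm_{0,s+2}]-[y_{0,r},x^\pm_{0,s+3}]=-\sigma_2([y_{0,r+1},x^\pm_{0,s}]-[y_{0,r},x^\pm_{0,s+1}])\pm\sigma_3\{y_{0,r},x^\pm_{0,s}\}$;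 $[\xi_{0,0},x^\pm_{0,s}]=0=[\xi_{0,1},x^\pm_{0,s}]$, $[\xi_{0,2},x^\pm_{0,s}]=\pm2h_1h_3x^\pm_{0,s}$; $\mathrm{Sym}_{r_1,r_2,r_3}[x^\pm_{0,r_1},[x^\pm_{0,r_2},x^\pm_{0,r_3+1}]]=0$. $\mathcal Y$ is $\mathbb N$-graded by $\deg x^\pm_{i,r}=\deg\xi_{i,r}=r$, $\deg\hbar_s=1$; $\widehat{\mathcal Y}$ is the completion. **Tensor products of Fock modules.** $\boldsymbol\lambda=(\lambda^{(1)},\dots,\lambda^{(r)})$ runs over $r$-tuples of partitions; $\boldsymbol\emptyset$ is the tuple of empty partitions; $\boldsymbol\lambda+1^{(b)}_l$ is $\boldsymbol\lambda$ with $\lambda^{(b)}_l$ increased by 1; $(a,s)\prec(b,l)$ iff $a<b$ or ($a=b$ and $s<l$). For an expression in $z$, $(\cdot)^\pm$ is its expansion in $z^{\mp1}$. Matrix coefficients not listed are zero. Infinite products reduce to finite ones by pairing, for large $s$, the factor of $(a,s)$ in the first product with that of $(a,s+1)$ in the second (their product is $1$). $F_R^{p'_1}(u'_1)\otimes\cdots\otimes F_R^{p'_r}(u'_r)$ is the free $R$-module with basis $|\boldsymbol\lambda\rangle$ and the following $\mathcal U_R$-action, where $\equiv$ is mod $m$, $c^{(a)}_s=p'_a+s-\lambda^{(a)}_s$, $\chi^{(a)}_s=q_1^{\lambda^{(a)}_s}q_3^{s-1}u'_a$, $\psi(z)=\frac{q-q^{-1}z}{1-z}$: $$\langle\boldsymbol\lambda+1^{(b)}_l|e_j(z)|\boldsymbol\lambda\rangle=\delta_{c^{(b)}_l\equiv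 j+1}\prod_{(a,s)\prec(b,l),\,c^{(a)}_s\equiv j}\psi\Big(\frac{\chi^{(a)}_s}{q_1\chi^{(b)}_l}\Big)\prod_{(a,s)\prec(b,l),\,c^{(a)}_s\equiv j+1}\psi\Big(\frac{\chi^{(b)}_l}{\chi^{(a)}_s}\Big)\,\delta\Big(\frac{\chi^{(b)}_l}{z}\Big),$$ $\langle\boldsymbol\lambda|f_j(z)|\boldsymbol\lambda+1^{(b)}_l\rangle$ is given by the same formula with $\prec$ replaced by $\succ$ (all quantities computed from $\boldsymbol\lambda$), multiplied by $\frac{q(1-q_3)}{1-q_1^{-1}}$ if $m=1$; and $$\langle\boldsymbol\lambda|\psi_j^\pm(z)|\boldsymbol\lambda\rangle=\prod_{c^{(a)}_s\equiv j}\psi(\chi^{(a)}_s/q_1z)^\pm\prod_{c^{(a)}_s\equiv j+1}\psi(z/\chi^{(a)}_s)^\pm,$$ which determines the diagonal action of $h_{j,k}$ ($h_{j,0}$ acting by integers). ${}^aF_R^{p_1}(v_1)\otimes\cdots\otimes{}^aF_R^{p_r}(v_r)$ is the free $R$-module with basis $|\boldsymbol\lambda\rangle$ and the following $\mathcal Y_R$-action, where $\equiv$ is mod $N=mn$, $c^{(a)}_s=p_a+s-\lambda^{(a)}_s$, $x^{(a)}_s=\lambda^{(a)}_sh_1+(s-1)h_3+v_a$ ($h_s=\hbar_s/mn$), $x^\pm_j(z)=\sum_{r\ge0}x^\pm_{j,r}z^{-r-1}$, $\xi_j(z)=1+h_2\sum_{r\ge0}\xi_{j,r}z^{-r-1}$: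 $$\langle\boldsymbol\lambda+1^{(b)}_l|x^+_j(z)|\boldsymbol\lambda\rangle=\delta_{c^{(b)}_l\equiv j+1}\prod_{(a,s)\prec(b,l),\,c^{(a)}_s\equiv j}\frac{x^{(a)}_s-x^{(b)}_l+h_3}{x^{(a)}_s-x^{(b)}_l-h_1}\prod_{(a,s)\prec(b,l),\,c^{(a)}_s\equiv j+1}\frac{x^{(b)}_l-x^{(a)}_s-h_2}{x^{(b)}_l-x^{(a)}_s}\cdot\frac{\delta^+(x^{(b)}_l/z)}{z},$$ $\langle\boldsymbol\lambda|x^-_j(z)|\boldsymbol\lambda+1^{(b)}_l\rangle$ is given by the same formula with $\prec$ replaced by $\succ$, multiplied by $-h_3/h_1$ if $N=1$; and $$\langle\boldsymbol\lambda|\xi_j(z)|\boldsymbol\lambda\rangle=\Big(\prod_{c^{(a)}_s\equiv j}\frac{x^{(a)}_s-z+h_3}{x^{(a)}_s-z-h_1}\prod_{c^{(a)}_s\equiv j+1}\frac{z-x^{(a)}_s-h_2}{z-x^{(a)}_s}\Big)^+.$$ The parameters $u'_1,\dots,u'_r$ are *not in resonance* if, for all $r$-tuples of partitions $\boldsymbol\lambda,\boldsymbol\lambda+1^{(b)}_l$ and $j\equiv c^{(b)}_l-1$ mod $m$ (with $c^{(a)}_s=p'_a+s-\lambda^{(a)}_s$), the products $$\prod_{(a,s)\prec(b,l),\,c^{(a)}_s\equiv j}\psi\Big(\frac{\chi^{(a)}_s}{q_1\chi^{(b)}_l}\Big)\prod_{(a,s)\prec(b,l),\,c^{(a)}_s\equiv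 j+1}\psi\Big(\frac{\chi^{(b)}_l}{\chi^{(a)}_s}\Big)$$ and the same products with $\prec$ replaced by $\succ$, which are the products entering the matrix coefficients $\langle\boldsymbol\lambda+1^{(b)}_l|e_j(z)|\boldsymbol\lambda\rangle$ and $\langle\boldsymbol\lambda|f_j(z)|\boldsymbol\lambda+1^{(b)}_l\rangle$, are well-defined over $R$. Likewise, the parameters $v_1,\dots,v_r$ are *not in resonance* if, for all $r$-tuples of partitions $\boldsymbol\lambda,\boldsymbol\lambda+1^{(b)}_l$ and $j\equiv c^{(b)}_l-1$ mod $mn$ (with $c^{(a)}_s=p_a+s-\lambda^{(a)}_s$), the products $$\prod_{(a,s)\prec(b,l),\,c^{(a)}_s\equiv j}\frac{x^{(a)}_s-x^{(b)}_l+h_3}{x^{(a)}_s-x^{(b)}_l-h_1}\prod_{(a,s)\prec(b,l),\,c^{(a)}_s\equiv j+1}\frac{x^{(b)}_l-x^{(a)}_s-h_2}{x^{(b)}_l-x^{(a)}_s}$$ and the same products with $\prec$ replaced by $\succ$, which are the products entering the matrix coefficients $\langle\boldsymbol\lambda+1^{(b)}_l|x^+_j(z)|\boldsymbol\lambda\rangle$ and $\langle\boldsymbol\lambda|x^-_j(z)|\boldsymbol\lambda+1^{(b)}_l\rangle$, are well-defined over $R$. **The elements $\Phi^{\omega_{mn}}_{m,n}(X)\in\widehat{\mathcal Y}$.** Here $\equiv$ is mod $m$. For $i'\in[mn]$: $\xi_{i'}(z)=1+\frac{\hbar_2}{mn}\sum_{r\ge0}\xi_{i',r}z^{-r-1}$;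 $\log\xi_{i'}(z)=\sum_{r\ge0}t_{i',r}z^{-r-1}$; $B_{i'}(w)=\sum_{r\ge0}\frac{t_{i',r}}{r!}w^r$. For $i'\equiv j'$ in $[mn]$: $H_{i',j'}(v)=\frac{nv}{e^{nv/2}-e^{-nv/2}}$ if $i'=j'$, $\frac{\omega_{mn}^{-i'}-\omega_{mn}^{-j'}}{\omega_{mn}^{-i'}e^{nv/2}-\omega_{mn}^{-j'}e^{-nv/2}}$ if $i'\ne j'$; $G_{i',j'}=\log H_{i',j'}$; $\gamma_{i',j'}(v)=-B_{j'}(-\partial_v)\partial_vG_{i',j'}(v)$; $g_{i'}(v)=\big(\frac{\hbar_2}{m(q-q^{-1})}\big)^{1/2}\exp\big(\frac12\sum_{j'\equiv i'}\gamma_{i',j'}(v)\big)$. Writing $e^{knv}g_{i'}(v)=\sum_rg^{(k)}_{i',r}v^r$: $\Phi^{\omega_{mn}}_{m,n}(h_{i,0})=\sum_{i'\equiv i}\xi_{i',0}$, $\Phi^{\omega_{mn}}_{m,n}(h_{i,l})=\frac n{q-q^{-1}}\sum_{i'\equiv i}\omega_{mn}^{-li'}B_{i'}(ln)$ ($l\ne0$), $\Phi^{\omega_{mn}}_{m,n}(e_{i,k})=\sum_{i'\equiv i}\omega_{mn}^{-ki'}\sum_{r\geq 0}g^{(k)}_{i',r}x^+_{i',r}$, $\Phi^{\omega_{mn}}_{m,n}(f_{i,k})=\sum_{i'\equiv i}\omega_{mn}^{-ki'}\sum_{r\geq 0}g^{(k)}_{i',r}x^-_{i',r}$ (sums over $i'\in[mn]$);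 these act on ${}^aF^{\mathbf p}_R(\mathbf v)$ through convergent series. *)

(* Defs.v *)
From HB Require Import structures.
From mathcomp Require Import all_boot all_order all_algebra.
From mathcomp Require Import boolp classical_sets functions reals trigo.
From mathcomp Require Import complex.
From mathcomp Require Import finmap.
From mathcomp.multinomials Require Import monalg.

Set Implicit Arguments.
Unset Strict Implicit.
Unset Printing Implicit Defensive.

Import GRing.Theory.
Local Open Scope ring_scope.

Section ClassicalInverse.
Variable T : comNzRingType.

Definition cunit : {pred T} := fun x => `[< exists y, y * x = 1 >].
Definition cinv (x : T) : T := xget x [set y | y * x = 1]%classic.

Lemma cmulVx : {in cunit, left_inverse 1 cinv *%R}.
Proof.
move=> x /asboolP[y yx]; rewrite /cinv.
by case: xgetP => [z _ //|/(_ y)].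
Qed.

Lemma cunitPl (x y : T) : y * x = 1 -> x \in cunit.
Proof. by move=> yx; apply/asboolP; exists y. Qed.

Lemma cinv_out : {in [predC cunit], cinv =1 id}.
Proof.
move=> x nx; rewrite /cinv; case: xgetP => // y _ yx.
by case/negP: nx; apply: (cunitPl yx).
Qed.

End ClassicalInverse.

(* The exact quotient x / d in a domain, meaningful when d <> 0 divides x. *)
Definition exdiv (T : comNzRingType) (x d : T) : T :=
  xget 0 [set y | y * d = x]%classic.

Definition exdivZ (K : comNzRingType) (V : lmodType K) (x : V) (d : K) : V :=
  xget 0 [set y | d *: y = x]%classic.

Record fps (T : Type) := FPS { fcoef : nat -> T }.

Lemma fpsP (T : Type) (f g : fps T) : fcoef f =1 fcoef g -> f = g.
Proof. by case: f g => f [g] /= /funext ->. Qed.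

HB.instance Definition _ (T : Type) := gen_eqMixin (fps T).
HB.instance Definition _ (T : Type) := gen_choiceMixin (fps T).

Section FpsRing.
Variable T : nzRingType.
Implicit Types f g h : fps T.

Definition fzero : fps T := FPS (fun=> 0).
Definition fadd f g := FPS (fun i => fcoef f i + fcoef g i).
Definition fopp f := FPS (fun i => - fcoef f i).
Definition fconst (c : T) : fps T := FPS (fun i => c *+ (i == 0%N)).
Definition fmul f g :=
  FPS (fun n => \sum_(i < n.+1) fcoef f i * fcoef g (n - i)).

Fact faddA : associative fadd.
Proof. by move=> f g h; apply: fpsP => i /=; rewrite addrA. Qed.
Fact faddC : commutative fadd.
Proof. by move=> f g; apply: fpsP => i /=; rewrite addrC. Qed.
Fact fadd0 : left_id fzero fadd.
Proof. by move=> f; apply: fpsP => i /=; rewrite add0r. Qed.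
Fact faddN : left_inverse fzero fopp fadd.
Proof. by move=> f; apply: fpsP => i /=; rewrite addNr. Qed.

HB.instance Definition _ :=
  GRing.isZmodule.Build (fps T) faddA faddC fadd0 faddN.

Fact fmul_rev f g n :
  fcoef (fmul f g) n = \sum_(i < n.+1) fcoef f (n - i) * fcoef g i.
Proof.
rewrite /= (reindex_inj rev_ord_inj) /=.
by apply: eq_bigr => i _; rewrite (sub_ordK i).
Qed.

Fact fcoefM f g n :
  fcoef (fmul f g) n = \sum_(i < n.+1) fcoef f i * fcoef g (n - i).
Proof. by []. Qed.

Fact fmulA : associative fmul.
Proof.
move=> f g h; apply: fpsP => i; rewrite [RHS]fmul_rev fcoefM.
pose c3 j k := fcoef f j * (fcoef g (i - j - k) * fcoef h k).
transitivity (\sum_(j < i.+1) \sum_(k < i.+1 | (k <= i - j)%N) c3 j k).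
  apply: eq_bigr => j _; rewrite fmul_rev big_distrr /=.
  by rewrite (big_ord_narrow_leq (leq_subr _ _)).
rewrite (exchange_big_dep predT) //=; apply: eq_bigr => k _.
transitivity (\sum_(j < i.+1 | (j <= i - k)%N) c3 j k).
  apply: eq_bigl => j; rewrite -ltnS -(ltnS j) -!subSn ?leq_ord //.
  by rewrite -subn_gt0 -(subn_gt0 j) -!subnDA addnC.
rewrite (big_ord_narrow_leq (leq_subr _ _)) big_distrl /=.
by apply: eq_bigr => j _; rewrite /c3 mulrA -!subnDA addnC.
Qed.

Fact fmul1 : left_id (fconst 1) fmul.
Proof.
move=> f; apply: fpsP => i /=; rewrite big_ord_recl /= subn0 mul1r.
by rewrite big1 ?addr0 // => j _; rewrite mulr0n mul0r.
Qed.
Fact fmulr1 : right_id (fconst 1) fmul.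
Proof.
move=> f; apply: fpsP => i; rewrite fmul_rev big_ord_recl /= subn0 mulr1.
by rewrite big1 ?addr0 // => j _; rewrite mulr0n mulr0.
Qed.
Fact fmulDl : left_distributive fmul +%R.
Proof.
move=> f g h; apply: fpsP => i /=; rewrite -big_split /=.
by apply: eq_bigr => j _; rewrite mulrDl.
Qed.
Fact fmulDr : right_distributive fmul +%R.
Proof.
move=> f g h; apply: fpsP => i /=; rewrite -big_split /=.
by apply: eq_bigr => j _; rewrite mulrDr.
Qed.
Fact f1_neq0 : fconst 1 != 0.
Proof.
apply/eqP => /(congr1 (fun f : fps T => fcoef f 0)) /= /eqP.
by rewrite oner_eq0.
Qed.

HB.instance Definition _ := GRing.Zmodule_isNzRing.Build (fps T)
  fmulA fmul1 fmulr1 fmulDl fmulDr f1_neq0.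

Definition fvar : fps T := FPS (fun i => (i == 1%N)%:R).

(* The expansion of 1 / (1 - c t) in powers of the variable t. *)
Definition fgeom (c : T) : fps T := FPS (fun i => c ^+ i).

Definition fderiv f : fps T := FPS (fun i => fcoef f i.+1 *+ i.+1).

End FpsRing.

Fact fmulC (T : comNzRingType) : commutative (@GRing.mul (fps T)).
Proof.
move=> f g; apply: fpsP => i; rewrite [RHS]fmul_rev /=.
by apply: eq_bigr => j _; rewrite mulrC.
Qed.

HB.instance Definition _ (T : comNzRingType) :=
  GRing.PzRing_hasCommutativeMul.Build (fps T) (@fmulC T).

HB.instance Definition _ (T : comNzRingType) :=
  GRing.ComNzRing_hasMulInverse.Build (fps T)
    (@cmulVx (fps T)) (@cunitPl (fps T)) (@cinv_out (fps T)).

Fact fps_lowest (T : nzRingType) (f : fps T) : f != 0 ->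
  exists n, fcoef f n != 0 /\ forall i, (i < n)%N -> fcoef f i = 0.
Proof.
move=> f0; have ex : exists n, fcoef f n != 0.
  apply/not_existsP => all0; case/eqP: f0; apply: fpsP => i /=.
  by apply/eqP; case: (boolP (fcoef f i == 0)) => // /all0.
exists (ex_minn ex); case: ex_minnP => n fn nmin; split => // i ltin.
by apply/eqP; apply: contraLR ltin => fi; rewrite -leqNgt nmin.
Qed.

Fact fps_integral (T : idomainType) (f g : fps T) :
  f * g = 0 -> (f == 0) || (g == 0).
Proof.
move=> fg0; apply/orP; apply: contrapT => /not_orP[/negP f0 /negP g0].
have [a [fa amin]] := fps_lowest f0; have [b [gb bmin]] := fps_lowest g0.
have /= := congr1 (fun h : fps T => fcoef h (a + b)) fg0.
have alt : (a < (a + b).+1)%N by rewrite ltnS leq_addr.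
rewrite (bigD1 (Ordinal alt)) //= addKn big1 => [|i].
  by rewrite addr0 => /eqP; rewrite mulf_eq0 (negPf fa) (negPf gb).
rewrite -val_eqE /= neq_ltn => /orP[/amin->|lt_ai]; first by rewrite mul0r.
have le_i : (i <= a + b)%N by rewrite -ltnS.
by rewrite bmin ?mulr0 // -(ltn_add2r i) subnK // [(b + i)%N]addnC ltn_add2r.
Qed.

HB.instance Definition _ (T : idomainType) :=
  GRing.ComUnitRing_isIntegral.Build (fps T) (@fps_integral T).

Section FpsExpLog.
Variables (K : comUnitRingType) (L : lalgType K).

(* exp f for f without constant term: the k-th power of f has no coefficient
   below degree k, so that each coefficient is a finite sum. *)
Definition fexp (f : fps L) : fps L :=
  FPS (fun i => \sum_(0 <= k < i.+1) (k`!%:R : K)^-1 *: fcoef (f ^+ k) i).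

(* log f for f with constant term 1. *)
Definition flog (f : fps L) : fps L :=
  FPS (fun i => \sum_(1 <= k < i.+1)
    ((-1) ^+ k.-1 / k%:R : K) *: fcoef ((f - 1) ^+ k) i).

(* exp (c t), for a scalar c and the variable t. *)
Definition fexpX (c : K) : fps L :=
  FPS (fun i => (c ^+ i / i`!%:R : K) *: 1).

End FpsExpLog.

Section BaseRing.
Variable RR : realType.
Local Notation C := (RR[i]).

(* C[[hbar_1, hbar_2]], with hbar_1 the inner and hbar_2 the outer variable. *)
Definition hseries := fps (fps C).
HB.instance Definition _ := GRing.IntegralDomain.on hseries.

Definition hs1 : hseries := fconst (fvar C).
Definition hs2 : hseries := fvar (fps C).
Definition hsC (c : C) : hseries := fconst (fconst c).

(* The d-th power of the maximal ideal (hbar_1, hbar_2). *)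
Definition mpower (d : nat) (a : hseries) : Prop :=
  forall i j, (i + j < d)%N -> fcoef (fcoef a j) i = 0.

Definition hden (nus : seq C) : hseries :=
  \prod_(nu <- nus) (hs1 - hsC nu * hs2).

Fact hden_neq0 nus : hden nus != 0.
Proof.
rewrite /hden; elim/big_rec: _ => [|nu a _ a0]; first exact: oner_neq0.
rewrite mulf_neq0 //; apply/eqP => /(congr1 (fun a => fcoef (fcoef a 0) 1)).
rewrite /= big_ord1 /= big1 => [|i _]; last by rewrite mulr0.
by rewrite subr0 mulr1n => /eqP; rewrite oner_eq0.
Qed.

Definition is_hloc : {pred {fraction hseries}} :=
  fun x => `[< exists a nus, x = tofrac a / tofrac (hden nus) >].

Fact hden_cat s t : hden (s ++ t) = hden s * hden t.
Proof. by rewrite /hden big_cat. Qed.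

Fact is_hlocP a nus : tofrac a / tofrac (hden nus) \in is_hloc.
Proof. by apply/asboolP; exists a, nus. Qed.

Fact is_hloc_subring : subring_closed is_hloc.
Proof.
have nz s : tofrac (hden s) != 0 by rewrite tofrac_eq0 hden_neq0.
split.
- apply/asboolP; exists 1, [::].
  by rewrite /hden big_nil !rmorph1 divr1.
- move=> _ _ /asboolP[a [s ->]] /asboolP[b [t ->]].
  apply/asboolP; exists (a * hden t - b * hden s), (s ++ t).
  rewrite hden_cat tofracB !tofracM.
  by rewrite -mulNr addf_div ?nz // mulNr.
- move=> _ _ /asboolP[a [s ->]] /asboolP[b [t ->]].
  apply/asboolP; exists (a * b), (s ++ t).
  by rewrite hden_cat !rmorphM mulf_div.
Qed.

HB.instance Definition _ :=
  GRing.isSubringClosed.Build {fraction hseries} is_hloc is_hloc_subring.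

(* The ring R, inside the field of fractions of C[[hbar_1, hbar_2]]. *)
Record hloc := HLoc { hloc_val : {fraction hseries}; _ : hloc_val \in is_hloc }.

HB.instance Definition _ := [isSub for hloc_val].
HB.instance Definition _ := [Choice of hloc by <:].
HB.instance Definition _ := [SubChoice_isSubComNzRing of hloc by <:].
HB.instance Definition _ :=
  GRing.ComNzRing_hasMulInverse.Build hloc
    (@cmulVx hloc) (@cunitPl hloc) (@cinv_out hloc).

Fact hloc_integral (x y : hloc) : x * y = 0 -> (x == 0) || (y == 0).
Proof.
move=> /(congr1 val); rewrite rmorphM rmorph0 => /eqP; rewrite mulf_eq0.
by case/orP => e; apply/orP; [left|right]; rewrite -val_eqE.
Qed.

HB.instance Definition _ :=
  GRing.ComUnitRing_isIntegral.Build hloc hloc_integral.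

End BaseRing.

Section LocalizedSeries.
Variable RR : realType.
Local Notation C := (RR[i]).
Local Notation R := (hloc RR).

Fact hseries_hloc (a : hseries RR) : tofrac a \in @is_hloc RR.
Proof. by apply/asboolP; exists a, [::]; rewrite /hden big_nil rmorph1 divr1. Qed.

Definition hemb (a : hseries RR) : R := HLoc (hseries_hloc a).
Definition hcst (c : C) : R := hemb (hsC c).

Definition hb1 : R := hemb (hs1 RR).
Definition hb2 : R := hemb (hs2 RR).
Definition hb3 : R := - hb1 - hb2.

(* R is filtered by the order in (hbar_1, hbar_2): each hbar_1 - nu hbar_2 is
   homogeneous of degree 1, so that dividing by it lowers the order by one. *)
Definition order_ge (d : nat) (x : R) : Prop :=
  exists a nus, x * hemb (hden nus) = hemb a /\ mpower (d + size nus) a.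

Definition hseries_to (u : nat -> R) (l : R) : Prop :=
  forall d, exists K, forall k, (K <= k)%N ->
    order_ge d (\sum_(0 <= i < k) u i - l).
Definition hsum (u : nat -> R) : R := xget 0 [set l | hseries_to u l]%classic.

Definition hexp (x : R) : R := hsum (fun k => x ^+ k / k`!%:R).

End LocalizedSeries.

Definition is_part (s : seq nat) := sorted geq s && (0%N \notin s).
Record part := Part { part_val :> seq nat; _ : is_part part_val }.
HB.instance Definition _ := [isSub for part_val].
HB.instance Definition _ := [Choice of part by <:].
Definition part0 : part := @Part [::] isT.

Section MultiPartitions.
Variable r : nat.

Definition mpart := {ffun 'I_r -> part}.
HB.instance Definition _ := Choice.on mpart.

Definition mpart0 : mpart := [ffun=> part0].

Implicit Types (la mu : mpart) (a b : 'I_r) (s l : nat).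

(* Rows are numbered from 1; lam la a s is the s-th part of the a-th
   partition, which is 0 for s large. *)
Definition lam la a s : nat := nth 0%N (la a) s.-1.

Definition with_part la b (t : seq nat) : mpart :=
  [ffun a => if a == b then insubd (la b) t else la a].

(* la + 1^(b)_l, defined when addable la b l. *)
Definition addable la b l : bool :=
  (0 < l)%N && is_part (incr_nth (la b) l.-1).
Definition add_box la b l : mpart := with_part la b (incr_nth (la b) l.-1).

(* The inverse operation, meaningful when removable mu b l. *)
Definition rem_box mu b l : mpart :=
  with_part mu b
    [seq x <- set_nth 0 (mu b) l.-1 (nth 0 (mu b) l.-1).-1 | x != 0]%N.
Definition removable mu b l : bool :=
  addable (rem_box mu b l) b l && (add_box (rem_box mu b l) b l == mu).

Definition prec a s b l : bool := (a < b)%N || (a == b) && (s < l)%N.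
Definition succ a s b l : bool := prec b l a s.

(* c^(a)_s = p_a + s - lambda^(a)_s *)
Definition content (p : 'I_r -> nat) la a s : int :=
  (p a)%:Z + s%:Z - (lam la a s)%:Z.

(* la^(a)_s = 0 for all a and all s >= cutoff la. *)
Definition cutoff la : nat := (\max_(a < r) size (la a)).+1.

(* The infinite product of F1 over the (a, s) with c^(a)_s = j, times that of
   F2 over the (a, s) with c^(a)_s = j + 1 (mod N), both restricted by P. For
   s > cutoff la the factors F1 a s and F2 a s.+1 have product 1: what remains
   is the first product up to the cutoff, and the second one a step further. *)
Definition pprod (T : comNzRingType) (N : nat) (p : 'I_r -> nat) la
    (P : 'I_r -> nat -> bool) (j : int) (F1 F2 : 'I_r -> nat -> T) : T :=
  (\prod_(a < r) \prod_(1 <= s < (cutoff la).+1 |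
      P a s && (content p la a s == j %[mod N%:Z])%Z) F1 a s) *
  (\prod_(a < r) \prod_(1 <= s < (cutoff la).+2 |
      P a s && (content p la a s == j + 1 %[mod N%:Z])%Z) F2 a s).

End MultiPartitions.

Section LinearMaps.
Variables (K : comNzRingType) (V : lmodType K).

Definition is_linear : {pred V -> V} := fun f => `[< linear f >].

Fact is_linear_submod : submod_closed is_linear.
Proof.
split=> [|c f g /asboolP lf /asboolP lg]; apply/asboolP => d x y.
  by change (0 = d *: (0 : V) + 0); rewrite scaler0 addr0.
change (c *: f (d *: x + y) + g (d *: x + y) =
  d *: (c *: f x + g x) + (c *: f y + g y)).
by rewrite lf lg !scalerDr !scalerA [c * d]mulrC addrACA.
Qed.

HB.instance Definition _ :=
  GRing.isSubmodClosed.Build K (V -> V) is_linear is_linear_submod.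

Record endo := Endo { endo_fun :> V -> V; _ : endo_fun \in is_linear }.
HB.instance Definition _ := [isSub for endo_fun].
HB.instance Definition _ := [Choice of endo by <:].
HB.instance Definition _ := [SubChoice_isSubLmodule of endo by <:].

Lemma endo_linear (T : endo) : linear T.
Proof. by case: T => f /= /asboolP. Qed.

Lemma endoP (S T : endo) : S =1 T -> S = T.
Proof. by move=> /funext e; apply: val_inj. Qed.

Lemma endoD (T : endo) x y : T (x + y) = T x + T y.
Proof. by rewrite -{1}[x]scale1r endo_linear scale1r. Qed.

Fact endo1_subproof : (id : V -> V) \in is_linear.
Proof. exact/asboolP. Qed.
Definition endo1 : endo := Endo endo1_subproof.

Fact endo_comp_subproof (S T : endo) : S \o T \in is_linear.
Proof. by apply/asboolP => c x y /=; rewrite !endo_linear. Qed.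
Definition endo_comp (S T : endo) : endo := Endo (endo_comp_subproof S T).

Fact endo_compA : associative endo_comp.
Proof. by move=> S T U; apply: endoP. Qed.
Fact endo_comp1 : left_id endo1 endo_comp.
Proof. by move=> T; apply: endoP. Qed.
Fact endo_compr1 : right_id endo1 endo_comp.
Proof. by move=> T; apply: endoP. Qed.
Fact endo_compDl : left_distributive endo_comp +%R.
Proof. by move=> S T U; apply: endoP. Qed.
Fact endo_compDr : right_distributive endo_comp +%R.
Proof. by move=> S T U; apply: endoP => x; apply: endoD. Qed.
Fact endo_scaleAl (c : K) (S T : endo) :
  c *: endo_comp S T = endo_comp (c *: S) T.
Proof. exact: endoP. Qed.

End LinearMaps.

Section FreeModule.
Variables (K : comNzRingType) (I : choiceType).
Local Notation M := {malg K[I]}.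

Definition lin_ext_fun (f : I -> M) (x : M) : M :=
  \sum_(la <- msupp x) x@_la *: f la.

Fact lin_ext_subproof f : lin_ext_fun f \in @is_linear K M.
Proof.
have ext (x : M) (d : {fset I}) : (msupp x `<=` d)%fset ->
    lin_ext_fun f x = \sum_(la <- d) x@_la *: f la.
  move=> xd; rewrite /lin_ext_fun (big_fset_incl _ xd) // => la _.
  by move=> /mcoeff_outdom ->; rewrite scale0r.
apply/asboolP => c x y.
pose d := (msupp x `|` msupp y `|` msupp (c *: x + y))%fset.
have dx : (msupp x `<=` d)%fset by rewrite /d -fsetUA fsubsetUl.
have dy : (msupp y `<=` d)%fset by rewrite /d fsetUAC fsubsetUr.
have dz : (msupp (c *: x + y) `<=` d)%fset by rewrite /d fsubsetUr.
rewrite (ext _ _ dx) (ext _ _ dy) (ext _ _ dz) scaler_sumr -big_split /=.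
by apply: eq_bigr => la _; rewrite mcoeffD mcoeffZ scalerDl scalerA.
Qed.
Definition lin_ext f : endo M := Endo (lin_ext_subproof f).

Definition diag (c : I -> K) : endo M :=
  lin_ext (fun la => c la *: << 1 *g la >>).

Fact endo_malg_neq0 (i : I) : endo1 M != 0.
Proof.
apply/eqP => e.
have /(congr1 (mcoeff i)) : (<< 1 *g i >> : M) = 0 :=
  congr1 (fun T : endo M => T << 1 *g i >>) e.
by rewrite mcoeffU eqxx mcoeff0 => /eqP; rewrite oner_eq0.
Qed.

End FreeModule.

Section FockSpace.
Variables (RR : realType) (r : nat).
Local Notation R := (hloc RR).

(* The free R-module with basis |la>. *)
Definition fock := {malg R[mpart r]}.
HB.instance Definition _ := GRing.Lmodule.on fock.

Definition ket (la : mpart r) : fock := << 1 *g la >>.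

Definition fock_endo := endo fock.
HB.instance Definition _ := GRing.Lmodule.on fock_endo.
HB.instance Definition _ := GRing.Zmodule_isNzRing.Build fock_endo
  (@endo_compA _ _) (@endo_comp1 _ _) (@endo_compr1 _ _)
  (@endo_compDl _ _) (@endo_compDr _ _) (endo_malg_neq0 _ (mpart0 r)).
HB.instance Definition _ :=
  GRing.Lmodule_isLalgebra.Build R fock_endo (@endo_scaleAl _ _).

(* Sums of convergent series of operators: pointwise convergence, for the
   filtration of the free module induced by that of R. *)
Definition fock_to (u : nat -> fock) (x : fock) : Prop :=
  forall d, exists K, forall k, (K <= k)%N ->
    forall la, order_ge d (\sum_(0 <= i < k) u i - x)@_la.
Definition endo_to (U : nat -> fock_endo) (T : fock_endo) : Prop :=
  forall w, fock_to (fun i => U i w) (T w).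
Definition endo_sum (U : nat -> fock_endo) : fock_endo :=
  xget 0 [set T | endo_to U T]%classic.

End FockSpace.

Section Scalars.
Variables (RR : realType) (m n : nat) (k : int).
Local Notation C := (RR[i]).
Local Notation R := (hloc RR).

Definition root_arg : RR := 2%:R * pi * k%:~R / (m * n)%:R.
Definition omega : C := (cos root_arg +i* sin root_arg)%C.

Definition q1 : R := hcst omega * hexp (hb1 RR / m%:R).
Definition q3 : R := hcst omega^-1 * hexp (hb3 RR / m%:R).
Definition qq : R := hexp (hb2 RR / (2 * m)%:R).

Definition h1 : R := hb1 RR / (m * n)%:R.
Definition h2 : R := hb2 RR / (m * n)%:R.
Definition h3 : R := hb3 RR / (m * n)%:R.

End Scalars.

Section ToroidalFock.
Variables (RR : realType) (m n : nat) (k : int) (r : nat).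
Variables (p : 'I_r -> nat) (u : 'I_r -> hloc RR).
Local Notation R := (hloc RR).
Local Notation q := (qq RR m).
Local Notation q1 := (q1 RR m n k).
Local Notation q3 := (q3 RR m n k).
Implicit Types (la mu : mpart r) (a b : 'I_r) (s l : nat) (j : int).

Definition chi la a s : R := q1 ^+ lam la a s * q3 ^+ s.-1 * u a.

Definition psi_num (z : R) : R := q - q^-1 * z.
Definition psi_den (z : R) : R := 1 - z.

(* Numerator and denominator of the product of the psi's entering the matrix
   coefficients, where P restricts the (a, s) to the predecessors or to the
   successors of (b, l). *)
Definition tor_prod (psi : R -> R) (P : 'I_r -> nat -> 'I_r -> nat -> bool)
    la b l j : R :=
  pprod m p la (fun a s => P a s b l) j
    (fun a s => psi (chi la a s / (q1 * chi la b l)))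
    (fun a s => psi (chi la b l / chi la a s)).
Definition tor_num := tor_prod psi_num.
Definition tor_den := tor_prod psi_den.

(* The products are well-defined over R: no denominator vanishes, and the
   quotient belongs to R. *)
Definition tor_nonresonant : Prop :=
  forall la b l j, addable la b l ->
    (j == content p la b l - 1 %[mod m%:Z])%Z ->
    forall P, P = @prec r \/ P = @succ r ->
    tor_den P la b l j != 0 /\
    exists y : R, y * tor_den P la b l j = tor_num P la b l j.

(* <la + 1^(b)_l | e_{j,i} | la>, and <la | f_{j,i} | la + 1^(b)_l> up to the
   factor for m = 1: the coefficient of z^-i in delta (chi / z) is chi ^ i. *)
Definition tor_coef P j (i : int) la b l : R :=
  if (content p la b l == j + 1 %[mod m%:Z])%Z
  then exdiv (tor_num P la b l j) (tor_den P la b l j) * chi la b l ^ i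
  else 0.

Definition tor_e (j : 'I_m) (i : int) : fock_endo RR r :=
  lin_ext (fun la => \sum_(b < r) \sum_(1 <= l < (size (la b)).+2 |
    addable la b l) tor_coef (@prec r) j i la b l *: ket RR (add_box la b l)).

Definition tor_f (j : 'I_m) (i : int) : fock_endo RR r :=
  lin_ext (fun mu => \sum_(b < r) \sum_(1 <= l < (size (mu b)).+1 |
    removable mu b l)
    ((if m == 1%N then q * (1 - q3) / (1 - q1^-1) else 1) *
     tor_coef (@succ r) j i (rem_box mu b l) b l) *: ket RR (rem_box mu b l)).

(* Expansions of psi (c t) and psi (c / t) in powers of t. *)
Definition psi_at0 (c : R) : fps R :=
  (fconst q - fconst (q^-1 * c) * fvar R) * fgeom c.
Definition psi_atoo (c : R) : fps R :=
  (fconst q^-1 - fconst (q * c^-1) * fvar R) * fgeom c^-1.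

(* The eigenvalues of psi_j^+ (z) and psi_j^- (z) on |la>, as series in z^-1
   and in z respectively. *)
Definition psi_plus la j : fps R :=
  pprod m p la (fun _ _ => true) j
    (fun a s => psi_at0 (chi la a s / q1))
    (fun a s => psi_atoo (chi la a s)^-1).
Definition psi_minus la j : fps R :=
  pprod m p la (fun _ _ => true) j
    (fun a s => psi_atoo (chi la a s / q1))
    (fun a s => psi_at0 (chi la a s)^-1).

(* The eigenvalues h i of h_{j,i} on |la> are determined by those of
   psi_j^+ (z) and psi_j^- (z), together with the integrality of h 0. *)
Definition tor_h_spec la j (h : int -> R) : Prop :=
  [/\ exists z : int, h 0 = z%:~R,
      psi_plus la j = fconst (hexp (hb2 RR / (2 * m)%:R * h 0)) *
        fexp (L := R^o)
          (FPS (fun i => if i is _.+1 then (q - q^-1) * h i%:Z else 0))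
    & psi_minus la j = fconst (hexp (- (hb2 RR / (2 * m)%:R * h 0))) *
        fexp (L := R^o)
          (FPS (fun i => if i is _.+1 then - ((q - q^-1) * h (- i%:Z)) else 0))].
Definition tor_h_eigen la j : int -> R :=
  xget (fun=> 0) [set h | tor_h_spec la j h]%classic.

Definition tor_h (j : 'I_m) (i : int) : fock_endo RR r :=
  diag (fun la => tor_h_eigen la j i).

End ToroidalFock.

Section YangianFock.
Variables (RR : realType) (m n : nat) (r : nat).
Variables (p : 'I_r -> nat) (v : 'I_r -> hloc RR).
Local Notation R := (hloc RR).
Local Notation N := (m * n)%N.
Local Notation h1 := (h1 RR m n).
Local Notation h2 := (h2 RR m n).
Local Notation h3 := (h3 RR m n).
Implicit Types (la mu : mpart r) (a b : 'I_r) (s l : nat) (j : int).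

Definition xpos la a s : R := (lam la a s)%:R * h1 + s.-1%:R * h3 + v a.

Definition yang_num P la b l j : R :=
  pprod N p la (fun a s => P a s b l) j
    (fun a s => xpos la a s - xpos la b l + h3)
    (fun a s => xpos la b l - xpos la a s - h2).
Definition yang_den P la b l j : R :=
  pprod N p la (fun a s => P a s b l) j
    (fun a s => xpos la a s - xpos la b l - h1)
    (fun a s => xpos la b l - xpos la a s).

Definition yang_nonresonant : Prop :=
  forall la b l j, addable la b l ->
    (j == content p la b l - 1 %[mod N%:Z])%Z ->
    forall P, P = @prec r \/ P = @succ r ->
    yang_den P la b l j != 0 /\
    exists y : R, y * yang_den P la b l j = yang_num P la b l j.

Definition yang_coef P j (i : nat) la b l : R :=
  if (content p la b l == j + 1 %[mod N%:Z])%Z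
  then exdiv (yang_num P la b l j) (yang_den P la b l j) * xpos la b l ^+ i
  else 0.

Definition yang_xp (j : 'I_N) (i : nat) : fock_endo RR r :=
  lin_ext (fun la => \sum_(b < r) \sum_(1 <= l < (size (la b)).+2 |
    addable la b l) yang_coef (@prec r) j i la b l *: ket RR (add_box la b l)).

Definition yang_xm (j : 'I_N) (i : nat) : fock_endo RR r :=
  lin_ext (fun mu => \sum_(b < r) \sum_(1 <= l < (size (mu b)).+1 |
    removable mu b l)
    ((if N == 1%N then - h3 / h1 else 1) *
     yang_coef (@succ r) j i (rem_box mu b l) b l) *: ket RR (rem_box mu b l)).

(* The eigenvalue of xi_j (z) on |la>, as a series in t = z^-1; for instance
   (x - z + h3) / (x - z - h1) = (1 - (x + h3) t) / (1 - (x - h1) t). *)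
Definition xi_series la j : fps R :=
  pprod N p la (fun _ _ => true) j
    (fun a s => (1 - fconst (xpos la a s + h3) * fvar R) *
                fgeom (xpos la a s - h1))
    (fun a s => (1 - fconst (xpos la a s + h2) * fvar R) *
                fgeom (xpos la a s)).

Definition yang_xi (j : 'I_N) (i : nat) : fock_endo RR r :=
  diag (fun la => exdiv (fcoef (xi_series la j) i.+1) h2).

End YangianFock.

Arguments yang_xp {RR} m n {r} p v j i.
Arguments yang_xm {RR} m n {r} p v j i.
Arguments yang_xi {RR} m n {r} p v j i.

Inductive tor_gen (m : nat) :=
  | Gen_h of 'I_m & int
  | Gen_e of 'I_m & int
  | Gen_f of 'I_m & int.

Definition tor_act (RR : realType) (m n : nat) (k : int) (r : nat)
    (p : 'I_r -> nat) (u : 'I_r -> hloc RR) (X : tor_gen m) : fock_endo RR r :=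
  match X with
  | Gen_h i l => tor_h n k p u i l
  | Gen_e i l => tor_e n k p u i l
  | Gen_f i l => tor_f n k p u i l
  end.

Arguments tor_act {RR} m n k {r} p u X.

(* The elements Phi (X) of the completed affine Yangian, evaluated on operators
   xp i s, xm i s and xi i s by which x^+_{i,s}, x^-_{i,s}, xi_{i,s} act. *)
Section Phi.
Variables (RR : realType) (m n : nat) (k : int) (r : nat).
Local Notation C := (RR[i]).
Local Notation R := (hloc RR).
Local Notation N := (m * n)%N.
Local Notation E := (fock_endo RR r).
Local Notation q := (qq RR m).
Local Notation h2 := (h2 RR m n).
Local Notation omega := (omega RR m n k).
Variables xp xm xi : 'I_N -> nat -> E.
Implicit Types i j : 'I_N.

(* xi_i (z) as a series in z^-1, and the coefficients t_{i,s} of its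
   logarithm. *)
Definition xi_gen i : fps E := FPS (fun s => if s is s'.+1 then h2 *: xi i s' else 1).
Definition tcoef i (s : nat) : E := fcoef (flog (xi_gen i)) s.+1.

Definition Bser i (w : R) : E :=
  endo_sum (fun s => (w ^+ s / s`!%:R) *: tcoef i s).

Definition Hser i j : fps C :=
  if i == j then
    exdiv (n%:R * fvar C)
      (fexpX C^o (n%:R / 2%:R) - fexpX C^o (- (n%:R / 2%:R)) : fps C)
  else
    exdiv (fconst (omega ^- i - omega ^- j))
      (fconst (omega ^- i) * (fexpX C^o (n%:R / 2%:R) : fps C) -
       fconst (omega ^- j) * (fexpX C^o (- (n%:R / 2%:R)) : fps C)).
Definition Gser i j : fps C := flog (L := C^o) (Hser i j).

(* - B_j (- d/dv) (d/dv) G_{i,j} (v) *)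
Definition gamma i j : fps E :=
  FPS (fun l => endo_sum (fun s =>
    (- ((-1) ^+ s / s`!%:R *
        hcst (fcoef (iter s.+1 (@fderiv C) (Gser i j)) l))) *: tcoef j s)).

(* (hbar_2 / (m (q - q^-1))) ^ (1/2), with constant term 1. *)
Definition gsqrt : R :=
  xget 0 [set c | c ^+ 2 * (m%:R * (q - q^-1)) = hb2 RR /\
                  order_ge 1 (c - 1)]%classic.

Definition gexponent i : fps E :=
  FPS (fun l => (2%:R : R)^-1 *:
    \sum_(j < N | (j == i %[mod m])%N) fcoef (gamma i j) l).

(* The constant term of the exponent is not zero, but its powers tend to 0. *)
Definition gser i : fps E :=
  FPS (fun l => gsqrt *: endo_sum (fun s =>
    (s`!%:R : R)^-1 *: fcoef (gexponent i ^+ s) l)).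

(* g^(l)_{i,s}, the coefficient of v^s in e^{l n v} g_i (v). *)
Definition gcoef (l : int) i (s : nat) : E :=
  fcoef (fexpX E (l%:~R * n%:R) * gser i) s.

Definition Phi (X : tor_gen m) : E :=
  match X with
  | Gen_h i0 l =>
      if l == 0 then \sum_(i < N | (i == i0 %[mod m])%N) xi i 0
      else exdivZ (n%:R *: \sum_(i < N | (i == i0 %[mod m])%N)
             hcst (omega ^ (- l * i%:Z)) *: Bser i (l%:~R * n%:R)) (q - q^-1)
  | Gen_e i0 l =>
      \sum_(i < N | (i == i0 %[mod m])%N) hcst (omega ^ (- l * i%:Z)) *:
        endo_sum (fun s => gcoef l i s * xp i s)
  | Gen_f i0 l =>
      \sum_(i < N | (i == i0 %[mod m])%N) hcst (omega ^ (- l * i%:Z)) *: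
        endo_sum (fun s => gcoef l i s * xm i s)
  end.

End Phi.

Arguments Phi {RR} m n k {r} xp xm xi X.

(* Main.v *)
(* Write N = mn, w = omega_{mn}, and for a row (a, s) let c be its content and
   x its position. Then chi = w^(1 - c) exp(n x), so that the factors of the
   toroidal and of the Yangian matrix coefficients are compared by
     Exp(Gam(d, y)) (exp(ny/2) - w^d exp(-ny/2)) = ny      if N | d,
                                                   1 - w^d otherwise,
   where Gam(d, y) = G_{i,j}(y) for i - j = d divisible by m, and Gam(d, y) = 0
   otherwise. Thus e_toroidal = e_Yangian * Exp(S_prec) and
   f_toroidal = f_Yangian * Exp(S_succ), up to a constant in f for m = 1, where
   S_prec and S_succ at a box are sums of differences of Gam over the preceding
   and the succeeding rows. By Taylor's formula g_i acts, before and after a box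
   is added, by Exp((S_prec + S_succ + corr) / 2) with a constant corr. Hence
   c_la = Exp(ell(la)) intertwines e and f as soon as
     ell(la + box) - ell(la) = (S_succ - S_prec + corr) / 2,
   and since Gam(-d, -y) = Gam(d, y) this system is integrable: the interaction
   of two boxes is symmetric. The Cartan generators are diagonal on both sides
   and are matched through logarithmic derivatives. For uniqueness, every tuple
   of partitions is reached from the empty one by adding boxes, and the
   coefficients of e do not vanish: by non-resonance, a zero of a numerator
   would be a zero of a denominator for another tuple of partitions. *)
Require Import Defs.
From HB Require Import structures.
From mathcomp Require Import all_boot all_order all_algebra.
From mathcomp Require Import boolp classical_sets functions reals trigo.
From mathcomp Require Import complex.
From mathcomp Require Import finmap.
From mathcomp.multinomials Require Import monalg.
From mathcomp Require Import zify ring.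

Set Implicit Arguments.
Unset Strict Implicit.
Unset Printing Implicit Defensive.

Import GRing.Theory.
Local Open Scope ring_scope.

(** * Formal power series *)

(** All exponentials and kernels are computed in C[[hbar_1, hbar_2]], where sums converge adically,
    and reach R through [hemb]. In R, multiplication by a fixed element may lower the order, and
    neither [h2] nor [q - q^-1] is among the inverted elements, so each division by them needs a
    divisibility proof.

    The halves come from the use of one series g_i for both e and f: e calls for S_prec and f for
    S_succ, g_i supplies their mean, and the normalisation c absorbs the difference. The row of the
    box itself belongs to neither sum. It contributes corr - Gam(0, h2); the square root in g_i
    equals Exp(Gam(0, h2) / 2) and removes the second term, while corr vanishes for m > 1 and, for m
    = 1, accounts for the scalar factors in f and x^-.

    The symmetry behind integrability combines two signs. One box more in a row changes the kernel
    sum by [theta], which is antisymmetric in the two boxes; exchanging the boxes also exchanges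
    preceding and succeeding rows. In particular [theta] vanishes on the diagonal, so a box does not
    influence its own factor, and g_i takes the same value before and after it is added. *)

Section FpsBasics.
Variable T : nzRingType.
Implicit Types (f g : fps T) (c : T).

Lemma fcoefD f g i : fcoef (f + g) i = fcoef f i + fcoef g i.
Proof. by []. Qed.
Lemma fcoefN f i : fcoef (- f) i = - fcoef f i.
Proof. by []. Qed.
Lemma fcoefB f g i : fcoef (f - g) i = fcoef f i - fcoef g i.
Proof. by []. Qed.
Lemma fcoef0 i : fcoef (0 : fps T) i = 0.
Proof. by []. Qed.
Lemma fcoef1 i : fcoef (1 : fps T) i = (i == 0%N)%:R.
Proof. by []. Qed.
Lemma fcoefME f g n :
  fcoef (f * g) n = \sum_(i < n.+1) fcoef f i * fcoef g (n - i).
Proof. by []. Qed.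

Lemma fcoef_sum I (r : seq I) (P : pred I) (F : I -> fps T) i :
  fcoef (\sum_(k <- r | P k) F k) i = \sum_(k <- r | P k) fcoef (F k) i.
Proof. exact: (big_morph (fun f : fps T => fcoef f i)). Qed.

Lemma fcoefM0 f g : fcoef (f * g) 0 = fcoef f 0 * fcoef g 0.
Proof. by rewrite fcoefME big_ord1. Qed.

Lemma fcoefCM c f i : fcoef (fconst c * f) i = c * fcoef f i.
Proof.
rewrite fcoefME big_ord_recl /= subn0 mulr1n big1 ?addr0 // => k _.
by rewrite mulr0n mul0r.
Qed.

Lemma fcoefXM f i : fcoef (fvar T * f) i = if i is j.+1 then fcoef f j else 0.
Proof.
rewrite fcoefME; case: i => [|i]; first by rewrite big_ord1 /= mul0r.
rewrite 2!big_ord_recl /= mul0r add0r mul1r subn1 /= big1 ?addr0 // => k _.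
by rewrite mul0r.
Qed.

Fact fconst_additive : zmod_morphism (@fconst T).
Proof. by move=> a b; apply: fpsP => i /=; rewrite mulrnBl. Qed.
Fact fconst_multiplicative : monoid_morphism (@fconst T).
Proof.
split=> // a b; apply: fpsP => i; rewrite fcoefCM /=.
by case: i => [|i]; rewrite ?mulr1n ?mulr0n ?mulr0.
Qed.
HB.instance Definition _ :=
  GRing.isZmodMorphism.Build T (fps T) (@fconst T) fconst_additive.
HB.instance Definition _ :=
  GRing.isMonoidMorphism.Build T (fps T) (@fconst T) fconst_multiplicative.

Definition fge (k : nat) f := forall i, (i < k)%N -> fcoef f i = 0.

Lemma fgeM a b f g : fge a f -> fge b g -> fge (a + b) (f * g).
Proof.
move=> fa gb i lti; rewrite fcoefME big1 // => j _.
have [/fa->|leaj] := ltnP j a; first by rewrite mul0r.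
by rewrite gb ?mulr0 //; have := ltn_ord j; lia.
Qed.

Lemma fgeX f k : fge 1 f -> fge k (f ^+ k).
Proof.
move=> f1; elim: k => [|k IH] //; rewrite exprS -add1n.
exact: fgeM.
Qed.

Lemma fge1 f : fcoef f 0 = 0 -> fge 1 f.
Proof. by move=> f0 [|]. Qed.

End FpsBasics.

Section FpsDerivation.
Variable T : comNzRingType.
Implicit Types (f g : fps T) (c : T).

Lemma fgeomK c : fgeom c * (1 - fconst c * fvar T) = 1.
Proof.
apply: fpsP => -[|i]; rewrite mulrC mulrBl mul1r -mulrA fcoefB fcoefCM fcoefXM.
  by rewrite mulr0 subr0.
by rewrite /= -exprS subrr.
Qed.

Lemma fcoef_deriv f i : fcoef (fderiv f) i = fcoef f i.+1 *+ i.+1.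
Proof. by []. Qed.

Fact fderiv_additive : zmod_morphism (@fderiv T).
Proof. by move=> f g; apply: fpsP => i /=; rewrite mulrnBl. Qed.
HB.instance Definition _ :=
  GRing.isZmodMorphism.Build (fps T) (fps T) (@fderiv T) fderiv_additive.

Lemma fderivB f g : fderiv (f - g) = fderiv f - fderiv g.
Proof. exact: fderiv_additive. Qed.

Lemma fderivC c : fderiv (fconst c) = 0.
Proof. by apply: fpsP => i /=; rewrite mulr0n mul0rn. Qed.

Lemma fderiv1 : fderiv (1 : fps T) = 0.
Proof. exact: fderivC. Qed.

Lemma fderiv_var : fderiv (fvar T) = 1.
Proof. by apply: fpsP => -[|i] //=; rewrite mul0rn. Qed.

Lemma fderivM f g : fderiv (f * g) = fderiv f * g + f * fderiv g.
Proof.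
apply: fpsP => n; rewrite fcoefD !fcoefME.
transitivity (\sum_(i < n.+2) (fcoef f i * fcoef g (n.+1 - i)) *+ i +
  \sum_(i < n.+2) (fcoef f i * fcoef g (n.+1 - i)) *+ (n.+1 - i)).
  rewrite [LHS]/= -sumrMnl -big_split /=; apply: eq_bigr => i _.
  rewrite -mulrnDr; congr (_ *+ _); have := ltn_ord i; lia.
congr (_ + _).
  rewrite big_ord_recl mulr0n add0r; apply: eq_bigr => i _ /=.
  by rewrite mulrnAl subSS.
rewrite big_ord_recr /= subnn mulr0n addr0; apply: eq_bigr => i _ /=.
by rewrite mulrnAr subSn // leq_ord.
Qed.

Lemma fderivCM c f : fderiv (fconst c * f) = fconst c * fderiv f.
Proof. by rewrite fderivM fderivC mul0r add0r. Qed.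

Lemma fderivX f k : fderiv (f ^+ k) = (f ^+ k.-1 * fderiv f) *+ k.
Proof.
elim: k => [|k IH]; first by rewrite mulr0n fderiv1.
rewrite exprS fderivM IH mulrnAr mulrA mulrSr addrC /=; congr (_ + _).
  by case: k {IH} => [|k]; rewrite ?mulr0n // -exprS.
by rewrite mulrC.
Qed.

(** Division-free form of [L = f' / f], meaningful over any commutative ring. It turns products into
    sums and, over a domain with invertible integers, determines [f] up to its constant term. *)
Definition logd L f := fderiv f = L * f.

Lemma logdM L M f g : logd L f -> logd M g -> logd (L + M) (f * g).
Proof. by rewrite /logd fderivM => -> ->; ring. Qed.

Lemma logd1 : logd 0 1.
Proof. by rewrite /logd fderiv1 mul0r. Qed.

Lemma logdC c L f : logd L f -> logd L (fconst c * f).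
Proof. by rewrite /logd fderivCM mulrCA => ->. Qed.

Lemma fderiv_geom c : fderiv (fgeom c) = fconst c * fgeom c ^+ 2.
Proof.
have := congr1 (@fderiv T) (fgeomK c).
rewrite fderivM fderiv1 raddfB /= fderiv1 fderivCM fderiv_var mulr1 sub0r => h.
have /= := congr1 ( *%R^~ (fgeom c)) h.
rewrite mul0r mulrDl -mulrA [_ * fgeom c]mulrC fgeomK mulr1 mulrN mulNr.
by move/eqP; rewrite subr_eq0 => /eqP->; rewrite mulrAC mulrC expr2.
Qed.

(** The logarithmic derivative is [a / (1 - a t) - b / (1 - b t)], whose coefficients are
    differences of powers. The factors of both psi and xi reduce to this shape. *)
Lemma logd_quot a b :
  logd (FPS (fun i => a ^+ i.+1 - b ^+ i.+1))
       ((1 - fconst b * fvar T) * fgeom a).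
Proof.
have -> : FPS (fun i => a ^+ i.+1 - b ^+ i.+1) =
    fconst a * fgeom a - fconst b * fgeom b.
  by apply: fpsP => i; rewrite fcoefB !fcoefCM /= -!exprS.
rewrite /logd fderivM fderiv_geom raddfB /= fderiv1 fderivCM fderiv_var.
rewrite mulr1 sub0r; have := fgeomK b; set u := 1 - _ => gu.
transitivity (fconst a * fgeom a ^+ 2 * u - fconst b * fgeom a * (fgeom b * u)).
  by rewrite gu; ring.
ring.
Qed.

End FpsDerivation.

(** [flog] and [fexp] for a ring over itself, with products in place of scalings: here the
    derivation and [logd] are available. *)
Definition plog (K : comUnitRingType) (H : fps K) : fps K :=
  FPS (fun i => \sum_(1 <= k < i.+1)
    ((-1) ^+ k.-1 / k%:R) * fcoef ((H - 1) ^+ k) i).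

Definition pexp (K : comUnitRingType) (F : fps K) : fps K :=
  FPS (fun i => \sum_(0 <= k < i.+1) k`!%:R^-1 * fcoef (F ^+ k) i).

Lemma flog_regular (K : comUnitRingType) (H : fps K) :
  flog (L := K^o) H = plog H.
Proof. by []. Qed.

Section FpsExpLog.
Variable K : idomainType.
Hypothesis natU : forall n, (n.+1%:R : K) \is a GRing.unit.
Implicit Types (f g F H : fps K).

Let nat0 n : (n.+1%:R : K) != 0.
Proof. by apply: contraTneq (natU n) => ->; rewrite unitr0. Qed.

(** Comparing coefficients in [h' = L h] expresses [(i + 1) h_(i+1)] by lower coefficients, so a
    solution without constant term vanishes. Identities between exponentials and logarithms are
    reduced to this. *)
Lemma logd_unique L f g :
  logd L f -> logd L g -> fcoef f 0 = fcoef g 0 -> f = g.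
Proof.
move=> lf lg e0; apply: subr0_eq.
have : logd L (f - g) by rewrite /logd raddfB /= lf lg mulrBr.
have : fcoef (f - g) 0 = 0 by rewrite fcoefB e0 subrr.
move: (f - g) => h h0 lh; apply: fpsP; elim/ltn_ind => -[|i] // IH.
have /= := congr1 (fun h : fps K => fcoef h i) lh.
rewrite big1 => [|j _]; last by rewrite (IH (i - j)%N) ?mulr0 // ltnS leq_subr.
by move/eqP; rewrite -mulr_natr mulf_eq0 (negPf (nat0 i)) orbF => /eqP.
Qed.

(** Replaces the logarithm by one polynomial in [H - 1] valid in all degrees up to [M], on which the
    derivation acts termwise. *)
Lemma plogE H M i : fcoef H 0 = 1 -> (i <= M)%N ->
  fcoef (plog H) i =
  fcoef (\sum_(1 <= k < M.+1) fconst ((-1) ^+ k.-1 / k%:R) * (H - 1) ^+ k) i.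
Proof.
move=> H0 iM; rewrite fcoef_sum.
rewrite [RHS](@big_cat_nat _ _ _ i.+1) // [X in _ = _ + X]big_nat.
rewrite [X in _ = _ + X]big1 ?addr0.
  by apply: eq_bigr => k _; rewrite fcoefCM.
move=> k /andP[ik _]; rewrite fcoefCM (@fgeX _ _ k) ?mulr0 //.
by apply: fge1; rewrite fcoefB H0 subrr.
Qed.

Lemma pexpE F M i : fcoef F 0 = 0 -> (i <= M)%N ->
  fcoef (pexp F) i =
  fcoef (\sum_(0 <= k < M.+1) fconst (k`!%:R^-1) * F ^+ k) i.
Proof.
move=> F0 iM; rewrite fcoef_sum.
rewrite [RHS](@big_cat_nat _ _ _ i.+1) // [X in _ = _ + X]big_nat.
rewrite [X in _ = _ + X]big1 ?addr0.
  by apply: eq_bigr => k _; rewrite fcoefCM.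
move=> k /andP[ik _]; rewrite fcoefCM (@fgeX _ _ k) ?mulr0 //.
exact: fge1.
Qed.

Lemma plog0 H : fcoef (plog H) 0 = 0.
Proof. by rewrite /= big_geq. Qed.

Lemma pexp0 F : fcoef (pexp F) 0 = 1.
Proof. by rewrite /= big_nat1 expr0 invr1 mulr1. Qed.

Lemma fcoefM_eq f f' g g' i :
  (forall j, (j <= i)%N -> fcoef f j = fcoef f' j) ->
  (forall j, (j <= i)%N -> fcoef g j = fcoef g' j) ->
  fcoef (f * g) i = fcoef (f' * g') i.
Proof.
move=> ef eg; rewrite !fcoefME; apply: eq_bigr => j _.
by rewrite ef ?eg ?leq_subr // -ltnS.
Qed.

(** On the truncation, the derivative produces the geometric sum of the powers of [- u], with
    [u = H - 1]; the error [(- u) ^+ i.+1] has no coefficient in degree [i]. *)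
Lemma fderiv_plog H : fcoef H 0 = 1 ->
  fderiv (plog H) * H = fderiv H.
Proof.
move=> H0; apply: fpsP => i; set u := H - 1.
have u1 : fge 1 u by apply: fge1; rewrite fcoefB H0 subrr.
pose P := \sum_(1 <= k < i.+2) fconst ((-1) ^+ k.-1 / k%:R) * u ^+ k.
transitivity (fcoef (fderiv P * H) i).
  apply: fcoefM_eq => // j ji.
  by rewrite !fcoef_deriv (@plogE H i.+1).
have dP : fderiv P = fderiv u * \sum_(k < i.+1) (- u) ^+ k.
  rewrite raddf_sum /= big_add1 /= big_mkord mulr_sumr; apply: eq_bigr => k _.
  rewrite fderivCM fderivX /= mulrnAr -mulrnAl -rmorphMn /= -mulr_natr.
  by rewrite divrK // rmorphXn /= rmorphN1 [(- u) ^+ k]exprNn mulrA mulrC.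
have eH : H = 1 - - u by rewrite opprK /u addrC subrK.
have geo : (\sum_(k < i.+1) (- u) ^+ k) * H = 1 - (- u) ^+ i.+1.
  by rewrite eH mulrC -opprB mulNr -subrX1 opprB.
rewrite dP -mulrA geo mulrBr mulr1 fcoefB [X in _ - X](@fgeM _ 0 i.+1) ?subr0 //.
  by rewrite /u fderivB fderiv1 subr0.
by apply: fgeX => j j1; rewrite fcoefN u1 ?oppr0.
Qed.

Lemma fderiv_pexp F : fcoef F 0 = 0 ->
  fderiv (pexp F) = fderiv F * pexp F.
Proof.
move=> F0; apply: fpsP => i.
pose P M := \sum_(0 <= k < M.+1) fconst (k`!%:R^-1) * F ^+ k.
transitivity (fcoef (fderiv (P i.+1)) i).
  by rewrite !fcoef_deriv (@pexpE F i.+1).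
have -> : fderiv (P i.+1) = fderiv F * P i.
  rewrite /P big_nat_recl //= raddfD /= expr0 mulr1 fderivC add0r.
  rewrite raddf_sum /= mulr_sumr; apply: eq_bigr => k _.
  rewrite fderivCM fderivX /= mulrnAr -mulrnAl -rmorphMn /= -mulr_natr.
  have fU : (k`!%:R : K) \is a GRing.unit.
    by rewrite -(prednK (fact_gt0 k)) natU.
  by rewrite factS natrM invrM // divrK // mulrA mulrC.
by apply: fcoefM_eq => // j ji; rewrite (@pexpE F i).
Qed.

Lemma logd_pexp F : fcoef F 0 = 0 ->
  logd (fderiv F) (pexp F).
Proof. exact: fderiv_pexp. Qed.

(** Both sides solve [y' = (plog H)' y] with constant term 1. *)
Lemma pexp_plog H : fcoef H 0 = 1 ->
  pexp (plog H) = H.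
Proof.
move=> H0; apply: (@logd_unique (fderiv (plog H))).
- by apply: logd_pexp; rewrite plog0.
- by rewrite /logd fderiv_plog.
- by rewrite pexp0 H0.
Qed.

Lemma logd_plog L H : fcoef H 0 = 1 -> logd L H ->
  fderiv (plog H) = L.
Proof.
move=> H0 lH; have Hn0 : H != 0.
  by apply/eqP => H00; move: H0; rewrite H00 => /eqP; rewrite eq_sym oner_eq0.
by apply: (mulIf Hn0); rewrite fderiv_plog.
Qed.

End FpsExpLog.

(** * Evaluation of series in C[[hbar_1, hbar_2]] *)

Section AdicSeries.
Variable RR : realType.
Local Notation C := (RR[i]).
Local Notation A := (hseries RR).
Implicit Types (a b x y : A) (u : nat -> A) (F G : fps C) (f g : fps A).

Lemma mpower0 a : mpower 0 a.
Proof. by []. Qed.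

Lemma mpowerW d e a : (d <= e)%N -> mpower e a -> mpower d a.
Proof. by move=> de ae i j /leq_trans/(_ de); apply: ae. Qed.

Lemma mpower_0 d : mpower d (0 : A).
Proof. by []. Qed.

Lemma mpowerD d a b : mpower d a -> mpower d b -> mpower d (a + b).
Proof. by move=> ad bd i j ij; rewrite !fcoefD ad ?bd ?addr0. Qed.

Lemma mpowerN d a : mpower d a -> mpower d (- a).
Proof. by move=> ad i j ij; rewrite !fcoefN ad ?oppr0. Qed.

Lemma mpowerB d a b : mpower d a -> mpower d b -> mpower d (a - b).
Proof. by move=> ad bd; apply/mpowerD/mpowerN. Qed.

Lemma mpower_sum d I (r : seq I) (P : pred I) (h : I -> A) :
  (forall i, P i -> mpower d (h i)) -> mpower d (\sum_(i <- r | P i) h i).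
Proof. by move=> hd; elim/big_ind: _ => // *; apply: mpowerD. Qed.

Lemma mpowerM d e a b : mpower d a -> mpower e b -> mpower (d + e) (a * b).
Proof.
move=> ad be i j ij; rewrite fcoefME fcoef_sum big1 // => s _.
rewrite fcoefME big1 // => t _.
have [lt|ge] := ltnP (t + s) d; first by rewrite ad ?mul0r.
by rewrite be ?mulr0 //; have := ltn_ord s; have := ltn_ord t; lia.
Qed.

Lemma mpowerMl d a b : mpower d b -> mpower d (a * b).
Proof. by move=> bd; rewrite -[d]add0n; apply: mpowerM. Qed.

Lemma mpowerX x k : mpower 1 x -> mpower k (x ^+ k).
Proof.
by move=> x1; elim: k => [|k IH] //; rewrite exprS -add1n; apply: mpowerM.
Qed.

Lemma mpower_eq a b : (forall d, mpower d (a - b)) -> a = b.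
Proof.
move=> ab; apply: subr0_eq; apply: fpsP => j; apply: fpsP => i.
exact: (ab (i + j).+1).
Qed.

Fact hsC_additive : zmod_morphism (@hsC RR).
Proof. by move=> a b; rewrite /hsC !rmorphB. Qed.
Fact hsC_multiplicative : monoid_morphism (@hsC RR).
Proof. by split=> [|a b]; rewrite /hsC ?rmorph1 // !rmorphM. Qed.
HB.instance Definition _ :=
  GRing.isZmodMorphism.Build C A (@hsC RR) hsC_additive.
HB.instance Definition _ :=
  GRing.isMonoidMorphism.Build C A (@hsC RR) hsC_multiplicative.

Lemma hsC_inj : injective (@hsC RR).
Proof.
by move=> a b /(congr1 (fun x : A => fcoef (fcoef x 0) 0)).
Qed.

Lemma natC_neq0 n : (n.+1%:R : C) != 0.
Proof. by rewrite Num.Theory.pnatr_eq0. Qed.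

Lemma natC_unit n : (n.+1%:R : C) \is a GRing.unit.
Proof. by rewrite unitfE natC_neq0. Qed.

Lemma factC_neq0 n : (n`!%:R : C) != 0.
Proof. by rewrite Num.Theory.pnatr_eq0 -lt0n fact_gt0. Qed.

(* The sum of a series whose k-th term lies in the k-th power of the maximal
   ideal. *)
Definition ssum u : A := FPS (fun j => FPS (fun i =>
  \sum_(0 <= k < (i + j).+1) fcoef (fcoef (u k) j) i)).

Definition summable u := forall k, mpower k (u k).

Lemma ssum_trunc u d K : summable u -> (forall k, (K <= k)%N -> mpower d (u k)) ->
  mpower d (ssum u - \sum_(0 <= k < K) u k).
Proof.
move=> us ud i j ij; rewrite !fcoefB !fcoef_sum.
(* Both truncations are prolonged by vanishing terms to a common length. *)
have ext K' : (K' <= maxn K (i + j).+1)%N ->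
    (forall k, (K' <= k)%N -> fcoef (fcoef (u k) j) i = 0) ->
    \sum_(0 <= k < K') fcoef (fcoef (u k) j) i =
    \sum_(0 <= k < maxn K (i + j).+1) fcoef (fcoef (u k) j) i.
  move=> K'M z; rewrite [RHS](@big_cat_nat _ _ _ K') //.
  rewrite [X in _ = _ + X]big_nat [X in _ = _ + X]big1 ?addr0 // => k /andP[/z].
  by [].
rewrite [X in X - _](ext (i + j).+1) ?leq_maxr // => [|k lt]; last first.
  by apply: us; apply: leq_trans lt; lia.
rewrite [X in _ - X](ext K) ?subrr ?leq_maxl // => k /ud; exact.
Qed.

Lemma ssum_truncd u d K : summable u -> (d <= K)%N ->
  mpower d (ssum u - \sum_(0 <= k < K) u k).
Proof.
move=> us dK; apply: ssum_trunc => // k Kk.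
exact: mpowerW (leq_trans dK Kk) (us k).
Qed.

Lemma ssum_mpower u d : summable u -> (forall k, mpower d (u k)) ->
  mpower d (ssum u).
Proof.
move=> us ud; have := @ssum_trunc u d 0 us (fun k _ => ud k).
by rewrite big_geq // subr0.
Qed.

Lemma eq_ssum u v : u =1 v -> ssum u = ssum v.
Proof. by move=> /funext ->. Qed.

Lemma ssumP u l : summable u ->
  (forall d, mpower d (l - \sum_(0 <= k < d) u k)) -> ssum u = l.
Proof.
move=> us h; apply: mpower_eq => d.
have -> : ssum u - l = (ssum u - \sum_(0 <= k < d) u k) -
  (l - \sum_(0 <= k < d) u k) by ring.
by apply: mpowerB => //; apply: ssum_truncd.
Qed.

Lemma summableM a u : summable u -> summable (fun k => a * u k).
Proof. by move=> us k; apply: mpowerMl. Qed.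

Lemma summableD u v : summable u -> summable v -> summable (fun k => u k + v k).
Proof. by move=> us vs k; apply: mpowerD. Qed.

Lemma ssumM a u : summable u -> ssum (fun k => a * u k) = a * ssum u.
Proof.
move=> us; apply: ssumP => [|d]; first exact: summableM.
by rewrite -mulr_sumr -mulrBr; apply/mpowerMl/ssum_truncd.
Qed.

Lemma ssumD u v : summable u -> summable v ->
  ssum (fun k => u k + v k) = ssum u + ssum v.
Proof.
move=> us vs; apply: ssumP => [|d]; first exact: summableD.
rewrite big_split /= opprD addrACA.
by apply: mpowerD; apply: ssum_truncd.
Qed.

Lemma ssumN u : summable u -> ssum (fun k => - u k) = - ssum u.
Proof.
move=> us; rewrite -mulN1r -ssumM //; apply: eq_ssum => k.
by rewrite mulN1r.
Qed.

Lemma ssumB u v : summable u -> summable v ->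
  ssum (fun k => u k - v k) = ssum u - ssum v.
Proof.
move=> us vs; rewrite ssumD ?ssumN // => k; exact: mpowerN.
Qed.

Lemma ssum1 u : summable u -> (forall k, u k.+1 = 0) -> ssum u = u 0%N.
Proof.
move=> us u0; apply: ssumP => // -[|d]; first exact: mpower0.
rewrite big_nat_recl // big1 => [|k _]; last by rewrite u0.
by rewrite addr0 subrr.
Qed.

Lemma ssum_rec u : summable u -> summable (fun k => u k.+1) ->
  ssum u = u 0%N + ssum (fun k => u k.+1).
Proof.
move=> us us'; apply: ssumP => // d; case: d => [|d]; first exact: mpower0.
rewrite big_nat_recl // opprD addrACA subrr add0r.
by apply: ssum_trunc => // k dk; apply: mpowerW (us k.+1).
Qed.

Lemma sum_triangle (u : nat -> nat -> A) d :
  \sum_(0 <= l < d) \sum_(0 <= k < d - l) u l k =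
  \sum_(0 <= n < d) \sum_(0 <= l < n.+1) u l (n - l)%N.
Proof.
elim: d => [|d IH]; first by rewrite !big_geq.
rewrite !big_nat_recr //= -IH subSn // subnn big_nat1 addrA; congr (_ + _).
rewrite -big_split /= !big_nat; apply: eq_bigr => l /andP[_ ld].
by rewrite subSn 1?ltnW // big_nat_recr.
Qed.

(** Up to order [d] only the pairs with [l + k < d] contribute; both sides are compared with this
    finite triangle. *)
Lemma ssum_diag (u : nat -> nat -> A) :
  (forall l k, mpower (l + k) (u l k)) ->
  ssum (fun l => ssum (u l)) =
  ssum (fun n => \sum_(0 <= l < n.+1) u l (n - l)%N).
Proof.
move=> us; have us1 l : summable (u l).
  by move=> k; apply: mpowerW (us l k); rewrite leq_addl.
have us2 l : mpower l (ssum (u l)).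
  by apply: ssum_mpower => // k; apply: mpowerW (us l k); rewrite leq_addr.
have us3 : summable (fun n => \sum_(0 <= l < n.+1) u l (n - l)%N).
  move=> n; rewrite big_nat; apply: mpower_sum => l /andP[_ ln].
  by have := us l (n - l)%N; rewrite subnKC.
apply: ssumP => // d; set S := ssum _.
have -> : S - \sum_(0 <= l < d) ssum (u l) =
    (S - \sum_(0 <= n < d) \sum_(0 <= l < n.+1) u l (n - l)%N) -
    \sum_(0 <= l < d) (ssum (u l) - \sum_(0 <= k < d - l) u l k).
  by rewrite sumrB sum_triangle; ring.
apply: mpowerB; first exact: ssum_truncd.
apply: mpower_sum => l _; apply: ssum_trunc => // k lk.
by apply: mpowerW (us l k); lia.
Qed.

Lemma ssum_exchange (u : nat -> nat -> A) :
  (forall l k, mpower (l + k) (u l k)) ->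
  ssum (fun l => ssum (u l)) = ssum (fun k => ssum (u^~ k)).
Proof.
move=> us; rewrite !ssum_diag // => [|l k]; last by rewrite addnC.
apply: eq_ssum => n; rewrite big_nat_rev /= !big_nat.
by apply: eq_bigr => l /andP[_ ln]; rewrite add0n subSS subKn.
Qed.

Lemma ssum_sum I (r : seq I) (P : pred I) (u : I -> nat -> A) :
  (forall i, P i -> summable (u i)) ->
  ssum (fun k => \sum_(i <- r | P i) u i k) = \sum_(i <- r | P i) ssum (u i).
Proof.
move=> us; apply: ssumP => [k|d]; first by apply: mpower_sum => i /us.
rewrite exchange_big -sumrB /=; apply: mpower_sum => i /us ui.
exact: ssum_truncd.
Qed.

(** The coefficients may lie in [A] itself, as those of Taylor shifts and of the exponent of g_i do;
    [ev] is the case of scalar coefficients. *)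
Definition evA f x : A := ssum (fun k => fcoef f k * x ^+ k).
Definition cmap F : fps A := FPS (fun k => hsC (fcoef F k)).
Definition ev F x : A := evA (cmap F) x.
Definition eser : fps C := FPS (fun k => k`!%:R^-1).
Definition Exp x : A := ev eser x.

Section Evaluation.
Variable x : A.
Hypothesis x1 : mpower 1 x.

Lemma evA_summable f : summable (fun k => fcoef f k * x ^+ k).
Proof. by move=> k; apply/mpowerMl/mpowerX. Qed.

Lemma evAD f g : evA (f + g) x = evA f x + evA g x.
Proof.
rewrite /evA -ssumD; try exact: evA_summable.
by apply: eq_ssum => k; rewrite mulrDl.
Qed.

Lemma evAN f : evA (- f) x = - evA f x.
Proof.
rewrite /evA -ssumN; try exact: evA_summable.
by apply: eq_ssum => k; rewrite mulNr.
Qed.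

Lemma evAM f g : evA (f * g) x = evA f x * evA g x.
Proof.
pose w l k := (fcoef f l * x ^+ l) * (fcoef g k * x ^+ k).
have wP l k : mpower (l + k) (w l k).
  by apply: mpowerM; apply: evA_summable.
transitivity (ssum (fun l => ssum (w l))); last first.
  rewrite mulrC -ssumM; last exact: evA_summable.
  apply: eq_ssum => l; rewrite mulrC -ssumM //; exact: evA_summable.
rewrite ssum_diag //; apply: eq_ssum => n.
rewrite fcoefME mulr_suml big_mkord; apply: eq_bigr => l _.
by rewrite /w mulrACA -exprD subnKC // -ltnS.
Qed.

Lemma evA_const c : evA (fconst c) x = c.
Proof.
rewrite /evA ssum1; first by rewrite expr0 mulr1 /= mulr1n.
  exact: evA_summable.
by move=> k /=; rewrite mulr0n mul0r.
Qed.

Lemma evA1 : evA 1 x = 1.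
Proof. exact: evA_const. Qed.

Lemma evA_var : evA (fvar A) x = x.
Proof.
apply: ssumP => [|d]; first exact: evA_summable.
case: d => [|[|d]]; rewrite ?big_nat1 ?mul0r ?subr0 //.
rewrite !big_nat_recl // big1 => [|k _]; last by rewrite mul0r.
by rewrite /= mul0r mul1r add0r addr0 subrr.
Qed.

Lemma evAX f k : evA (f ^+ k) x = evA f x ^+ k.
Proof. by elim: k => [|k IH]; rewrite ?evA1 // !exprS evAM IH. Qed.

Lemma evA_sum I (r : seq I) (P : pred I) (h : I -> fps A) :
  evA (\sum_(i <- r | P i) h i) x = \sum_(i <- r | P i) evA (h i) x.
Proof.
apply: (big_morph (evA^~ x)) => [f g|]; first exact: evAD.
by rewrite -(rmorph0 (@fconst A)) evA_const.
Qed.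

Lemma cmapM F G : cmap (F * G) = cmap F * cmap G.
Proof.
apply: fpsP => n; rewrite [RHS]fcoefME /cmap /= rmorph_sum.
by apply: eq_bigr => i _; rewrite rmorphM.
Qed.

Lemma cmapD F G : cmap (F + G) = cmap F + cmap G.
Proof. by apply: fpsP => n; rewrite /= rmorphD. Qed.

Lemma cmapN F : cmap (- F) = - cmap F.
Proof. by apply: fpsP => n; rewrite /= rmorphN. Qed.

Lemma cmapC c : cmap (fconst c) = fconst (hsC c).
Proof. by apply: fpsP => n; rewrite /= rmorphMn. Qed.

Lemma cmap_var : cmap (fvar C) = fvar A.
Proof. by apply: fpsP => n; rewrite /= rmorph_nat. Qed.

Lemma evM F G : ev (F * G) x = ev F x * ev G x.
Proof. by rewrite /ev cmapM evAM. Qed.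
Lemma evD F G : ev (F + G) x = ev F x + ev G x.
Proof. by rewrite /ev cmapD evAD. Qed.
Lemma evN F : ev (- F) x = - ev F x.
Proof. by rewrite /ev cmapN evAN. Qed.
Lemma evB F G : ev (F - G) x = ev F x - ev G x.
Proof. by rewrite evD evN. Qed.
Lemma ev_const c : ev (fconst c) x = hsC c.
Proof. by rewrite /ev cmapC evA_const. Qed.
Lemma ev_var : ev (fvar C) x = x.
Proof. by rewrite /ev cmap_var evA_var. Qed.

Lemma ev_mpower F : fcoef F 0 = 0 -> mpower 1 (ev F x).
Proof.
move=> F0; apply: ssum_mpower => [|[|k]]; first exact: evA_summable.
  by rewrite /= F0 rmorph0 mul0r.
exact: (@mpowerW 1 k.+1 _ isT (evA_summable (cmap F) (k := k.+1))).
Qed.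

End Evaluation.

Lemma ev_at0 F : ev F 0 = hsC (fcoef F 0).
Proof.
rewrite /ev /evA ssum1; first by rewrite expr0 mulr1.
  by apply: evA_summable.
by move=> k; rewrite expr0n mulr0.
Qed.

Lemma Exp0 : Exp 0 = 1.
Proof. by rewrite /Exp ev_at0 /= invr1 rmorph1. Qed.

Lemma ExpD x y : mpower 1 x -> mpower 1 y -> Exp (x + y) = Exp x * Exp y.
Proof.
move=> x1 y1.
pose w l k := (fcoef (cmap eser) l * x ^+ l) * (fcoef (cmap eser) k * y ^+ k).
have wP l k : mpower (l + k) (w l k).
  by apply: mpowerM; apply: evA_summable.
transitivity (ssum (fun l => ssum (w l))); last first.
  rewrite mulrC -ssumM; last exact: evA_summable.
  apply: eq_ssum => l; rewrite mulrC -ssumM //; exact: evA_summable.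
rewrite ssum_diag //; apply: eq_ssum => n.
rewrite addrC exprDn mulr_sumr big_mkord; apply: eq_bigr => l _.
have ln : (l <= n)%N by rewrite -ltnS.
have e : l`!%:R^-1 * (n - l)`!%:R^-1 = n`!%:R^-1 * 'C(n, l)%:R :> C.
  rewrite -(bin_fact ln) !natrM.
  have := factC_neq0 l; have := factC_neq0 (n - l).
  have : ('C(n, l)%:R : C) != 0.
    by rewrite Num.Theory.pnatr_eq0 -lt0n bin_gt0.
  by move=> ? ? ?; field; apply/and3P.
rewrite /w mulrACA /= -[hsC _ * hsC _]rmorphM /= e rmorphM rmorph_nat -mulr_natr.
ring.
Qed.

Lemma Exp_mpower x : mpower 1 x -> mpower 1 (Exp x - 1).
Proof.
move=> x1; have -> : Exp x - 1 = ev (eser - 1) x.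
  by rewrite evB // (ev_const x1 1) rmorph1.
by apply: ev_mpower => //=; rewrite mulr1n invr1 subrr.
Qed.

Lemma ExpN x : mpower 1 x -> Exp x * Exp (- x) = 1.
Proof. by move=> x1; rewrite -ExpD ?subrr ?Exp0 //; apply: mpowerN. Qed.

Lemma Exp_neq0 x : mpower 1 x -> Exp x != 0.
Proof.
move=> x1; apply/eqP => e; have := ExpN x1.
by rewrite e mul0r => /eqP; rewrite eq_sym oner_eq0.
Qed.

Lemma mpowerMn d a n : mpower d a -> mpower d (a *+ n).
Proof. by move=> ad; rewrite -mulr_natl; apply: mpowerMl. Qed.

Lemma Exp_sum I (r : seq I) (P : pred I) (h : I -> A) :
  (forall i, P i -> mpower 1 (h i)) ->
  Exp (\sum_(i <- r | P i) h i) = \prod_(i <- r | P i) Exp (h i).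
Proof.
move=> h1.
suff [] : mpower 1 (\sum_(i <- r | P i) h i) /\
  Exp (\sum_(i <- r | P i) h i) = \prod_(i <- r | P i) Exp (h i) by [].
elim/big_rec2: _ => [|i a b Pi [b1 <-]]; first by rewrite Exp0.
by split; [apply/mpowerD/b1/h1|rewrite ExpD //; apply: h1].
Qed.

End AdicSeries.

(** * Composition with exponentials and Taylor shifts *)

Section Composition.
Variable RR : realType.
Local Notation C := (RR[i]).
Local Notation A := (hseries RR).
Implicit Types (a b x y : A) (F G : fps C) (f g : fps A).

Lemma fcoef_varXM (T : nzRingType) (f : fps T) s n :
  fcoef (fvar T ^+ s * f) n = if (s <= n)%N then fcoef f (n - s) else 0.
Proof.
elim: s n => [|s IH] n; first by rewrite mul1r subn0.
by rewrite exprS -mulrA fcoefXM; case: n => [|n].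
Qed.

Lemma evX F x k : mpower 1 x -> ev (F ^+ k) x = ev F x ^+ k.
Proof.
move=> x1; elim: k => [|k IH]; last by rewrite !exprS evM // IH.
by rewrite (ev_const x1 1) rmorph1.
Qed.

(** Writing [F = t F1] shows that [F ^+ s] starts in degree [s], so both sides are rearrangements of
    one double series whose terms have order [s + l]. *)
Lemma Exp_ev F x : mpower 1 x -> fcoef F 0 = 0 ->
  Exp (ev F x) = ev (pexp F) x.
Proof.
move=> x1 F0; pose F1 := FPS (fun i => fcoef F i.+1).
have eF : F = fvar C * F1 by apply: fpsP => -[|i]; rewrite fcoefXM.
pose w s l := hsC s`!%:R^-1 * (hsC (fcoef (F1 ^+ s) l) * x ^+ (s + l)).
have wP s l : mpower (s + l) (w s l) by do 2!apply: mpowerMl; apply: mpowerX.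
have wS s : summable (w s) by move=> l; apply: mpowerW (wP s l); rewrite leq_addl.
transitivity (ssum (fun s => ssum (w s))).
  apply: eq_ssum => s; rewrite ssumM /=; last first.
    by move=> l; apply/mpowerMl/(@mpowerW _ _ (s + l))/mpowerX => //; lia.
  congr (_ * _); rewrite eF evM // ev_var // exprMn -evX // -ssumM.
    by apply: eq_ssum => l; rewrite exprD mulrCA.
  exact: evA_summable.
rewrite ssum_diag //; apply: eq_ssum => n.
rewrite /= rmorph_sum mulr_suml !big_nat; apply: eq_bigr => s /andP[_ sn].
rewrite /w subnKC // mulrA -rmorphM eF exprMn fcoef_varXM.
by rewrite -ltnS sn.
Qed.

Definition pexpX (c : C) : fps C := FPS (fun i => c ^+ i / i`!%:R).

Lemma fexpX_regular (c : C) : fexpX C^o c = pexpX c :> fps C.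
Proof. by apply: fpsP => i; rewrite /= [LHS]mulr1. Qed.

Lemma ev_pexpX c x : ev (pexpX c) x = Exp (hsC c * x).
Proof.
apply: eq_ssum => k.
by rewrite [LHS]/= exprMn -rmorphXn mulrA -rmorphM [_ * c ^+ k]mulrC.
Qed.

Lemma Exp_plog H x : mpower 1 x -> fcoef H 0 = 1 -> Exp (ev (plog H) x) = ev H x.
Proof.
move=> x1 H0; rewrite (Exp_ev x1 (plog0 H)).
by rewrite (pexp_plog (@natC_unit RR) H0).
Qed.

(** The coefficient of degree [l] in the divided derivative of order [k] of [F]. *)
Definition tayc F l k : C := fcoef F (l + k) *+ 'C(l + k, k).

(** The expansion of [F (x + y)] in powers of [x], with coefficients in [A]. *)
Definition shift F y : fps A :=
  FPS (fun l => ssum (fun k => hsC (tayc F l k) * y ^+ k)).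

Lemma shift_summable F l y : mpower 1 y ->
  summable (fun k => hsC (tayc F l k) * y ^+ k).
Proof. by move=> y1 k; apply/mpowerMl/mpowerX. Qed.

Lemma evA_shift F x y : mpower 1 x -> mpower 1 y ->
  evA (shift F y) x = ev F (x + y).
Proof.
move=> x1 y1; pose w l k := (hsC (tayc F l k) * y ^+ k) * x ^+ l.
have wP l k : mpower (l + k) (w l k).
  by rewrite addnC; apply: mpowerM; [apply/mpowerMl/mpowerX|apply: mpowerX].
transitivity (ssum (fun l => ssum (w l))).
  apply: eq_ssum => l; rewrite mulrC -ssumM; last exact: shift_summable.
  by apply: eq_ssum => k; rewrite mulrC.
rewrite ssum_diag //; apply: eq_ssum => n.
rewrite addrC exprDn mulr_sumr big_mkord; apply: eq_bigr => l _ /=.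
have ln : (l <= n)%N by rewrite -ltnS.
rewrite /w /tayc subnKC // bin_sub // rmorphMn -[in RHS]mulrnAr.
by rewrite -!mulrA -mulr_natl -[in LHS]mulr_natl; ring.
Qed.

(** Unlike in [pexp], the constant term need not vanish: it suffices that all coefficients lie in
    the maximal ideal. This is how the exponential in [gser] converges. *)
Definition compexp f : fps A :=
  FPS (fun l => ssum (fun s => hsC s`!%:R^-1 * fcoef (f ^+ s) l)).

Lemma fcoefX_mpower f s l : (forall k, mpower 1 (fcoef f k)) ->
  mpower s (fcoef (f ^+ s) l).
Proof.
move=> f1; elim: s l => [|s IH] l //; rewrite exprS fcoefME.
by apply: mpower_sum => i _; rewrite -add1n; apply: mpowerM.
Qed.

Lemma compexp_summable f l : (forall k, mpower 1 (fcoef f k)) ->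
  summable (fun s => hsC s`!%:R^-1 * fcoef (f ^+ s) l).
Proof. by move=> f1 s; apply/mpowerMl/fcoefX_mpower. Qed.

(** The sum over the powers of [f] is interchanged with the evaluation, which is multiplicative. *)
Lemma Exp_evA f x : mpower 1 x -> (forall k, mpower 1 (fcoef f k)) ->
  evA (compexp f) x = Exp (evA f x).
Proof.
move=> x1 f1.
pose w l s := (hsC s`!%:R^-1 * fcoef (f ^+ s) l) * x ^+ l.
have wP l s : mpower (l + s) (w l s).
  rewrite addnC; apply: mpowerM; last exact: mpowerX.
  exact: compexp_summable.
transitivity (ssum (fun l => ssum (w l))).
  apply: eq_ssum => l; rewrite mulrC -ssumM; last exact: compexp_summable.
  by apply: eq_ssum => s; rewrite mulrC.
rewrite ssum_exchange //; apply: eq_ssum => s.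
rewrite -evAX // -ssumM; last exact: evA_summable.
by apply: eq_ssum => l; rewrite /w mulrA.
Qed.

Lemma fcoef_iter_deriv F s l :
  fcoef (iter s (@fderiv C) F) l = fcoef F (l + s) *+ (l + s) ^_ s.
Proof.
elim: s l => [|s IH] l; first by rewrite addn0 ffactn0 mulr1n.
rewrite iterS fcoef_deriv IH -mulrnA addSnnS ffactnSr; congr (_ *+ (_ * _)).
by rewrite addnS subSn ?leq_addl // addnK.
Qed.

(** The weight [1 / s!] comes from B_j, and [1 / (s + 1)] from integrating the logarithmic
    derivative of xi_j; together with [s + 1] derivatives they form the divided derivative in
    Taylor's formula. *)
Lemma taylor_coef F s l :
  fcoef (iter s.+1 (@fderiv C) F) l * (s`!%:R^-1 * s.+1%:R^-1) = tayc F l s.+1.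
Proof.
rewrite fcoef_iter_deriv /tayc; move: (fcoef F _) => c.
have e : (((l + s.+1) ^_ s.+1)%:R : C) =
    'C(l + s.+1, s.+1)%:R * (s.+1%:R * s`!%:R).
  by rewrite -!natrM -factS bin_ffact.
rewrite -[c *+ _]mulr_natr e -[RHS]mulr_natr.
move: ('C(_, _)%:R) (s`!%:R) (s.+1%:R) (factC_neq0 RR s) (natC_neq0 RR s).
by move=> x y z y0 z0; field; apply/andP.
Qed.

End Composition.

(** * The order filtration of R and limits *)

Section OrderFiltration.
Variable RR : realType.
Local Notation C := (RR[i]).
Local Notation A := (hseries RR).
Local Notation R := (hloc RR).
Implicit Types (a b : A) (x y z : R) (nus : seq C).

Lemma hemb_inj : injective (@hemb RR).
Proof.
by move=> a b /(congr1 val) /= /eqP; rewrite tofrac_eq => /eqP.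
Qed.

Fact hemb_additive : zmod_morphism (@hemb RR).
Proof. by move=> a b; apply: val_inj; rewrite [RHS]rmorphB /= tofracB. Qed.
Fact hemb_multiplicative : monoid_morphism (@hemb RR).
Proof.
split=> [|a b]; apply: val_inj; first by rewrite [RHS]rmorph1 /= rmorph1.
by rewrite [RHS]rmorphM /= tofracM.
Qed.
HB.instance Definition _ :=
  GRing.isZmodMorphism.Build A R (@hemb RR) hemb_additive.
HB.instance Definition _ :=
  GRing.isMonoidMorphism.Build A R (@hemb RR) hemb_multiplicative.

Lemma hemb_neq0 a : (hemb a != 0) = (a != 0).
Proof. by rewrite -(rmorph0 (@hemb RR)) (inj_eq hemb_inj). Qed.

Lemma hloc_frac x : exists a nus, x * hemb (hden nus) = hemb a.
Proof.
have /asboolP[a [nus e]] := valP x.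
exists a, nus; apply: val_inj; rewrite rmorphM /= e mulfVK //.
by rewrite tofrac_eq0 hden_neq0.
Qed.

Lemma mpower1P a : fcoef (fcoef a 0) 0 = 0 -> mpower 1 a.
Proof.
move=> a0 i j; rewrite ltnS leqn0 addn_eq0 => /andP[/eqP-> /eqP->].
exact: a0.
Qed.

Lemma mpower_hs1 : mpower 1 (hs1 RR).
Proof. exact: mpower1P. Qed.

Lemma mpower_hs2 : mpower 1 (hs2 RR).
Proof. exact: mpower1P. Qed.

Lemma mpower_hden nus : mpower (size nus) (hden nus).
Proof.
rewrite /hden; elim: nus => [|nu nus IH]; first exact: mpower0.
rewrite big_cons /= -add1n; apply: mpowerM => //.
apply: mpowerB; first exact: mpower_hs1.
exact/mpowerMl/mpower_hs2.
Qed.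

(** In degree [(i + 1, j)] the product has the coefficient [a_(i, j) - nu a_(i+1, j-1)], indices
    being the powers of hbar_1 and hbar_2: induction on [j]. *)
Lemma mpower_linear_cancel nu d a :
  mpower d.+1 ((hs1 RR - hsC nu * hs2 RR) * a) -> mpower d a.
Proof.
have hs1E i j : fcoef (fcoef (hs1 RR * a) j) i.+1 = fcoef (fcoef a j) i.
  by rewrite /hs1 fcoefCM fcoefXM.
have hs2E i j : fcoef (fcoef (hsC nu * (hs2 RR * a)) j) i =
    nu * (if j is j'.+1 then fcoef (fcoef a j') i else 0).
  by rewrite /hsC !fcoefCM /hs2 fcoefXM; case: j.
move=> h i j; elim: j i => [|j IH] i ij.
  have := h i.+1 0%N ij; rewrite mulrBl -mulrA !fcoefB hs1E hs2E.
  by rewrite mulr0 subr0.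
have := h i.+1 j.+1; rewrite mulrBl -mulrA !fcoefB hs1E hs2E IH; last lia.
by rewrite mulr0 subr0; apply.
Qed.

Lemma mpower_hden_cancel nus d a :
  mpower (d + size nus) (hden nus * a) -> mpower d a.
Proof.
rewrite /hden; elim: nus d => [|nu nus IH] d.
  by rewrite big_nil mul1r addn0.
rewrite big_cons -mulrA /= addnS => /mpower_linear_cancel; exact: IH.
Qed.

(** No order is gained by writing a series as a fraction, since a factor [hden nus] in a product
    accounts for at most [size nus] of its order. *)
Lemma order_ge_hemb d a : order_ge d (hemb a) <-> mpower d a.
Proof.
split=> [[b [nus [e bd]]]|ad].
  apply: (@mpower_hden_cancel nus).
  by move: e; rewrite -rmorphM /= => /hemb_inj; rewrite mulrC => ->.
exists a, [::]; split; last by rewrite addn0.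
by rewrite /hden big_nil rmorph1 mulr1.
Qed.

Lemma order_ge0 d : order_ge d (0 : R).
Proof. by rewrite -(rmorph0 (@hemb RR)); apply/order_ge_hemb. Qed.

Lemma order_geN d x : order_ge d x -> order_ge d (- x).
Proof.
move=> [a [nus [e ad]]]; exists (- a), nus.
by split; [rewrite mulNr e rmorphN|apply: mpowerN].
Qed.

Lemma order_geD d x y : order_ge d x -> order_ge d y -> order_ge d (x + y).
Proof.
move=> [a [nus [e ad]]] [b [mus [e' bd]]].
exists (a * hden mus + b * hden nus), (nus ++ mus); split.
  have gen (T : comNzRingType) (s t p q : T) :
    (s + t) * (p * q) = s * p * q + t * q * p by ring.
  by rewrite hden_cat rmorphD !rmorphM /= -e -e' gen.
rewrite size_cat; apply: mpowerD.
  by rewrite addnA; apply/mpowerM/mpower_hden.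
by rewrite [(size nus + _)%N]addnC addnA; apply/mpowerM/mpower_hden.
Qed.

(** The loss is bounded by the number of linear factors in a denominator of [z], uniformly in [x]:
    this makes multiplication by [z] continuous. *)
Lemma order_geM_loss z : exists e, forall d x, order_ge (d + e) x ->
  order_ge d (z * x).
Proof.
have [b [mus e']] := hloc_frac z; exists (size mus) => d x [a [nus [e ad]]].
exists (b * a), (mus ++ nus); split.
  by rewrite hden_cat !rmorphM /= -e -e' mulrACA.
by rewrite size_cat addnA; apply: mpowerMl.
Qed.

(** The filtration is separated, whence the uniqueness of limits in R and on the Fock space. *)
Lemma order_ge_eq0 x : (forall d, order_ge d x) -> x = 0.
Proof.
move=> xd; have [a [nus e]] := hloc_frac x.
have [l hl] := order_geM_loss (hemb (hden nus)).
have a0 : a = 0.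
  apply: mpower_eq => d; rewrite subr0; apply/order_ge_hemb.
  by rewrite -e mulrC; apply: hl.
apply/eqP; have /eqP := e; rewrite a0 rmorph0 mulf_eq0 => /orP[//|].
by rewrite -[_ == 0]negbK hemb_neq0 hden_neq0.
Qed.

Lemma hseries_to_unique (u : nat -> R) k l :
  hseries_to u k -> hseries_to u l -> k = l.
Proof.
move=> uk ul; apply: subr0_eq; apply: order_ge_eq0 => d.
have [K kK] := uk d; have [L lL] := ul d; pose M := maxn K L.
have -> : k - l = (\sum_(0 <= i < M) u i - l) - (\sum_(0 <= i < M) u i - k).
  by rewrite opprB [RHS]addrC addrA subrK.
apply: order_geD; first by apply: lL; rewrite leq_maxr.
by apply: order_geN; apply: kK; rewrite leq_maxl.
Qed.

Lemma hseries_to_ssum (u : nat -> A) : summable u ->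
  hseries_to (fun k => hemb (u k)) (hemb (ssum u)).
Proof.
move=> us d; exists d => k dk; rewrite -rmorph_sum -rmorphB /= -opprB.
by apply/order_ge_hemb/mpowerN/ssum_truncd.
Qed.

Lemma hsumP (u : nat -> R) l : hseries_to u l -> hsum u = l.
Proof.
move=> ul; rewrite /hsum; case: xgetP => [x _ ux|/(_ l)//].
exact: hseries_to_unique ux ul.
Qed.

Lemma natR_neq0 n : (n.+1%:R : R) != 0.
Proof.
rewrite -(rmorph_nat (@hemb RR)) hemb_neq0 -(rmorph_nat (@hsC RR)).
by rewrite -(rmorph0 (@hsC RR)) (inj_eq (@hsC_inj RR)) natC_neq0.
Qed.

Lemma hemb_unit a b : a * b = 1 -> hemb a \is a GRing.unit.
Proof.
move=> ab; apply/(@cunitPl R _ (hemb b)).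
by rewrite -rmorphM mulrC ab rmorph1.
Qed.

Lemma hemb_inv a b : a * b = 1 -> (hemb a)^-1 = hemb b.
Proof.
move=> ab; apply: (mulrI (hemb_unit ab)).
by rewrite mulrV ?(hemb_unit ab) // -rmorphM ab rmorph1.
Qed.

Lemma hcst_inv (c : C) : c != 0 -> (hcst c)^-1 = hcst c^-1.
Proof. by move=> c0; apply: hemb_inv; rewrite -rmorphM mulfV ?rmorph1. Qed.

Lemma hcst_unit (c : C) : c != 0 -> hcst c \is a GRing.unit.
Proof.
by move=> c0; apply: (@hemb_unit _ (hsC c^-1)); rewrite -rmorphM mulfV ?rmorph1.
Qed.

Lemma hcst_nat n : hcst n%:R = n%:R :> R.
Proof. by rewrite /hcst !rmorph_nat. Qed.

Lemma natR_unit n : (n.+1%:R : R) \is a GRing.unit.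
Proof. by rewrite -hcst_nat hcst_unit ?natC_neq0. Qed.

Lemma natR_inv n : (0 < n)%N -> (n%:R : R)^-1 = hcst n%:R^-1.
Proof.
by case: n => // n _; rewrite -hcst_nat hcst_inv ?natC_neq0.
Qed.

Lemma hexp_hemb a : mpower 1 a -> hexp (hemb a) = hemb (Exp a).
Proof.
move=> a1; apply: hsumP.
have := hseries_to_ssum (evA_summable a1 (cmap (eser RR))).
congr hseries_to; apply/funext => k; rewrite natR_inv ?fact_gt0 //.
by rewrite -rmorphXn -rmorphM /= mulrC.
Qed.

End OrderFiltration.

(** * Operators on the Fock space *)

Section FockLimits.
Variables (RR : realType) (r : nat).
Local Notation R := (hloc RR).
Local Notation M := (fock RR r).
Local Notation E := (fock_endo RR r).
Implicit Types (x y : M) (U : nat -> M) (la mu : mpart r).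

Lemma fcoeffD x y la : (x + y)@_la = x@_la + y@_la.
Proof. exact: mcoeffD. Qed.
Lemma fcoeffN x la : (- x)@_la = - x@_la.
Proof. exact: mcoeffN. Qed.
Lemma fcoeffZ (c : R) x la : (c *: x)@_la = c * x@_la.
Proof. exact: mcoeffZ. Qed.
Lemma fcoeff_sum I (s : seq I) (P : pred I) (h : I -> M) la :
  (\sum_(i <- s | P i) h i)@_la = \sum_(i <- s | P i) (h i)@_la.
Proof. exact: (raddf_sum (mcoeff la)). Qed.
Lemma fcoeff_ket mu la : (ket RR mu)@_la = (mu == la)%:R.
Proof. by rewrite mcoeffU. Qed.

Lemma fockP x y : (forall la, x@_la = y@_la) -> x = y.
Proof. by move=> xy; apply/malgP. Qed.

Lemma fock_to_unique U x y : fock_to U x -> fock_to U y -> x = y.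
Proof.
move=> Ux Uy; apply: fockP => la; apply: (@hseries_to_unique _ (fun i => (U i)@_la)).
  move=> d; have [K KP] := Ux d; exists K => k /KP/(_ la).
  by rewrite fcoeffD fcoeffN fcoeff_sum.
move=> d; have [K KP] := Uy d; exists K => k /KP/(_ la).
by rewrite fcoeffD fcoeffN fcoeff_sum.
Qed.

Lemma fock_toZ (c : R) U x : fock_to U x -> fock_to (fun i => c *: U i) (c *: x).
Proof.
move=> Ux d; have [e eP] := order_geM_loss c; have [K KP] := Ux (d + e)%N.
exists K => k /KP h la; rewrite -scaler_sumr -scalerBr fcoeffZ.
exact: eP.
Qed.

Lemma fock_toD U V x y : fock_to U x -> fock_to V y ->
  fock_to (fun i => U i + V i) (x + y).
Proof.
move=> Ux Vy d; have [K KP] := Ux d; have [L LP] := Vy d.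
exists (maxn K L) => k; rewrite geq_max => /andP[/KP h1 /LP h2] la.
rewrite big_split /= opprD addrACA fcoeffD.
exact: order_geD.
Qed.

Lemma fock_to0 : fock_to (fun=> 0) (0 : M).
Proof.
move=> d; exists 0%N => k _ la; rewrite big1 // subr0 mcoeff0.
exact: order_ge0.
Qed.

Lemma fock_to_sum I (s : seq I) (P : pred I) (U : I -> nat -> M) (x : I -> M) :
  (forall i, P i -> fock_to (U i) (x i)) ->
  fock_to (fun k => \sum_(i <- s | P i) U i k) (\sum_(i <- s | P i) x i).
Proof.
move=> Ux; elim: s => [|i s IH].
  by rewrite big_nil; under eq_fun do rewrite big_nil; apply: fock_to0.
rewrite big_cons; under eq_fun do rewrite big_cons.
by case: ifP => // Pi; apply: fock_toD; first exact: Ux.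
Qed.

Lemma fock_to_ket (u : nat -> R) l mu : hseries_to u l ->
  fock_to (fun i => u i *: ket RR mu) (l *: ket RR mu).
Proof.
move=> ul d; have [K KP] := ul d; exists K => k /KP h la.
rewrite -scaler_suml -scalerBl fcoeffZ fcoeff_ket.
by case: eqP => _; rewrite ?mulr1 ?mulr0 //; apply: order_ge0.
Qed.

Lemma lin_extE (f : mpart r -> M) x :
  lin_ext f x = \sum_(la <- msupp x) x@_la *: f la.
Proof. by []. Qed.

Lemma endo_sumP (U : nat -> E) (T : E) : endo_to U T -> endo_sum U = T.
Proof.
move=> UT; rewrite /endo_sum; case: xgetP => [S _ US|/(_ T)//].
by apply: endoP => w; apply: fock_to_unique (US w) (UT w).
Qed.

Lemma endoZ (T : E) (c : R) x : T (c *: x) = c *: T x.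
Proof.
have T0 : T 0 = 0.
  have := endoD T 0 0; rewrite addr0 => /esym/eqP.
  by rewrite -subr_eq0 addrK => /eqP.
by rewrite -{1}[c *: x]addr0 endo_linear T0 [LHS]addr0.
Qed.

Lemma endo_sumr (T : E) I (s : seq I) (P : pred I) (h : I -> M) :
  T (\sum_(i <- s | P i) h i) = \sum_(i <- s | P i) T (h i).
Proof.
apply: (big_morph T) => [x y|]; first exact: endoD.
by have := endoZ T 0 0; rewrite !scale0r.
Qed.

Lemma fock_decomp x : x = \sum_(la <- msupp x) x@_la *: ket RR la.
Proof.
rewrite {1}[x]monalgE; apply: eq_bigr => la _.
by apply: fockP => mu; rewrite fcoeffZ fcoeff_ket mcoeffU mulr_natr.
Qed.

Lemma lin_ext_ket (f : mpart r -> M) la : (lin_ext f : E) (ket RR la) = f la.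
Proof.
have e : msupp (ket RR la) = [fset la]%fset.
  by rewrite /ket msuppU oner_eq0.
rewrite lin_extE e big_seq_fset1 mcoeffU eqxx.
exact: scale1r.
Qed.

(* Opaque copies of the operators and basis vectors: failing conversion
   problems between the originals unfold them down to the field of fractions. *)
Fact kt_sig : {kt : mpart r -> M | kt = @ket RR r}.
Proof. by exists (@ket RR r). Qed.
Definition kt := sval kt_sig.
Fact ap_sig : {ap : E -> M -> M | ap = fun T => T}.
Proof. by exists (fun T => T). Qed.
Definition ap := sval ap_sig.
Fact lx_sig : {lx : (mpart r -> M) -> E | lx = @lin_ext R (mpart r)}.
Proof. by exists (@lin_ext R (mpart r)). Qed.
Definition lx := sval lx_sig.
Fact dg_sig : {dg : (mpart r -> R) -> E | dg = @diag R (mpart r)}.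
Proof. by exists (@diag R (mpart r)). Qed.
Definition dg := sval dg_sig.
Fact es_sig : {es : (nat -> E) -> E | es = @endo_sum RR r}.
Proof. by exists (@endo_sum RR r). Qed.
Definition es := sval es_sig.

Lemma ktE : kt = @ket RR r. Proof. exact: (svalP kt_sig). Qed.
Lemma apE : ap = fun T => T. Proof. exact: (svalP ap_sig). Qed.
Lemma lxE : lx = @lin_ext R (mpart r). Proof. exact: (svalP lx_sig). Qed.
Lemma dgE : dg = @diag R (mpart r). Proof. exact: (svalP dg_sig). Qed.
Lemma esE : es = @endo_sum RR r. Proof. exact: (svalP es_sig). Qed.

Lemma fcoeff_kt mu la : (kt mu)@_la = (mu == la)%:R.
Proof. by rewrite ktE fcoeff_ket. Qed.

Lemma fock_to_kt (u : nat -> R) l mu : hseries_to u l ->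
  fock_to (fun i => u i *: kt mu) (l *: kt mu).
Proof. by rewrite ktE; apply: fock_to_ket. Qed.

Lemma apZ T (c : R) x : ap T (c *: x) = c *: ap T x.
Proof. by rewrite apE endoZ. Qed.

Lemma ap_sumr T I (s : seq I) (P : pred I) (h : I -> M) :
  ap T (\sum_(i <- s | P i) h i) = \sum_(i <- s | P i) ap T (h i).
Proof. by rewrite apE endo_sumr. Qed.

Lemma ap_suml I (s : seq I) (P : pred I) (T : I -> E) x :
  ap (\sum_(i <- s | P i) T i) x = \sum_(i <- s | P i) ap (T i) x.
Proof. by rewrite apE; exact: (big_morph (fun T : E => T x)). Qed.

Lemma apM S T x : ap (S * T) x = ap S (ap T x).
Proof. by rewrite apE. Qed.

Lemma apD S T x : ap (S + T) x = ap S x + ap T x.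
Proof. by rewrite apE. Qed.

Lemma ap1 x : ap 1 x = x.
Proof. by rewrite apE. Qed.

Lemma ap0 x : ap 0 x = 0.
Proof. by rewrite apE. Qed.

Lemma apZl (c : R) S x : ap (c *: S) x = c *: ap S x.
Proof. by rewrite apE. Qed.

Lemma ap_eq (S T : E) : (forall la, ap S (kt la) = ap T (kt la)) -> S = T.
Proof.
rewrite apE ktE => ST; apply: endoP => x; rewrite [x]fock_decomp.
rewrite [LHS]endo_sumr [RHS]endo_sumr; apply: eq_bigr => la _.
by rewrite [LHS]endoZ [RHS]endoZ ST.
Qed.

Lemma ap_lx f la : ap (lx f) (kt la) = f la.
Proof. by rewrite apE lxE ktE lin_ext_ket. Qed.

Lemma ap_dg c la : ap (dg c) (kt la) = c la *: kt la.
Proof. by rewrite apE dgE ktE; exact: lin_ext_ket. Qed.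

(** Convergence on basis vectors is enough, every vector being a finite combination of them. *)
Lemma es_lx (f : nat -> mpart r -> M) (g : mpart r -> M) :
  (forall la, fock_to (f^~ la) (g la)) -> es (fun s => lx (f s)) = lx g.
Proof.
rewrite esE lxE => fg; apply: endo_sumP => w.
under eq_fun do rewrite lin_extE.
by rewrite lin_extE; apply: fock_to_sum => la _; apply: fock_toZ.
Qed.

Lemma dg_lx c : dg c = lx (fun la => c la *: kt la).
Proof. by apply: ap_eq => la; rewrite ap_dg ap_lx. Qed.

Lemma dgM c d : dg c * dg d = dg (fun la => c la * d la).
Proof.
apply: ap_eq => la; rewrite apM ap_dg apZ ap_dg [RHS]ap_dg scalerA.
by congr (_ *: _); exact: mulrC.
Qed.

Lemma dgD c d : dg c + dg d = dg (fun la => c la + d la).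
Proof. by apply: ap_eq => la; rewrite apD 2!ap_dg [RHS]ap_dg scalerDl. Qed.

Lemma dgZ (a : R) c : a *: dg c = dg (fun la => a * c la).
Proof. by apply: ap_eq => la; rewrite apZl ap_dg [RHS]ap_dg scalerA. Qed.

Lemma dg1 : 1 = dg (fun=> 1).
Proof. by apply: ap_eq => la; rewrite ap1 ap_dg scale1r. Qed.

Lemma dg0 : 0 = dg (fun=> 0).
Proof. by apply: ap_eq => la; rewrite ap0 ap_dg scale0r. Qed.

Lemma dg_sum I (s : seq I) (P : pred I) (c : I -> mpart r -> R) :
  \sum_(i <- s | P i) dg (c i) = dg (fun la => \sum_(i <- s | P i) c i la).
Proof.
apply: ap_eq => la; rewrite ap_suml [RHS]ap_dg scaler_suml.
by apply: eq_bigr => i _; rewrite ap_dg.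
Qed.

Lemma es_dg (u : nat -> mpart r -> R) (l : mpart r -> R) :
  (forall la, hseries_to (u^~ la) (l la)) -> es (fun s => dg (u s)) = dg l.
Proof.
move=> ul; under eq_fun do rewrite dg_lx.
by rewrite dg_lx; apply: es_lx => la; apply: fock_to_kt.
Qed.

(** Series of diagonal operators are encoded by their eigenvalues on each basis vector: products,
    powers and logarithms in the non-commutative [fps E] become those of the commutative [fps R]. *)
Definition dfps (F : mpart r -> fps R) : fps E :=
  FPS (fun s => dg (fun la => fcoef (F la) s)).

Lemma dfpsM (F G : mpart r -> fps R) :
  dfps F * dfps G = dfps (fun la => F la * G la).
Proof.
apply: fpsP => n; rewrite fcoefME [RHS]/= -dg_sum; apply: eq_bigr => i _.
exact: dgM.
Qed.

Lemma dfps1 : 1 = dfps (fun=> 1).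
Proof.
apply: fpsP => -[|n] /=; first by rewrite mulr1n [LHS]dg1.
by rewrite mulr0n [LHS]dg0.
Qed.

Lemma dfpsX (F : mpart r -> fps R) k :
  dfps F ^+ k = dfps (fun la => F la ^+ k).
Proof.
elim: k => [|k IH]; first by rewrite expr0 dfps1.
rewrite exprS IH dfpsM; congr dfps; apply/funext => la.
by rewrite exprS.
Qed.

Lemma dfpsB1 (F : mpart r -> fps R) :
  dfps F - 1 = dfps (fun la => F la - 1).
Proof.
apply: fpsP => n; rewrite fcoefB dfps1 [LHS]/= -[- dg _]scaleN1r.
rewrite dgZ dgD [RHS]/=; congr dg; apply/funext => la.
by rewrite mulN1r.
Qed.

Lemma flog_dfps (F : mpart r -> fps R) :
  flog (L := E) (dfps F) = dfps (fun la => plog (F la)).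
Proof.
apply: fpsP => n; rewrite [RHS]/= -dg_sum [LHS]/=; apply: eq_bigr => k _.
by rewrite dfpsB1 dfpsX [fcoef _ _]/= dgZ.
Qed.

End FockLimits.

(** * Tuples of partitions and sums over rows *)

Section Partitions.
Variable r : nat.
Implicit Types (la mu : mpart r) (a b : 'I_r) (s l M : nat).

Lemma lam_cutoff la a s : (cutoff la <= s)%N -> lam la a s = 0%N.
Proof.
move=> h; rewrite /lam nth_default //; have : (size (la a) < cutoff la)%N.
  by rewrite ltnS; apply: leq_bigmax.
by move: h; case: s => [|s] /=; lia.
Qed.

Lemma lam0 a s : lam (mpart0 r) a s = 0%N.
Proof. by rewrite /lam ffunE nth_nil. Qed.

Lemma addable_gt0 la b l : addable la b l -> (0 < l)%N.
Proof. by case/andP. Qed.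

Lemma addable_size la b l : addable la b l -> (l <= (size (la b)).+1)%N.
Proof.
case/andP=> l0 /andP[_ n0]; rewrite leqNgt; apply/negP => lt.
case/negP: n0; apply/(nthP 0%N); exists (size (la b)).
  by rewrite size_incr_nth; case: ifP; lia.
by rewrite nth_incr_nth nth_default // addn0; case: eqP => //; lia.
Qed.

Lemma addable_cutoff la b l : addable la b l -> (l <= cutoff la)%N.
Proof.
move/addable_size => /leq_trans; apply; rewrite ltnS.
exact: leq_bigmax.
Qed.

Lemma lam_add_box la b l a s : addable la b l -> (0 < s)%N ->
  lam (add_box la b l) a s = (lam la a s + ((a == b) && (s == l)))%N.
Proof.
move=> al s0; have l0 := addable_gt0 al; case/andP: al => _ al.
rewrite /lam /add_box /with_part ffunE; case: eqP => [->|_] /=; last first.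
  by rewrite addn0.
rewrite insubdK // nth_incr_nth addnC; congr (_ + nat_of_bool _)%N.
by apply/eqP/eqP; lia.
Qed.

Lemma cutoff_add_box la b l : addable la b l ->
  (cutoff la <= cutoff (add_box la b l))%N.
Proof.
move=> al; case/andP: (al) => _ al'.
rewrite ltnS; apply/bigmax_leqP => a _; apply: leq_trans (leq_bigmax a).
rewrite /add_box /with_part ffunE; case: eqP => [->|//].
by rewrite insubdK // size_incr_nth; case: ifP => // /negbT; lia.
Qed.

Lemma add_box_inj la b l b' l' : addable la b l -> addable la b' l' ->
  add_box la b l = add_box la b' l' -> (b, l) = (b', l').
Proof.
move=> al al' e.
have h : lam (add_box la b l) b l = lam (add_box la b' l') b l by rewrite e.
rewrite !lam_add_box ?(addable_gt0 al) ?(addable_gt0 al') // !eqxx in h.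
have : (b == b') && (l == l').
  by move: h; case: (b == b') => /=; case: (l == l') => /=; lia.
by case/andP=> /eqP-> /eqP->.
Qed.

Lemma part_geq (t : part) i j : (i <= j)%N -> (nth 0 t j <= nth 0 t i)%N.
Proof.
move=> ij; have /andP[st _] := valP t.
have [js|sj] := ltnP j (size t); last by rewrite nth_default.
have geT : transitive geq by move=> y x z yx zy; apply: leq_trans zy yx.
have geR : reflexive geq by move=> x; exact: leqnn.
have := sorted_leq_nth geT geR 0%N st; apply => //; rewrite inE //.
exact: leq_ltn_trans js.
Qed.

Lemma lam_geq la a s t : (0 < s)%N -> (s <= t)%N -> (lam la a t <= lam la a s)%N.
Proof. by move=> s0 st; apply: part_geq; lia. Qed.

Lemma addable_lt la b l s : addable la b l -> (0 < s)%N -> (s < l)%N ->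
  (lam la b l < lam la b s)%N.
Proof.
move=> al s0 sl; have l0 := addable_gt0 al.
have := lam_geq (add_box la b l) b s0 (ltnW sl).
rewrite !lam_add_box // !eqxx /= (ltn_eqF sl); lia.
Qed.

Definition boxes la : nat := \sum_(a < r) sumn (la a).

Lemma part_last (t : part) : t != part0 -> exists2 u : part,
  is_part (incr_nth u (size t).-1) /\ incr_nth u (size t).-1 = t &
  (sumn u < sumn t)%N.
Proof.
case: t => t pt; rewrite -val_eqE /=; case/lastP: t pt => [//|t x] pt _.
have [st nx] : sorted geq (rcons t x) /\ x != 0%N.
  case/andP: pt => -> /=; rewrite mem_rcons inE negb_or => /andP[x0 _].
  by rewrite eq_sym.
have n0 : 0%N \notin t.
  by case/andP: pt => _; rewrite mem_rcons inE negb_or => /andP[].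
case: x nx st pt => // x _ st pt.
(* The last part is now [x.+1]. Without its last box it is [x], and the row disappears when [x] is
   0, since a partition lists no zero parts. *)
pose u := if x == 0%N then t else rcons t x.
have pu : is_part u.
  rewrite /u /is_part; case: eqP => [_|/eqP x0].
    rewrite n0 andbT; case: t st {n0 pt u} => //= y t.
    by rewrite rcons_path => /andP[].
  rewrite mem_rcons inE negb_or eq_sym x0 n0 /= andbT.
  case: t st {n0 pt u} => //= y t.
  by rewrite !rcons_path => /andP[-> /= /ltnW].
exists (Part pu); rewrite /= ?size_rcons /=.
  suff -> : incr_nth u (size t) = rcons t x.+1 by [].
  apply: (@eq_from_nth _ 0%N).
    rewrite size_incr_nth /u; case: eqP => _; rewrite ?size_rcons ?ltnn //.
    by rewrite ltnSn.
  move=> i _; rewrite nth_incr_nth nth_rcons /u.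
  case: (x =P 0%N) => [->|_]; last first.
    by rewrite nth_rcons; case: (ltngtP i (size t)).
  case: (ltngtP i (size t)) => [lt|gt|->] //; last by rewrite nth_default.
  by rewrite nth_default // ltnW.
rewrite sumn_rcons /u; case: (x =P 0%N) => [->|_]; first by rewrite addn1.
by rewrite sumn_rcons addnS.
Qed.

Lemma mpart_ind (Q : mpart r -> Prop) : Q (mpart0 r) ->
  (forall la b l, addable la b l -> Q la -> Q (add_box la b l)) ->
  forall la, Q la.
Proof.
move=> Q0 QS la; move En: (boxes la) => n; elim/ltn_ind: n la En => n IH la En.
have [->//|] := eqVneq la (mpart0 r) => nz.
have [b lab] : exists b, la b != part0.
  apply/existsP; rewrite -negb_forall; apply: contra nz => /forallP h.
  by apply/eqP/ffunP => a; rewrite ffunE; apply/eqP.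
have [u [pu eu] su] := part_last lab.
pose mu : mpart r := [ffun a => if a == b then u else la a].
have mub : mu b = u by rewrite ffunE eqxx.
have sz : (0 < size (la b))%N.
  by rewrite lt0n size_eq0; apply: contra lab => /eqP e; apply/eqP/val_inj.
have al : addable mu b (size (la b)) by rewrite /addable sz mub.
have -> : la = add_box mu b (size (la b)).
  apply/ffunP => a; rewrite /add_box /with_part ffunE mub.
  case: eqP => [->|/eqP nab]; last by rewrite ffunE (negPf nab).
  by apply: val_inj; rewrite insubdK.
apply: QS => //; apply: (IH (boxes mu)) => //; rewrite -En /boxes.
rewrite (bigD1 b) // [X in (_ < X)%N](bigD1 b) //= mub -addSn.
apply: leq_add => //; rewrite leq_eqVlt; apply/orP; left; apply/eqP.
by apply: eq_bigr => a nab; rewrite ffunE (negPf nab).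
Qed.

End Partitions.

(** * Sums over rows *)

Section RowSums.
Variables (r : nat) (V : zmodType).
Implicit Types (la mu : mpart r) (a b : 'I_r) (s l M : nat).
Implicit Types (P : 'I_r -> nat -> bool).

(** The second sum runs one row further than the first, because beyond the partition the term
    [F1 a s] pairs with [F2 a s.+1]. *)
Definition rowsum M (P : 'I_r -> nat -> bool) (F1 F2 : 'I_r -> nat -> V) : V :=
  \sum_(a < r) \sum_(1 <= s < M.+1 | P a s) F1 a s +
  \sum_(a < r) \sum_(1 <= s < M.+2 | P a s) F2 a s.

Definition psum (N : nat) (p : 'I_r -> nat) la (P : 'I_r -> nat -> bool)
    (j : int) (F1 F2 : 'I_r -> nat -> V) : V :=
  (\sum_(a < r) \sum_(1 <= s < (cutoff la).+1 |
      P a s && (content p la a s == j %[mod N%:Z])%Z) F1 a s) +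
  (\sum_(a < r) \sum_(1 <= s < (cutoff la).+2 |
      P a s && (content p la a s == j + 1 %[mod N%:Z])%Z) F2 a s).

Lemma psum_rowsum N p la P j F1 F2 :
  psum N p la P j F1 F2 = rowsum (cutoff la) P
    (fun a s => if (content p la a s == j %[mod N%:Z])%Z then F1 a s else 0)
    (fun a s => if (content p la a s == j + 1 %[mod N%:Z])%Z then F2 a s else 0).
Proof.
by congr (_ + _); apply: eq_bigr => a _; rewrite big_mkcondr.
Qed.

Lemma eq_rowsum M (P : 'I_r -> nat -> bool) (F1 F2 G1 G2 : 'I_r -> nat -> V) :
  (forall a s, (0 < s)%N -> P a s -> F1 a s = G1 a s) ->
  (forall a s, (0 < s)%N -> P a s -> F2 a s = G2 a s) ->
  rowsum M P F1 F2 = rowsum M P G1 G2.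
Proof.
move=> e1 e2; congr (_ + _); apply: eq_bigr => a _.
  rewrite big_nat_cond [RHS]big_nat_cond.
  by apply: eq_bigr => s /andP[/andP[s0 _] /e1->].
rewrite big_nat_cond [RHS]big_nat_cond.
by apply: eq_bigr => s /andP[/andP[s0 _] /e2->].
Qed.

Lemma eq_psum N p la (P : 'I_r -> nat -> bool) j (F1 F2 G1 G2 : 'I_r -> nat -> V) :
  (forall a s, (0 < s)%N -> P a s -> (content p la a s == j %[mod N%:Z])%Z ->
     F1 a s = G1 a s) ->
  (forall a s, (0 < s)%N -> P a s -> (content p la a s == j + 1 %[mod N%:Z])%Z ->
     F2 a s = G2 a s) ->
  psum N p la P j F1 F2 = psum N p la P j G1 G2.
Proof.
move=> e1 e2; rewrite !psum_rowsum; apply: eq_rowsum => a s s0 Ps.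
  by case: ifP => // /e1->.
by case: ifP => // /e2->.
Qed.

Lemma rowsum_sum I (t : seq I) (Q : pred I) M (P : 'I_r -> nat -> bool)
    (F1 F2 : I -> 'I_r -> nat -> V) :
  \sum_(i <- t | Q i) rowsum M P (F1 i) (F2 i) =
  rowsum M P (fun a s => \sum_(i <- t | Q i) F1 i a s)
             (fun a s => \sum_(i <- t | Q i) F2 i a s).
Proof.
rewrite big_split /=; congr (_ + _); rewrite exchange_big; apply: eq_bigr => a _;
  by rewrite exchange_big.
Qed.

Lemma rowsumB M (P : 'I_r -> nat -> bool) (F1 F2 G1 G2 : 'I_r -> nat -> V) :
  rowsum M P F1 F2 - rowsum M P G1 G2 =
  rowsum M P (fun a s => F1 a s - G1 a s) (fun a s => F2 a s - G2 a s).
Proof.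
rewrite /rowsum opprD addrACA; congr (_ + _); rewrite -sumrB;
  by apply: eq_bigr => a _; rewrite sumrB.
Qed.

(** Raising the bound by one adds one term to each sum, and these two cancel. *)
Lemma rowsum_stable M M' P F1 F2 : (M <= M')%N ->
  (forall a s, (M < s)%N -> P a s = P a s.+1) ->
  (forall a s, (M < s)%N -> P a s -> F1 a s + F2 a s.+1 = 0) ->
  rowsum M P F1 F2 = rowsum M' P F1 F2.
Proof.
elim: M' => [|M' IH]; first by rewrite leqn0 => /eqP->.
rewrite leq_eqVlt => /orP[/eqP->//|MM'] hP h0; rewrite IH // /rowsum.
have big_last (F : nat -> V) (Q : pred nat) m : (0 < m)%N ->
    \sum_(1 <= s < m.+1 | Q s) F s =
    \sum_(1 <= s < m | Q s) F s + (if Q m then F m else 0).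
  by move=> m0; rewrite big_mkcond big_nat_recr //= -big_mkcond.
apply/eqP; rewrite eq_sym -subr_eq0 opprD addrACA -!sumrB -big_split /=.
rewrite big1 // => a _.
rewrite (big_last _ _ M'.+1) // (big_last _ _ M'.+2) //.
rewrite [X in X - _ + _]addrC addrK [X in _ + (X - _)]addrC addrK -(hP a M'.+1) //.
by case: ifP => [Pa|_]; rewrite ?addr0 // h0.
Qed.

End RowSums.

(** * Residues modulo m and modulo N *)

Section Residues.
Variables (m N : nat).
Hypotheses (N_gt0 : (0 < N)%N) (m_dvd_N : (m %| N)%N).

Lemma eqz_mod_nat (d i j : nat) :
  (i%:Z == j%:Z %[mod d%:Z])%Z = (i == j %[mod d])%N.
Proof. by rewrite !modz_nat eqz_nat. Qed.

Lemma eqz_mod_dvdn (c c' : int) :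
  (c == c' %[mod N%:Z])%Z -> (c == c' %[mod m%:Z])%Z.
Proof.
rewrite !eqz_mod_dvd; apply: dvdz_trans.
by rewrite -[(_ %| _)%Z]/(m %| N)%N.
Qed.

Lemma residue_exists (c : int) : exists j : 'I_N, (c == j%:Z %[mod N%:Z])%Z.
Proof.
have lt : (`|(c %% N%:Z)%Z|%N < N)%N.
  by rewrite -ltz_nat gez0_abs ?modz_ge0 ?ltz_pmod // -lt0n.
exists (Ordinal lt); rewrite /= gez0_abs; first by rewrite modz_mod.
by rewrite modz_ge0 // -lt0n.
Qed.

Lemma residue_unique (c : int) (j j' : 'I_N) :
  (c == j%:Z %[mod N%:Z])%Z -> (c == j'%:Z %[mod N%:Z])%Z -> j = j'.
Proof.
move=> /eqP e /eqP e'; apply: val_inj; have : (j%:Z == j'%:Z %[mod N%:Z])%Z.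
  by rewrite -e e'.
by rewrite eqz_mod_nat !modn_small // => /eqP.
Qed.

(** Exactly one [j] below [N] is congruent to [c] modulo [N]; for this [j], being congruent to [i]
    modulo [m] means the same for [c]. *)
Lemma sum_residue (V : zmodType) (c : int) (i : nat) (F : 'I_N -> V) (G : V) :
  (forall j : 'I_N, (j == i %[mod m])%N -> (c == j%:Z %[mod N%:Z])%Z ->
     F j = G) ->
  \sum_(j < N | (j == i %[mod m])%N)
    (if (c == j%:Z %[mod N%:Z])%Z then F j else 0) =
  if (c == i%:Z %[mod m%:Z])%Z then G else 0.
Proof.
move=> FG; have [j0 cj0] := residue_exists c.
have -> : (c == i%:Z %[mod m%:Z])%Z = (j0 == i %[mod m])%N.
  by rewrite -eqz_mod_nat (eqP (eqz_mod_dvdn cj0)).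
rewrite big_mkcond (bigD1 j0) //= cj0 big1 => [|j nj].
  by rewrite addr0; case: ifP => // j0i; apply: FG.
case: ifP => // _; case: ifP => // cj.
by move: nj; rewrite (residue_unique cj cj0) eqxx.
Qed.

(** Merges the conditions modulo [N] over the fibre of [i] into one condition modulo [m]. This is
    how the sums over i' in Phi meet the row products of the toroidal side. *)
Lemma psum_fibre (r : nat) (V : zmodType) (p : 'I_r -> nat) (la : mpart r)
    (P : 'I_r -> nat -> bool) (i : nat)
    (F1 F2 : 'I_N -> 'I_r -> nat -> V) (G1 G2 : 'I_r -> nat -> V) :
  (forall (j : 'I_N) a s, (j == i %[mod m])%N -> (0 < s)%N ->
     (content p la a s == j%:Z %[mod N%:Z])%Z -> F1 j a s = G1 a s) ->
  (forall (j : 'I_N) a s, (j == i %[mod m])%N -> (0 < s)%N ->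
     (content p la a s == j%:Z + 1 %[mod N%:Z])%Z -> F2 j a s = G2 a s) ->
  \sum_(j < N | (j == i %[mod m])%N) psum N p la P j (F1 j) (F2 j) =
  psum m p la P i G1 G2.
Proof.
move=> FG1 FG2; under eq_bigr do rewrite psum_rowsum.
rewrite rowsum_sum psum_rowsum; apply: eq_rowsum => a s s0 _.
  by rewrite (sum_residue _ (G := G1 a s)) // => j ji; apply: FG1.
have shift1 d (k : nat) : (content p la a s == k%:Z + 1 %[mod d])%Z =
    (content p la a s - 1 == k%:Z %[mod d])%Z.
  by rewrite !eqz_mod_dvd opprD addrA addrAC.
under eq_bigr do rewrite shift1.
rewrite shift1 (sum_residue _ (G := G2 a s)) // => j ji.
by rewrite -shift1; apply: FG2.
Qed.

End Residues.

Lemma content_mod (m r : nat) (p : 'I_r -> nat) (la : mpart r) a s (c : int) :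
  (content (fun a => p a %% m)%N la a s == c %[mod m%:Z])%Z =
  (content p la a s == c %[mod m%:Z])%Z.
Proof.
rewrite !eqz_mod_dvd /content.
have -> : (p a)%:Z + s%:Z - (lam la a s)%:Z - c =
    (p a %/ m * m)%N%:Z + ((p a %% m)%N%:Z + s%:Z - (lam la a s)%:Z - c).
  by rewrite {1}(divn_eq (p a) m); lia.
rewrite [RHS]rpredDl //; apply/dvdzP; exists (p a %/ m)%N%:Z.
by rewrite PoszM.
Qed.

(* The combinatorial core: any function Gam (d, y) invariant under
   (d, y) -> (-d, -y) yields row interactions for which the system
   ell (la + box) - ell (la) = (S_succ - S_prec + corr) / 2 is integrable. *)
Section Potential.
Variables (r : nat) (A : comNzRingType) (m : A -> Prop).
Variables (Gam : int -> A -> A) (h1 h2 h3 half : A).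
Variables (p : 'I_r -> nat) (v : 'I_r -> A).
Hypothesis Gam_sym : forall d y, Gam (- d) (- y) = Gam d y.
Hypothesis Gam00 : Gam 0 0 = 0.
Hypothesis m0 : m 0.
Hypothesis mD : forall x y, m x -> m y -> m (x + y).
Hypothesis mN : forall x, m x -> m (- x).
Hypothesis mM : forall x y, m y -> m (x * y).
Hypothesis Gam_m : forall d y, m y -> m (Gam d y).
Hypothesis h123 : h3 = - h1 - h2.
Hypothesis half2 : half + half = 1.
Hypothesis h1m : m h1.
Hypothesis h2m : m h2.
Hypothesis vm : forall a, m (v a).
Implicit Types (la mu : mpart r) (a b : 'I_r) (s l M k : nat).

Let mB x y : m x -> m y -> m (x - y).
Proof. by move=> mx my; apply/mD/mN. Qed.

Let m_sum I (t : seq I) (P : pred I) (F : I -> A) :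
  (forall i, P i -> m (F i)) -> m (\sum_(i <- t | P i) F i).
Proof. by move=> Fm; elim/big_ind: _. Qed.

Let h3m : m h3.
Proof. by rewrite h123; apply: mB => //; apply: mN. Qed.

Definition box_pos a s k : A := k%:R * h1 + s.-1%:R * h3 + v a.
Definition box_cont a s k : int := (p a)%:Z + s%:Z - k%:Z.

Lemma pos_m a s k : m (box_pos a s k).
Proof. by apply: mD => //; apply: mD; apply: mM. Qed.

(** With the kernel of the theorem, [Exp K1] and [Exp K2] are the quotients of the toroidal by the
    Yangian factor of the row [(a, s)], of length [ka], in the first and in the second product
    ([ratio1], [ratio2]). *)
Definition K1 b l kb a s ka : A :=
  let D := box_cont b l kb - box_cont a s ka in let y := box_pos b l kb - box_pos a s ka in
  Gam (D - 1) (y + h1) - Gam (D - 1) (y - h3).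
Definition K2 b l kb a s ka : A :=
  let D := box_cont b l kb - box_cont a s ka in let y := box_pos b l kb - box_pos a s ka in
  Gam D y - Gam D (y - h2).

Lemma K1_m b l kb a s ka : m (K1 b l kb a s ka).
Proof.
have ? := pos_m a s ka; have ? := pos_m b l kb.
by apply: mB; apply: Gam_m; [apply: mD|apply: mB] => //;
  apply: mB.
Qed.

Lemma K2_m b l kb a s ka : m (K2 b l kb a s ka).
Proof.
have ? := pos_m a s ka; have ? := pos_m b l kb.
by apply: mB; apply: Gam_m; [|apply: mB => //]; apply: mB.
Qed.

(** The length [k] of the row [(b, l)] is an argument of its own, so that the box stays fixed while
    the shape [la] varies. *)
Definition Srow (P : 'I_r -> nat -> 'I_r -> nat -> bool) M la b l k : A :=
  rowsum M (fun a s => P a s b l)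
    (fun a s => K1 b l k a s (lam la a s))
    (fun a s => K2 b l k a s (lam la a s)).

Lemma Srow_m P M la b l k : m (Srow P M la b l k).
Proof.
by apply: mD; apply: m_sum => a _; apply: m_sum => s _;
  [apply: K1_m|apply: K2_m].
Qed.

(** Passing to the next empty row raises the content by 1 and the position by [h3]; since
    [- h3 - h2 = h1], [K2] there is the opposite of [K1] here. *)
Lemma K_cancel b l k a s : (0 < s)%N ->
  K1 b l k a s 0 + K2 b l k a s.+1 0 = 0.
Proof.
move=> s0; have -> : K2 b l k a s.+1 0 =
    Gam (box_cont b l k - box_cont a s 0 - 1) (box_pos b l k - box_pos a s 0 - h3) -
    Gam (box_cont b l k - box_cont a s 0 - 1) (box_pos b l k - box_pos a s 0 + h1).
  rewrite /K2 /=.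
  have -> : box_cont a s.+1 0 = box_cont a s 0 + 1 by rewrite /box_cont; lia.
  have -> : box_pos a s.+1 0 = box_pos a s 0 + h3.
    by case: s s0 => // s _; rewrite /box_pos -[s.+1.-1]/(s) -natr1; ring.
  by congr (Gam _ _ - Gam _ _); rewrite ?h123; (lia || ring).
by rewrite /K1 /=; ring.
Qed.

Lemma Srow_stable P M M' la b l k : P = @prec r \/ P = @succ r ->
  (cutoff la <= M)%N -> (l <= M)%N -> (M <= M')%N ->
  Srow P M la b l k = Srow P M' la b l k.
Proof.
move=> hP cM lM MM'; apply: rowsum_stable => // a s Ms.
  by case: hP => ->; rewrite /succ /prec; case: ltngtP => //= _;
    rewrite ?andbT ?andbF //; congr andb; lia.
by move=> _; rewrite !lam_cutoff ?K_cancel //; lia.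
Qed.

(** The change in the contribution of the row [(a, s)] when its length grows from [ka] to [ka.+1]:
    the interaction of two boxes. *)
Definition theta b l kb a s ka : A :=
  K1 b l kb a s ka.+1 + K2 b l kb a s ka.+1 -
  (K1 b l kb a s ka + K2 b l kb a s ka).

(** The eight values of [Gam] on one side are those on the other, with opposite signs, after
    [(d, y) -> (- d, - y)] and [h1 + h2 + h3 = 0]. *)
Lemma theta_anti b l kb a s ka : theta b l kb a s ka = - theta a s ka b l kb.
Proof.
rewrite /theta /K1 /K2.
have posS c t k : box_pos c t k.+1 = box_pos c t k + h1.
  by rewrite /box_pos -natr1; ring.
have contS c t k : box_cont c t k.+1 = box_cont c t k - 1 by rewrite /box_cont; lia.
rewrite !posS !contS /=.
move: (box_pos b l kb) (box_pos a s ka) (box_cont b l kb) (box_cont a s ka) => x y c e.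
have G d z d' z' : d' = - d -> z' = - z -> Gam d' z' = Gam d z.
  by move=> -> ->; apply: Gam_sym.
rewrite -(G (e - (c - 1) - 1) (y - (x + h1) + h1) (c - e) (x - y)); [|lia|ring].
rewrite -(G (e - (c - 1) - 1) (y - (x + h1) - h3) (c - e) (x - y - h2));
  [|lia|rewrite h123; ring].
rewrite -(G (e - (c - 1)) (y - (x + h1)) (c - e - 1) (x - y + h1)); [|lia|ring].
rewrite -(G (e - (c - 1)) (y - (x + h1) - h2) (c - e - 1) (x - y - h3));
  [|lia|rewrite h123; ring].
rewrite -(G (e - c - 1) (y - x + h1) (c - (e - 1)) (x - (y + h1))); [|lia|ring].
rewrite -(G (e - c - 1) (y - x - h3) (c - (e - 1)) (x - (y + h1) - h2));
  [|lia|rewrite h123; ring].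
rewrite -(G (e - c) (y - x) (c - (e - 1) - 1) (x - (y + h1) + h1)); [|lia|ring].
rewrite -(G (e - c) (y - x - h2) (c - (e - 1) - 1) (x - (y + h1) - h3));
  [|lia|rewrite h123; ring].
ring.
Qed.

(** Antisymmetry and the presence of [half]. This is why adding a box leaves the sum over all rows
    at its own position unchanged. *)
Lemma theta_self b l k : theta b l k b l k = 0.
Proof.
have e := theta_anti b l k b l k.
by rewrite -[LHS]mul1r -half2 mulrDl {2}e mulrN subrr.
Qed.

(** Columns [k] are numbered from 0. The bound [M] on the rows is independent of [la], so that two
    shapes can be compared over the same range. *)
Definition bs M la (f : 'I_r -> nat -> nat -> A) : A :=
  \sum_(a < r) \sum_(1 <= s < M.+1) \sum_(0 <= k < lam la a s) f a s k.

Lemma sum_pick M b l (F : 'I_r -> nat -> A) : (0 < l)%N -> (l <= M)%N ->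
  \sum_(a < r) \sum_(1 <= s < M.+1)
    (if (a == b) && (s == l) then F a s else 0) = F b l.
Proof.
move=> l0 lM; rewrite (bigD1 b) //= [X in _ + X]big1 => [|a /negPf->].
  rewrite addr0 (bigD1_seq l) ?mem_index_iota ?iota_uniq ?l0 //= !eqxx /=.
  by rewrite big1 ?addr0 // => s /negPf->.
by rewrite big1.
Qed.

Lemma bs_widen M M' la f : (cutoff la <= M)%N -> (M <= M')%N ->
  bs M la f = bs M' la f.
Proof.
move=> cM MM'; apply: eq_bigr => a _.
rewrite [RHS](@big_cat_nat _ _ _ M.+1) //= [X in _ = _ + X]big_nat_cond.
rewrite [X in _ = _ + X]big1 ?addr0 // => s /andP[/andP[Ms _] _].
by rewrite lam_cutoff ?big_geq //; lia.
Qed.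

Lemma bs_add M la b l f : addable la b l -> (l <= M)%N ->
  bs M (add_box la b l) f = bs M la f + f b l (lam la b l).
Proof.
move=> al lM; rewrite -(sum_pick b (fun a s => f a s (lam la a s)) _ lM).
  rewrite -big_split; apply: eq_bigr => a _; rewrite -big_split /= !big_nat.
  apply: eq_bigr => s /andP[s0 _]; rewrite lam_add_box //.
  by case: ifP => _; rewrite ?addn0 ?addr0 // addn1 big_nat_recr.
exact: addable_gt0 al.
Qed.

Lemma bs_lin M la f g : bs M la (fun a s k => f a s k + g a s k) =
  bs M la f + bs M la g.
Proof.
rewrite -big_split; apply: eq_bigr => a _; rewrite -big_split /=.
by apply: eq_bigr => s _; rewrite big_split.
Qed.

Lemma eq_bs M la f g : (forall a s k, (0 < s)%N -> f a s k = g a s k) ->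
  bs M la f = bs M la g.
Proof.
move=> fg; apply: eq_bigr => a _; rewrite !big_nat; apply: eq_bigr => s.
by case/andP=> s0 _; apply: eq_bigr => k _; apply: fg.
Qed.

Lemma bs_m M la f : (forall a s k, m (f a s k)) -> m (bs M la f).
Proof. by move=> fm; do 3!apply: m_sum => ? _. Qed.

Lemma bs0 M f : bs M (mpart0 r) f = 0.
Proof. by rewrite /bs big1 // => a _; rewrite big1 // => s _; rewrite lam0 big_geq. Qed.

(** Each row is built from the empty one box by box, and every box contributes its [theta]. The
    hypothesis disposes of the additional row [M.+1] of the second sum. *)
Lemma Srow_tel P M la b l k : (forall a, lam la a M.+1 = 0%N) ->
  Srow P M la b l k = Srow P M (mpart0 r) b l k +
    bs M la (fun a s k' => if P a s b l then theta b l k a s k' else 0).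
Proof.
move=> z; apply/eqP; rewrite addrC -subr_eq /Srow rowsumB; apply/eqP.
rewrite /rowsum -big_split; apply: eq_bigr => a _ /=.
rewrite big_mkcond [X in _ + X]big_mkcond [X in _ + X]big_nat_recr //=.
rewrite z lam0 subrr if_same addr0 -big_split /=; apply: eq_bigr => s _.
case: ifP => Ps; last by rewrite addr0 big1.
rewrite lam0 addrACA -opprD.
rewrite -(telescope_sumr (fun k' => K1 b l k a s k' + K2 b l k a s k')) //.
Qed.

Lemma Srow_all_add la b l : addable la b l ->
  let P := fun (_ : 'I_r) (_ : nat) (_ : 'I_r) (_ : nat) => true in
  let la' := add_box la b l in let k := lam la b l in
  Srow P (cutoff la') la' b l k = Srow P (cutoff la) la b l k.
Proof.
move=> al P la' k; have cc := cutoff_add_box al.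
have z (mu : mpart r) M : (cutoff mu <= M)%N -> forall a, lam mu a M.+1 = 0%N.
  by move=> cM a; rewrite lam_cutoff // ltnW.
transitivity (Srow P (cutoff la') la b l k).
  rewrite (Srow_tel P b l k (z la' _ (leqnn _))) (Srow_tel P b l k (z la _ cc)).
  rewrite bs_add //=; last exact: leq_trans (addable_cutoff al) cc.
  by rewrite theta_self addr0.
apply: esym; apply: rowsum_stable => // a s Ms _.
by rewrite !lam_cutoff ?K_cancel //; lia.
Qed.

Definition corr : A := Gam (- 1) h1 - Gam (- 1) (- h3).

(** Here content and position differences are 0: [K1] gives [corr], and [K2] gives
    [Gam 0 0 - Gam 0 (- h2) = - Gam 0 h2]. *)
Lemma K_self b l k : K1 b l k b l k + K2 b l k b l k = corr - Gam 0 h2.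
Proof.
have := Gam_sym 0 h2; rewrite oppr0 => e.
by rewrite /K1 /K2 /corr /= !subrr !sub0r !add0r Gam00 sub0r e.
Qed.

(** Every row other than [(b, l)] either precedes or succeeds it. *)
Lemma Srow_all la b l : addable la b l ->
  let P := fun (_ : 'I_r) (_ : nat) (_ : 'I_r) (_ : nat) => true in
  let M := cutoff la in let k := lam la b l in
  Srow P M la b l k =
  Srow (@prec r) M la b l k + Srow (@succ r) M la b l k + (corr - Gam 0 h2).
Proof.
move=> al P M k; have l0 := addable_gt0 al; have lM := addable_cutoff al.
have split3 M' (F : 'I_r -> nat -> A) : (l <= M')%N ->
    \sum_(a < r) \sum_(1 <= s < M'.+1 | P a s b l) F a s =
    \sum_(a < r) \sum_(1 <= s < M'.+1 | prec a s b l) F a s +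
    \sum_(a < r) \sum_(1 <= s < M'.+1 | succ a s b l) F a s + F b l.
  move=> lM'; rewrite -(sum_pick b F l0 lM') -!big_split; apply: eq_bigr => a _.
  rewrite [X in _ = X + _ + _]big_mkcond [X in _ = _ + X + _]big_mkcond.
  rewrite -!big_split; apply: eq_bigr => s _ /=.
  rewrite /succ /prec [b == a]eq_sym -!val_eqE /=.
  case: (ltngtP (val a) (val b)) => _ /=; rewrite ?addr0 ?add0r //.
  by case: (ltngtP s l) => _; rewrite ?addr0 ?add0r.
rewrite -(K_self b l k).
transitivity (rowsum M (fun a s => prec a s b l)
      (fun a s => K1 b l k a s (lam la a s)) (fun a s => K2 b l k a s (lam la a s)) +
    rowsum M (fun a s => succ a s b l)
      (fun a s => K1 b l k a s (lam la a s)) (fun a s => K2 b l k a s (lam la a s)) +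
    (K1 b l k b l k + K2 b l k b l k)); last by [].
rewrite /rowsum [X in _ = X + _]addrACA [RHS]addrACA; congr (_ + _).
  exact: (split3 M (fun a s => K1 b l k a s (lam la a s))).
by apply: (split3 M.+1 (fun a s => K2 b l k a s (lam la a s))); apply: ltnW.
Qed.

(** The required increment, without the factor 1/2, when all rows are empty; by [Srow_stable] the
    bound [l] is large enough. *)
Definition vac b l k : A :=
  Srow (@succ r) l (mpart0 r) b l k - Srow (@prec r) l (mpart0 r) b l k + corr.

(** The sign given by the order of the two rows compensates the antisymmetry of [theta]. *)
Definition sigma a s k' b l k : A :=
  if succ a s b l then theta b l k a s k'
  else if prec a s b l then - theta b l k a s k' else 0.

Lemma sigma_sym a s k' b l k : sigma a s k' b l k = sigma b l k a s k'.
Proof.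
rewrite /sigma /succ; case: ifP => h1'; case: ifP => h2' //.
- by move: h1' h2'; rewrite /prec [a == b]eq_sym -val_eqE /=; case: ltngtP => //= _; lia.
- exact: theta_anti.
- by rewrite theta_anti opprK.
Qed.

Lemma sigma_self b l k : sigma b l k b l k = 0.
Proof. by rewrite /sigma /succ /prec ltnn eqxx ltnn. Qed.

(** The inner [half] corrects the double count of unordered pairs of boxes; the outer one is the
    factor 1/2 of the system. *)
Definition ell la : A :=
  half * (bs (cutoff la) la vac +
    half * bs (cutoff la) la (fun a s k' => bs (cutoff la) la (sigma a s k'))).

Lemma ell_m la : m (ell la).
Proof.
have tm b l k a s k' : m (theta b l k a s k').
  by apply: mB; apply: mD; (apply: K1_m || apply: K2_m).
apply: mM; apply: mD.
  apply: bs_m => a s k; apply: mD; first by apply: mB; apply: Srow_m.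
  by apply: mB; apply: Gam_m => //; apply: mN.
apply: mM; apply: bs_m => a s k; apply: bs_m => b l k'.
by rewrite /sigma; case: ifP => // _; case: ifP => // _; apply: mN.
Qed.

Lemma ell0 : ell (mpart0 r) = 0.
Proof. by rewrite /ell !bs0 mulr0 addr0 mulr0. Qed.

(** The new box meets each old one in both orders, which by [sigma_sym] doubles a single sum and is
    undone by the inner [half]; it does not meet itself by [sigma_self]. What remains is the
    difference of the two instances of [Srow_tel]. *)
Lemma ell_add la b l : addable la b l -> let k := lam la b l in
  ell (add_box la b l) = ell la + half *
    (Srow (@succ r) (cutoff la) la b l k - Srow (@prec r) (cutoff la) la b l k + corr).
Proof.
move=> al k; have lc := addable_cutoff al; have cc := cutoff_add_box al.
have l0 := addable_gt0 al.
set M := cutoff (add_box la b l); have lM : (l <= M)%N := leq_trans lc cc.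
have -> : ell la = half * (bs M la vac +
    half * bs M la (fun a s k' => bs M la (sigma a s k'))).
  rewrite /ell; congr (_ * (_ + _ * _)); first exact: bs_widen.
  by rewrite (bs_widen _ _ cc) //; apply: eq_bs => a s k' _; apply: bs_widen.
have c0 : cutoff (mpart0 r) = 1%N.
  by rewrite /cutoff big1 // => a _; rewrite ffunE.
have zM a : lam la a M.+1 = 0%N by rewrite lam_cutoff // ltnW.
have SM P : P = @prec r \/ P = @succ r -> Srow P (cutoff la) la b l k =
    Srow P l (mpart0 r) b l k +
    bs M la (fun a s k' => if P a s b l then theta b l k a s k' else 0).
  move=> hP; rewrite (Srow_stable (M' := M)) // Srow_tel //; congr (_ + _).
  by apply: esym; apply: Srow_stable; rewrite ?c0.
rewrite (SM (@succ r)) ?(SM (@prec r)); [|by left|by right].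
have esig : bs M la (fun a s k' => sigma a s k' b l k) =
    bs M la (fun a s k' => if succ a s b l then theta b l k a s k' else 0) -
    bs M la (fun a s k' => if prec a s b l then theta b l k a s k' else 0).
  apply/eqP; rewrite eq_sym subr_eq -bs_lin; apply/eqP.
  apply: eq_bs => a s k' _; rewrite /sigma /succ; case: ifP => h.
    suff -> : prec a s b l = false by rewrite addr0.
    by move: h; rewrite /prec [a == b]eq_sym -val_eqE /=; case: ltngtP => //= _; lia.
  by case: ifP; rewrite ?addNr ?addr0.
rewrite /ell -/M bs_add // bs_add // bs_add // -/k sigma_self addr0.
have -> : bs M la (fun a s k' => bs M (add_box la b l) (sigma a s k')) =
    bs M la (fun a s k' => bs M la (sigma a s k')) +
    bs M la (fun a s k' => sigma a s k' b l k).
  by rewrite -bs_lin; apply: eq_bs => a s k' _; rewrite bs_add.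
have -> : bs M la (sigma b l k) = bs M la (fun a s k' => sigma a s k' b l k).
  by apply: eq_bs => a s k' _; apply: sigma_sym.
rewrite esig /vac.
set u := bs M la vac; set w := bs M la (fun a s k' => bs _ _ _).
set x := bs M la _; set y := bs M la _.
have -> : half * (w + (x - y) + (x - y)) = half * w + (half + half) * (x - y).
  by ring.
by rewrite half2; ring.
Qed.

End Potential.

(** * The functions G_{i,j} *)

Section RootOfUnity.
Variable RR : realType.
Local Notation C := (RR[i]).

Definition cis (x : RR) : C := (cos x +i* sin x)%C.

Lemma cisD x y : cis (x + y) = cis x * cis y.
Proof.
rewrite /cis cosD sinD; apply/eqP; rewrite eq_complex /=.
by rewrite eqxx addrC eqxx.
Qed.

Lemma cis0 : cis 0 = 1.
Proof. by rewrite /cis cos0 sin0. Qed.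

Lemma cisMn x t : cis (x *+ t) = cis x ^+ t.
Proof.
elim: t => [|t IH]; first by rewrite mulr0n cis0.
by rewrite mulrS cisD IH exprS.
Qed.

Lemma cis_neq0 x : cis x != 0.
Proof.
apply/eqP => e; have := cisD x (- x); rewrite subrr cis0 e mul0r => /eqP.
by rewrite oner_eq0.
Qed.

Lemma cisN x : cis (- x) = (cis x)^-1.
Proof.
apply: (mulfI (cis_neq0 x)).
by rewrite -cisD subrr cis0 mulfV ?cis_neq0.
Qed.

Lemma cisMz x (z : int) : cis (x *~ z) = cis x ^ z.
Proof.
case: z => t; first exact: cisMn.
by rewrite NegzE mulrNz cisN -exprnN [x *~ _]/(x *+ t.+1) cisMn.
Qed.

Lemma cis2pi : cis (pi *+ 2) = 1.
Proof.
have := periodicn (@cosD2pi RR) 1 0; have := periodicn (@sinD2pi RR) 1 0.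
by rewrite !mulr1n !add0r /cis => -> ->; rewrite cos0 sin0.
Qed.

(** [cos 2x = 1] would force [sin x = 0]. *)
Lemma cis_neq1 x : 0 < x < pi -> cis (x *+ 2) != 1.
Proof.
move=> /sin_gt0_pi s0; apply/eqP => -[e _].
move: e; rewrite cos_mulr2n cos2sin2 => e.
have : 2 * sin x ^+ 2 = 1 - ((1 - sin x ^+ 2) *+ 2 - 1) by ring.
rewrite e subrr => /eqP; rewrite mulf_eq0 Num.Theory.pnatr_eq0 /= expf_eq0 /=.
by move=> /eqP s00; rewrite s00 Order.POrderTheory.ltxx in s0.
Qed.

Variables (m n : nat) (k : int).
Hypotheses (m_gt0 : (0 < m)%N) (n_gt0 : (0 < n)%N) (kn : coprimez k n%:Z).
Local Notation w := (omega RR m n k).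
Local Notation N := (m * n)%N.

Lemma omega_cis : w = cis (root_arg RR m n k).
Proof. by []. Qed.

Lemma omega_neq0 : w != 0.
Proof. exact: cis_neq0. Qed.

Let natRR t : (0 < t)%N -> (t%:R : RR) != 0.
Proof. by move=> t0; rewrite Num.Theory.pnatr_eq0 -lt0n. Qed.

Lemma omegaN (d : int) : (N%:Z %| d)%Z -> w ^ d = 1.
Proof.
move=> /dvdzP[t ->]; rewrite omega_cis -cisMz.
have -> : root_arg RR m n k *~ (t * N%:Z) = (pi *+ 2) *~ (k * t).
  have m0 := natRR m_gt0; have n0 := natRR n_gt0.
  rewrite -mulrzr intrM -[RHS]mulrzr intrM /root_arg -pmulrn natrM.
  by rewrite -mulr_natl; field; apply/andP.
by rewrite cisMz cis2pi exp1rz.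
Qed.

(** For [d = t m] the power is [exp (2 pi i k t / n)]. As [k] is prime to [n] and [n] does not
    divide [t], the remainder of [k t] modulo [n] lies strictly between 0 and [n]. *)
Lemma omega_neq1 (d : int) : (m%:Z %| d)%Z -> ~~ (N%:Z %| d)%Z -> w ^ d != 1.
Proof.
move=> /dvdzP[t ->] nN; rewrite omega_cis -cisMz.
pose s := ((k * t) %% n%:Z)%Z; pose q := ((k * t) %/ n%:Z)%Z.
have ekt : k * t = q * n%:Z + s by apply: divz_eq.
have m0 := natRR m_gt0; have n0 := natRR n_gt0.
have n0z : n%:Z != 0 by rewrite -lt0n.
have -> : root_arg RR m n k *~ (t * m%:Z) =
    (pi *+ 2) *~ q + (pi * s%:~R / n%:R) *+ 2.
  have : (k%:~R * t%:~R : RR) = q%:~R * n%:R + s%:~R.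
    by rewrite -intrM ekt intrD intrM -pmulrn.
  move=> e; rewrite -mulrzr intrM -[(_ *+ 2) *~ q]mulrzr /root_arg -!pmulrn natrM.
  have -> : pi *+ 2 * q%:~R + pi * s%:~R / n%:R *+ 2 =
    2 * pi * (q%:~R * n%:R + s%:~R) / n%:R :> RR.
    by rewrite !mulr2n; field.
  by rewrite -e; field; apply/andP.
rewrite cisD cisMz cis2pi exp1rz mul1r; apply: cis_neq1.
have s_ge0 : (0 <= s)%R by apply: modz_ge0.
have s_lt : (s < n%:Z)%R by rewrite ltz_mod.
have s_neq0 : s != 0.
  apply: contra nN => /eqP s0; rewrite mulrC PoszM dvdz_mul2l //; last by rewrite -lt0n.
  have : (n%:Z %| k * t)%Z by rewrite dvdz_eq -/q ekt s0 addr0.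
  by rewrite Gauss_dvdzr // coprimez_sym.
have s_gt0 : (0 < s)%R by rewrite Order.POrderTheory.lt_def s_neq0.
have pi0 := pi_gt0 RR.
have n0' : (0 < n%:R :> RR)%R by rewrite Num.Theory.ltr0n.
apply/andP; split.
  by rewrite !Num.Theory.mulr_gt0 ?Num.Theory.invr_gt0 // ltr0z.
rewrite Num.Theory.ltr_pdivrMr // Num.Theory.ltr_pM2l //.
by rewrite [n%:R]pmulrn ltr_int.
Qed.

End RootOfUnity.

Lemma dvdz_oppr (a d : int) : (a %| - d)%Z = (a %| d)%Z.
Proof. by rewrite !dvdzE abszN. Qed.

Section ExactDivision.
Variable T : idomainType.

Lemma exdiv_unique (x d y : T) : d != 0 -> y * d = x -> exdiv x d = y.
Proof.
move=> d0 e; rewrite /exdiv; case: xgetP => [z _ /= ez|/(_ y)/= h].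
  by apply: (mulIf d0); rewrite ez e.
by case: h.
Qed.

Lemma exdivK (x d y : T) : d != 0 -> y * d = x -> exdiv x d * d = x.
Proof. by move=> d0 e; rewrite (exdiv_unique d0 e). Qed.

End ExactDivision.

(** * The kernel series and their logarithms *)

Section KernelSeries.
Variables (RR : realType) (m n : nat) (k : int).
Hypotheses (m_gt0 : (0 < m)%N) (n_gt0 : (0 < n)%N) (kn : coprimez k n%:Z).
Local Notation C := (RR[i]).
Local Notation A := (hseries RR).
Local Notation w := (omega RR m n k).
Local Notation N := (m * n)%N.
Implicit Types (F H : fps C) (d : int) (y : A).

(** With [c] the constant term and [H = F / c], an inverse is [exp (- log H) / c]. *)
Lemma fps_inv F : fcoef F 0 != 0 -> exists g, g * F = 1.
Proof.
move=> F0; pose c := fcoef F 0; pose H := fconst c^-1 * F.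
have H0 : fcoef H 0 = 1 by rewrite fcoefCM mulVf.
pose E := pexp (plog H); pose E' := pexp (- plog H).
have EE' : E' * E = 1.
  have l0 : fcoef (plog H) 0 = 0 by rewrite plog0.
  have l0' : fcoef (- plog H) 0 = 0 by rewrite fcoefN l0 oppr0.
  apply: (@logd_unique _ (@natC_unit RR) 0); last 1 first.
  - have gen (f g : fps C) : fcoef f 0 = 1 -> fcoef g 0 = 1 ->
        fcoef (f * g) 0 = fcoef 1 0.
      by move=> e e'; rewrite fcoefM0 e e' mulr1.
    by apply: gen; apply: pexp0.
  - have -> : 0 = fderiv (- plog H) + fderiv (plog H).
      by rewrite -(rmorph0 (@fconst C)) -raddfD /= addNr; apply: fpsP => i /=; rewrite mul0rn mul0rn.
    by apply: logdM; apply: logd_pexp => //; apply: natC_unit.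
  - exact: logd1.
exists (E' * fconst c^-1); rewrite -mulrA -/H.
by rewrite -{1}(pexp_plog (@natC_unit RR) H0).
Qed.

(** The denominator of H_{i,j} after cancelling [w ^- i], so that only [d = i - j] matters; the
    cases [i = j] and [i <> j] then share it. *)
Definition den d : fps C :=
  pexpX (n%:R / 2%:R) - fconst (w ^ d) * pexpX (- (n%:R / 2%:R)).
Definition num d : fps C :=
  if (N%:Z %| d)%Z then n%:R * fvar C else fconst (1 - w ^ d).

Let n0 : (n%:R : C) != 0.
Proof. by rewrite Num.Theory.pnatr_eq0 -lt0n. Qed.

Let wN d : (N%:Z %| d)%Z -> w ^ d = 1.
Proof. exact: omegaN. Qed.

Let w1 d : (m%:Z %| d)%Z -> ~~ (N%:Z %| d)%Z -> w ^ d != 1.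
Proof. exact: omega_neq1. Qed.

Lemma fcoef_natM (T : nzRingType) t (f : fps T) i :
  fcoef (t%:R * f) i = t%:R * fcoef f i.
Proof. by rewrite -(rmorph_nat (@fconst T)) fcoefCM. Qed.

Lemma pexpX0 (c : C) : fcoef (pexpX c) 0 = 1.
Proof. by rewrite /= expr0 divr1. Qed.

Lemma den_coef0 d : fcoef (den d) 0 = 1 - w ^ d.
Proof. by rewrite /den fcoefB fcoefCM !pexpX0 mulr1. Qed.

Lemma den_coef1 d : w ^ d = 1 -> fcoef (den d) 1 = n%:R.
Proof.
move=> e; rewrite /den fcoefB fcoefCM e mul1r /= !expr1 !divr1 opprK.
by rewrite -mulr2n -[_ *+ 2]mulr_natr divfK ?Num.Theory.pnatr_eq0.
Qed.

Lemma den_neq0 d : (m%:Z %| d)%Z -> den d != 0.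
Proof.
move=> md; have [Nd|nNd] := boolP (N%:Z %| d)%Z.
  apply/eqP => /(congr1 (fun f => fcoef f 1)).
  rewrite (den_coef1 (wN Nd)) fcoef0 => /eqP.
  by rewrite (negPf n0).
apply/eqP => /(congr1 (fun f => fcoef f 0)).
rewrite den_coef0 fcoef0 => /eqP; rewrite subr_eq0 eq_sym.
by rewrite (negPf (w1 md nNd)).
Qed.

(** If [N] divides [d], the denominator is the variable times a series with constant term [n];
    otherwise its constant term [1 - w ^ d] is already non-zero. *)
Lemma Hd_exists d : (m%:Z %| d)%Z -> exists H, H * den d = num d.
Proof.
move=> md; rewrite /num; case: ifPn => Nd.
  have e := wN Nd.
  pose D := FPS (fun i => fcoef (den d) i.+1).
  have eD : den d = fvar C * D.
    by apply: fpsP => -[|i]; rewrite fcoefXM // den_coef0 e subrr.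
  have D0 : fcoef D 0 != 0 by rewrite [fcoef D 0]den_coef1.
  have [g gD] := fps_inv D0; exists (n%:R * g).
  by rewrite eD -mulrA; congr (_ * _); rewrite mulrCA gD mulr1.
have den0 : fcoef (den d) 0 != 0.
  by rewrite den_coef0 subr_eq0 eq_sym; apply: w1.
have [g gD] := fps_inv den0.
by exists (fconst (1 - w ^ d) * g); rewrite -mulrA gD mulr1.
Qed.

Definition Hd d : fps C := exdiv (num d) (den d).
Definition Gd d : fps C := plog (Hd d).

Lemma Hd_den d : (m%:Z %| d)%Z -> Hd d * den d = num d.
Proof.
by move=> md; have [H e] := Hd_exists md; apply: exdivK e; apply: den_neq0.
Qed.

Lemma Hd_unique d H : (m%:Z %| d)%Z -> H * den d = num d -> Hd d = H.
Proof. by move=> md; apply/exdiv_unique/den_neq0. Qed.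

Lemma Hd0 d : (m%:Z %| d)%Z -> fcoef (Hd d) 0 = 1.
Proof.
move=> md; have e := Hd_den md; move: e; rewrite /num; case: ifPn => Nd e.
  have wd := wN Nd.
  have e1 := congr1 (fun f => fcoef f 1) e; move: e1.
  rewrite fcoef_natM fcoefME !big_ord_recl big_ord0 addr0 den_coef1 //.
  rewrite den_coef0 wd subrr mulr0 addr0 => e1.
  by apply: (mulIf n0); rewrite mul1r; apply: etrans e1 _; apply: mulr1.
have e1 := congr1 (fun f => fcoef f 0) e; move: e1.
rewrite fcoefM0 den_coef0 [RHS]/= mulr1n => e1.
apply: (@mulIf _ (1 - w ^ d)); last by rewrite e1 mul1r.
by rewrite subr_eq0 eq_sym; apply: w1.
Qed.

Lemma Hser_Hd (i j : 'I_N) : (j == i %[mod m])%N -> 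
  Hser RR k i j = Hd (i%:Z - j%:Z).
Proof.
move=> ij; have md : (m%:Z %| i%:Z - j%:Z)%Z.
  by rewrite -eqz_mod_dvd eqz_mod_nat eq_sym.
apply: esym; apply: Hd_unique => //.
rewrite /Hser !fexpX_regular; case: eqP => [->|/eqP nij].
  have e0 : den (j%:Z - j%:Z) =
      pexpX (n%:R / 2%:R) - pexpX (- (n%:R / 2%:R)).
    by rewrite subrr /den expr0z rmorph1 mul1r.
  have en : num (j%:Z - j%:Z) = n%:R * fvar C by rewrite subrr /num dvdz0.
  by rewrite -e0 -en; apply: Hd_den; rewrite subrr dvdz0.
have nN : ~~ (N%:Z %| i%:Z - j%:Z)%Z.
  rewrite -eqz_mod_dvd eqz_mod_nat; apply: contra nij => h.
  by apply/eqP/val_inj/eqP; move: h; rewrite !modn_small.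
have w0 := omega_neq0 RR m n k.
have eden : fconst (w ^- i) * pexpX (n%:R / 2%:R) -
    fconst (w ^- j) * pexpX (- (n%:R / 2%:R)) =
    fconst (w ^- i) * den (i%:Z - j%:Z).
  rewrite mulrBr mulrA -rmorphM /= expfzDr // -exprnP -exprnN mulrA mulVf ?mul1r //.
  by rewrite expf_neq0.
rewrite eden; have := Hd_den md; rewrite /num (negPf nN) => e.
rewrite (@exdiv_unique _ _ _ (Hd (i%:Z - j%:Z))) //.
  rewrite mulf_neq0 ?den_neq0 //; apply/eqP => /(congr1 (fun f => fcoef f 0)).
  by rewrite /= mulr1n => /eqP; rewrite invr_eq0 expf_eq0 (negPf w0) andbF.
rewrite mulrCA e -rmorphM /=; congr fconst.
rewrite mulrBr mulr1 expfzDr // -exprnP -exprnN mulrA mulVf ?mul1r //.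
by rewrite expf_neq0.
Qed.

Definition fneg F : fps C := FPS (fun i => (-1) ^+ i * fcoef F i).

Lemma fnegM F H : fneg (F * H) = fneg F * fneg H.
Proof.
apply: fpsP => t; rewrite [RHS]fcoefME [LHS]/= mulr_sumr; apply: eq_bigr => i _ /=.
by rewrite mulrACA -exprD subnKC // -ltnS.
Qed.

Lemma fnegB F H : fneg (F - H) = fneg F - fneg H.
Proof. by apply: fpsP => t; rewrite /= mulrBr. Qed.

Lemma fnegC c : fneg (fconst c) = fconst c.
Proof. by apply: fpsP => -[|t]; rewrite /= ?expr0 ?mul1r // mulr0n mulr0. Qed.

Lemma fneg_pexpX c : fneg (pexpX c) = pexpX (- c).
Proof. by apply: fpsP => t; rewrite /= [(- c) ^+ t]exprNn mulrA. Qed.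

Lemma fnegX F t : fneg (F ^+ t) = fneg F ^+ t.
Proof.
elim: t => [|t IH]; last by rewrite !exprS fnegM IH.
exact: fnegC.
Qed.

Lemma plog_fneg H : plog (fneg H) = fneg (plog H).
Proof.
apply: fpsP => t; rewrite /= mulr_sumr; apply: eq_bigr => i _.
have -> : fneg H - 1 = fneg (H - 1) by rewrite fnegB; congr (_ - _); apply/esym/fnegC.
by rewrite -fnegX /= mulrCA.
Qed.

(** Changing the sign of the variable turns the denominator for [d] into the one for [- d] times
    [- w ^ d], and the numerators are related by the same factor. *)
Lemma Hd_opp d : (m%:Z %| d)%Z -> Hd (- d) = fneg (Hd d).
Proof.
move=> md; have w0 := omega_neq0 RR m n k.
apply: Hd_unique; first by rewrite dvdz_oppr.
have -> : den (- d) = - fconst (w ^ (- d)) * fneg (den d).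
  rewrite /den fnegB fnegM fnegC !fneg_pexpX opprK mulrBr !mulNr opprK mulrA.
  rewrite -rmorphM /= -expfzDr // addNr expr0z mul1r addrC.
  by [].
rewrite mulrCA -fnegM Hd_den // /num dvdz_oppr; case: ifPn => Nd.
  have -> : w ^ (- d) = 1 by apply: wN => //; rewrite dvdz_oppr.
  rewrite fnegM -(rmorph_nat (@fconst C)) fnegC mulN1r -mulrN; congr (_ * _).
  by apply: fpsP => -[|[|t]]; rewrite /= ?mulr0 ?oppr0 // expr1 mulr1 opprK.
rewrite fnegC mulNr -rmorphM -rmorphN /=; congr fconst.
by rewrite mulrBr mulr1 -expfzDr // addNr expr0z opprB.
Qed.

(* The logarithm of the paper's H_{i,j} for i - j = d, evaluated at y; being 0
   when m does not divide d, it makes the residue conditions on the products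
   over rows automatic. *)
Definition Gam d y : A := if (m%:Z %| d)%Z then ev (Gd d) y else 0.

Lemma Gam_sym d y : Gam (- d) (- y) = Gam d y.
Proof.
rewrite /Gam dvdz_oppr; case: (boolP (m%:Z %| d)%Z) => md; last by [].
rewrite /Gd (Hd_opp md) plog_fneg.
have gen (T : comNzRingType) (a b : T) i :
    ((-1) ^+ i * a) * ((-1) ^+ i * b) = a * b.
  by rewrite mulrACA -exprMn mulrNN mulr1 expr1n mul1r.
apply: eq_ssum => t /=; rewrite rmorphM rmorphXn rmorphN1 [(- y) ^+ t]exprNn.
exact: gen.
Qed.

Lemma GamE d y : (m%:Z %| d)%Z -> Gam d y = ev (Gd d) y.
Proof. by rewrite /Gam => ->. Qed.

Lemma Gam00 : Gam 0 0 = 0.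
Proof. by rewrite /Gam dvdz0 ev_at0 plog0 rmorph0. Qed.

Lemma Gam_mpower d y : mpower 1 y -> mpower 1 (Gam d y).
Proof.
move=> y1; rewrite /Gam; case: ifP => // _; apply: ev_mpower => //.
exact: plog0.
Qed.

Definition half_n : A := hsC (n%:R / 2%:R).

Lemma Exp_Gam d y : (m%:Z %| d)%Z -> mpower 1 y ->
  Exp (Gam d y) * (Exp (half_n * y) - hsC (w ^ d) * Exp (- (half_n * y))) =
  if (N%:Z %| d)%Z then n%:R * y else hsC (1 - w ^ d).
Proof.
move=> md y1; rewrite /Gam md Exp_plog ?Hd0 //.
have := congr1 (fun F : fps C => ev F y) (Hd_den md); rewrite /= evM // /den evB // evM //.
rewrite ev_const // !ev_pexpX rmorphN mulNr -/half_n => ->.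
rewrite /num; case: ifP => _; last exact: ev_const.
by rewrite -(rmorph_nat (@fconst C)) evM // ev_const // ev_var // rmorph_nat.
Qed.

End KernelSeries.

(** * Comparison of the matrix coefficients *)

Section Exponentials.
Variables (RR : realType) (m n : nat) (k : int).
Hypotheses (m_gt0 : (0 < m)%N) (n_gt0 : (0 < n)%N) (kn : coprimez k n%:Z).
Local Notation C := (RR[i]).
Local Notation A := (hseries RR).
Local Notation R := (hloc RR).
Local Notation w := (omega RR m n k).
Local Notation N := (m * n)%N.
Local Notation Gam := (@Gam RR m n k).
Local Notation hn := (half_n RR n).
Implicit Types (d : int) (x y : A).

Definition h1A : A := hsC N%:R^-1 * hs1 RR.
Local Notation a1 := h1A.
Definition h2A : A := hsC N%:R^-1 * hs2 RR.
Local Notation a2 := h2A.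
Definition h3A : A := - a1 - a2.
Local Notation a3 := h3A.

Lemma a1_mpower : mpower 1 a1.
Proof. exact/mpowerMl/mpower_hs1. Qed.
Lemma a2_mpower : mpower 1 a2.
Proof. exact/mpowerMl/mpower_hs2. Qed.
Lemma a3_mpower : mpower 1 a3.
Proof. by apply: mpowerB; [apply/mpowerN/a1_mpower|apply: a2_mpower]. Qed.

Let N_gt0 : (0 < N)%N.
Proof. by rewrite muln_gt0 m_gt0. Qed.

Lemma h1E : h1 RR m n = hemb a1.
Proof. by rewrite /h1 natR_inv // [hb1 RR * _]mulrC -rmorphM. Qed.
Lemma h2E : h2 RR m n = hemb a2.
Proof. by rewrite /h2 natR_inv // [hb2 RR * _]mulrC -rmorphM. Qed.
Lemma h3E : h3 RR m n = hemb a3.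
Proof.
rewrite /h3 /hb3 mulrBl mulNr -/(h1 RR m n) -/(h2 RR m n) h1E h2E.
by rewrite /h3A rmorphB rmorphN.
Qed.

(** These elements form a group that contains q1, q3 and all chi: [d] is determined by contents and
    [y] by positions. *)
Definition wexp d y : A := hsC (w ^ d) * Exp (n%:R * y).

Lemma wexpD d d' y y' : mpower 1 y -> mpower 1 y' ->
  wexp d y * wexp d' y' = wexp (d + d') (y + y').
Proof.
move=> y1 y1'; rewrite /wexp mulrDr ExpD; try exact: mpowerMl.
rewrite (expfzDr _ _ (omega_neq0 RR m n k)) (rmorphM (@hsC RR)).
exact: mulrACA.
Qed.

Lemma wexp0 : wexp 0 0 = 1.
Proof. by rewrite /wexp expr0z rmorph1 mulr0 Exp0 mulr1. Qed.

Lemma wexpV d y : mpower 1 y -> wexp d y * wexp (- d) (- y) = 1.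
Proof. move=> y1; rewrite (wexpD _ _ y1 (mpowerN y1)) !subrr; exact: wexp0. Qed.

Lemma wexpX d y t : mpower 1 y -> wexp d y ^+ t = wexp (d * t%:Z) (t%:R * y).
Proof.
move=> y1; elim: t => [|t IH]; first by rewrite mulr0 mul0r wexp0.
rewrite exprS IH (wexpD _ _ y1 (mpowerMl _ y1)); congr (wexp _ _).
  by rewrite -addn1 PoszD mulrDr mulr1 addrC.
have gen (T : comNzRingType) (z : T) : z + t%:R * z = t.+1%:R * z.
  by rewrite -natr1; ring.
exact: gen.
Qed.

Lemma hemb_wexpV d y : mpower 1 y ->
  (hemb (wexp d y))^-1 = hemb (wexp (- d) (- y)).
Proof. by move=> y1; apply/hemb_inv/wexpV. Qed.

Lemma hemb_wexp_unit d y : mpower 1 y -> hemb (wexp d y) \is a GRing.unit.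
Proof. by move=> y1; apply: hemb_unit (wexpV d y1). Qed.

Lemma hexp_wexp d y : mpower 1 y ->
  hcst (w ^ d) * hexp (hemb (n%:R * y)) = hemb (wexp d y).
Proof.
by move=> y1; rewrite hexp_hemb; [rewrite rmorphM|apply: mpowerMl].
Qed.

Lemma natC_invM (a b : nat) : (0 < a)%N -> (0 < b)%N ->
  b%:R * hsC (a * b)%:R^-1 = hsC a%:R^-1 :> A.
Proof.
move=> a0 b0; rewrite -(rmorph_nat (@hsC RR)) -rmorphM; congr hsC.
have a0' : (a%:R : C) != 0 by rewrite Num.Theory.pnatr_eq0 -lt0n.
have b0' : (b%:R : C) != 0 by rewrite Num.Theory.pnatr_eq0 -lt0n.
by rewrite natrM; field; apply/andP.
Qed.

Lemma q1E : q1 RR m n k = hemb (wexp 1 a1).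
Proof.
rewrite -hexp_wexp; last exact: a1_mpower.
rewrite /q1 expr1z; congr (_ * hexp _).
by rewrite natR_inv // [hb1 RR * _]mulrC -rmorphM /h1A mulrA natC_invM.
Qed.

Lemma q3E : q3 RR m n k = hemb (wexp (- 1) a3).
Proof.
rewrite -hexp_wexp; last exact: a3_mpower.
rewrite /q3; congr (_ * hexp _).
have e x : n%:R * (hsC N%:R^-1 * x) = hsC m%:R^-1 * x by rewrite mulrA natC_invM.
rewrite natR_inv // [hb3 RR * _]mulrC /hb3 -rmorphN -rmorphB -rmorphM.
congr hemb; rewrite -e; congr (_ * _).
by rewrite mulrBr mulrN.
Qed.

Lemma hnE y : hn * y + hn * y = n%:R * y.
Proof.
rewrite -mulrDl -rmorphD -mulr2n -[_ *+ 2]mulr_natr.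
by rewrite divfK ?rmorph_nat // Num.Theory.pnatr_eq0.
Qed.

Lemma hn_mpower y : mpower 1 y -> mpower 1 (hn * y).
Proof. exact: mpowerMl. Qed.

Lemma hb2_half : hb2 RR / (2 * m)%:R = hemb (hn * a2).
Proof.
rewrite natR_inv ?muln_gt0 // [hb2 RR * _]mulrC -rmorphM; congr hemb.
rewrite /h2A mulrA -rmorphM; congr (hsC _ * _).
have m0 : (m%:R : C) != 0 by rewrite Num.Theory.pnatr_eq0 -lt0n.
have n0 : (n%:R : C) != 0 by rewrite Num.Theory.pnatr_eq0 -lt0n.
by rewrite !natrM; field; rewrite m0 n0.
Qed.

Lemma qqE : qq RR m = hemb (Exp (hn * a2)).
Proof. by rewrite /qq hb2_half hexp_hemb //; apply/hn_mpower/a2_mpower. Qed.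

Lemma qqV : (qq RR m)^-1 = hemb (Exp (- (hn * a2))).
Proof. by rewrite qqE; apply/hemb_inv/ExpN/hn_mpower/a2_mpower. Qed.

Definition pn d y : A := Exp (hn * a2) - Exp (- (hn * a2)) * wexp d y.
Definition pd d y : A := 1 - wexp d y.

Lemma psi_numE d y : psi_num m (hemb (wexp d y)) = hemb (pn d y).
Proof. by rewrite /psi_num qqV qqE -rmorphM -rmorphB. Qed.

Lemma psi_denE d y : psi_den (hemb (wexp d y)) = hemb (pd d y).
Proof. by rewrite /psi_den -(rmorph1 (@hemb RR)) -rmorphB. Qed.

Definition Bfac d y : A := if (N%:Z %| d)%Z then n%:R * y else hsC (1 - w ^ d).

Lemma pd_Gam d y : (m%:Z %| d)%Z -> mpower 1 y ->
  pd d (- y) * Exp (Gam d y) = Exp (- (hn * y)) * Bfac d y.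
Proof.
move=> md y1; have hy := hn_mpower y1; rewrite /Bfac -(Exp_Gam m_gt0 n_gt0 kn md y1).
have -> : pd d (- y) =
    Exp (- (hn * y)) * (Exp (hn * y) - hsC (w ^ d) * Exp (- (hn * y))).
  have e2 : Exp (n%:R * - y) = Exp (- (hn * y)) * Exp (- (hn * y)).
    by rewrite mulrN -hnE opprD (ExpD (mpowerN hy) (mpowerN hy)).
  have gen (T : comNzRingType) (c e f : T) : e * f = 1 ->
      1 - c * (f * f) = f * (e - c * f).
    by move=> ef; rewrite mulrBr [f * e]mulrC ef mulrCA.
  by rewrite /pd /wexp e2; apply/gen/ExpN.
by rewrite -mulrA; congr (_ * _); apply: mulrC.
Qed.

(** [q - q^-1 z = q (1 - q^-2 z)] with [q^2 = Exp (n * a2)]: the numerator of psi is its denominator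
    at a shifted position, so a single kernel identity handles both. *)
Lemma pn_pd d y : mpower 1 y -> pn d y = Exp (hn * a2) * pd d (y - a2).
Proof.
move=> y1; have h2 := hn_mpower a2_mpower; have h2' := mpowerN h2.
have a2' := mpowerN a2_mpower.
have e : Exp (n%:R * (y - a2)) = Exp (n%:R * y) *
    (Exp (- (hn * a2)) * Exp (- (hn * a2))).
  by rewrite mulrDr (ExpD (mpowerMl _ y1) (mpowerMl _ a2')) mulrN -(hnE a2) opprD
    (ExpD h2' h2').
rewrite /pn /pd /wexp e.
have gen (T : comNzRingType) (a b c f : T) : b * a = 1 ->
  b - a * (c * f) = b * (1 - c * (f * (a * a))).
  move=> ba; transitivity (b - (b * a) * (a * (c * f))); last by ring.
  by rewrite ba mul1r.
exact/gen/ExpN.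
Qed.

Lemma psi_ratio d y : (m%:Z %| d)%Z -> mpower 1 y ->
  pn d (- y) * Exp (Gam d (y + a2)) = Exp (- (hn * y)) * Bfac d (y + a2).
Proof.
move=> md y1; have h2 := hn_mpower a2_mpower; have h2' := mpowerN h2.
have y1' := mpowerN y1; have hy := mpowerN (hn_mpower y1).
have ya : mpower 1 (y + a2) := mpowerD y1 a2_mpower.
have e : - y - a2 = - (y + a2) by rewrite opprD.
rewrite (pn_pd d y1') e -[LHS]mulrA (pd_Gam md ya) [LHS]mulrA; congr (_ * _).
rewrite mulrDr opprD (ExpD hy h2').
have gen (T : comNzRingType) (a b c : T) : b * a = 1 -> b * (c * a) = c.
  by move=> ba; rewrite mulrCA ba mulr1.
exact/gen/ExpN.
Qed.

End Exponentials.

Section RowProducts.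
Variables (r : nat) (T : comNzRingType).
Implicit Types (la : mpart r) (P : 'I_r -> nat -> bool) (F G : 'I_r -> nat -> T).

Definition rowprod M P F1 F2 : T :=
  (\prod_(a < r) \prod_(1 <= s < M.+1 | P a s) F1 a s) *
  (\prod_(a < r) \prod_(1 <= s < M.+2 | P a s) F2 a s).

Lemma pprod_rowprod N p la P j F1 F2 :
  pprod N p la P j F1 F2 = rowprod (cutoff la) P
    (fun a s => if (content p la a s == j %[mod N%:Z])%Z then F1 a s else 1)
    (fun a s => if (content p la a s == j + 1 %[mod N%:Z])%Z then F2 a s else 1).
Proof.
by congr (_ * _); apply: eq_bigr => a _; rewrite big_mkcondr.
Qed.

Lemma rowprodM M P F1 F2 G1 G2 :
  rowprod M P F1 F2 * rowprod M P G1 G2 =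
  rowprod M P (fun a s => F1 a s * G1 a s) (fun a s => F2 a s * G2 a s).
Proof.
rewrite /rowprod mulrACA; congr (_ * _); rewrite -big_split;
  by apply: eq_bigr => a _; rewrite big_split.
Qed.

Lemma eq_rowprod M P F1 F2 G1 G2 :
  (forall a s, (0 < s)%N -> P a s -> F1 a s = G1 a s) ->
  (forall a s, (0 < s)%N -> P a s -> F2 a s = G2 a s) ->
  rowprod M P F1 F2 = rowprod M P G1 G2.
Proof.
move=> e1 e2; congr (_ * _); apply: eq_bigr => a _.
  rewrite big_nat_cond [RHS]big_nat_cond.
  by apply: eq_bigr => s /andP[/andP[s0 _] /e1->].
rewrite big_nat_cond [RHS]big_nat_cond.
by apply: eq_bigr => s /andP[/andP[s0 _] /e2->].
Qed.

End RowProducts.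

Lemma Exp_rowsum (RR : realType) (r : nat) M (P : 'I_r -> nat -> bool)
    (F1 F2 : 'I_r -> nat -> hseries RR) :
  (forall a s, mpower 1 (F1 a s)) -> (forall a s, mpower 1 (F2 a s)) ->
  Exp (rowsum M P F1 F2) =
  rowprod M P (fun a s => Exp (F1 a s)) (fun a s => Exp (F2 a s)).
Proof.
move=> m1 m2; rewrite ExpD; last 2 first.
- by apply: mpower_sum => a _; apply: mpower_sum => s _.
- by apply: mpower_sum => a _; apply: mpower_sum => s _.
congr (_ * _); rewrite Exp_sum; try by move=> a _; apply: mpower_sum.
  by apply: eq_bigr => a _; rewrite Exp_sum.
by apply: eq_bigr => a _; rewrite Exp_sum.
Qed.

Lemma rmorph_rowprod (T U : comNzRingType) (f : {rmorphism T -> U}) (r : nat)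
    M (P : 'I_r -> nat -> bool) (F1 F2 : 'I_r -> nat -> T) :
  f (rowprod M P F1 F2) =
  rowprod M P (fun a s => f (F1 a s)) (fun a s => f (F2 a s)).
Proof.
by rewrite rmorphM; congr (_ * _); rewrite rmorph_prod; apply: eq_bigr => a _;
  rewrite rmorph_prod.
Qed.

Lemma eqz_mod_shift (d x y j t : int) : (y == j + t %[mod d])%Z ->
  (x == j %[mod d])%Z = (d %| y - x - t)%Z.
Proof.
rewrite !eqz_mod_dvd => h.
have -> : y - x - t = y - (j + t) - (x - j) by ring.
by rewrite [RHS]rpredBl.
Qed.

Lemma hembM (RR : realType) (x y : hseries RR) :
  hemb x * hemb y = hemb (x * y).
Proof. by rewrite rmorphM. Qed.

Section Comparison.
Variables (RR : realType) (m n : nat) (k : int) (r : nat).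
Hypotheses (m_gt0 : (0 < m)%N) (n_gt0 : (0 < n)%N) (kn : coprimez k n%:Z).
Local Notation A := (hseries RR).
Local Notation R := (hloc RR).
Local Notation w := (omega RR m n k).
Local Notation N := (m * n)%N.
Local Notation Gam := (@Gam RR m n k).
Local Notation wexp := (wexp m n k).
Local Notation pn := (pn m n k).
Local Notation pd := (pd m n k).
Local Notation a1 := (h1A RR m n).
Local Notation a2 := (h2A RR m n).
Local Notation a3 := (h3A RR m n).
Variables (p : 'I_r -> nat) (v : 'I_r -> A).
Hypothesis v_mpower : forall a, mpower 1 (v a).
Let p' a := (p a %% m)%N.
Let u' a : R := hcst (w ^- p a) * hexp (n%:R * hemb (v a)).
Let vy a : R := hemb (v a).
Local Notation pos := (box_pos a1 a3 v).
Local Notation cont := (box_cont p).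
Implicit Types (la : mpart r) (a b : 'I_r) (s l : nat) (j : int).

Definition row_pos la a s : A := pos a s (lam la a s).
Local Notation kpos := row_pos.
Definition row_cont la a s : int := cont a s (lam la a s).
Local Notation kcont := row_cont.

Lemma kpos_mpower la a s : mpower 1 (kpos la a s).
Proof.
apply: mpowerD => //; apply: mpowerD; apply: mpowerMl.
  exact: a1_mpower.
exact: a3_mpower.
Qed.

Lemma xposE la a s : xpos m n vy la a s = hemb (kpos la a s).
Proof.
have gen (t : nat) x : (t%:R : R) * hemb x = hemb (t%:R * x).
  by rewrite (rmorphM (@hemb RR)) (rmorph_nat (@hemb RR)).
by rewrite /xpos h1E // h3E // !gen -!rmorphD.
Qed.

Lemma contentE la a s : content p la a s = kcont la a s.
Proof. by []. Qed.

Lemma chiE la a s : (0 < s)%N ->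
  chi m n k u' la a s = hemb (wexp (1 - kcont la a s) (kpos la a s)).
Proof.
move=> s0; have e1 := mpowerMl (lam la a s)%:R (a1_mpower RR m n).
have e3 := mpowerMl s.-1%:R (a3_mpower RR m n).
have eu : u' a = hemb (wexp (- (p a)%:Z) (v a)).
  rewrite -(hexp_wexp m n k _ (v_mpower a)) /u' exprnN; congr (_ * hexp _).
  by rewrite (rmorphM (@hemb RR)) (rmorph_nat (@hemb RR)).
have q1' := q1E RR k m_gt0 n_gt0; have q3' := q3E RR k m_gt0 n_gt0.
have gen d (y : A) t : mpower 1 y -> hemb (wexp d y) ^+ t = hemb (wexp (d * t%:Z) (t%:R * y)).
  by move=> y1; rewrite -(wexpX _ _ _ _ t y1) rmorphXn.
set t := lam la a s; set t' := s.-1.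
have E1 : q1 RR m n k ^+ t = hemb (wexp (1 * t%:Z) (t%:R * a1)).
  by rewrite q1'; apply/gen/a1_mpower.
have E3 : q3 RR m n k ^+ t' = hemb (wexp (- 1 * t'%:Z) (t'%:R * a3)).
  by rewrite q3'; apply/gen/a3_mpower.
transitivity (hemb (wexp (1 * t%:Z) (t%:R * a1)) *
    hemb (wexp (- 1 * t'%:Z) (t'%:R * a3)) * hemb (wexp (- (p a)%:Z) (v a))).
  exact: (congr2 *%R (congr2 *%R E1 E3) eu).
apply: etrans (congr1 (fun z => z * _) (hembM _ _)) _; apply: etrans (hembM _ _) _.
rewrite (wexpD _ _ _ _ _ e1 e3) (wexpD _ _ _ _ _ (mpowerD e1 e3) (v_mpower a)).
by congr (hemb (wexp _ _)); rewrite /row_cont /box_cont /t /t'; lia.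
Qed.

Lemma chi_quot1 la a s b l : (0 < s)%N -> (0 < l)%N ->
  chi m n k u' la a s / (q1 RR m n k * chi m n k u' la b l) =
  hemb (wexp (kcont la b l - kcont la a s - 1)
             (- (kpos la b l - kpos la a s + a1))).
Proof.
move=> s0 l0; have am := kpos_mpower la a s; have lm := kpos_mpower la b l.
have a1m := a1_mpower RR m n; have al := mpowerD a1m lm.
have al' := mpowerN al; have ea := chiE la a s0; have eb := chiE la b l0.
have E1 : q1 RR m n k * chi m n k u' la b l =
    hemb (wexp (1 + (1 - kcont la b l)) (a1 + kpos la b l)).
  apply: etrans (congr2 *%R (q1E RR k m_gt0 n_gt0) eb) _.
  by apply: etrans (hembM _ _) (congr1 _ _); apply: wexpD.
have E2 := etrans (congr1 (@GRing.inv _) E1) (hemb_wexpV m n k _ al).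
apply: etrans (congr2 *%R ea E2) _; apply: etrans (hembM _ _) (congr1 _ _).
apply: etrans (wexpD m n k _ _ am al') _; congr (wexp _ _); first by lia.
have gen (T : comNzRingType) (x y z : T) : x - (z + y) = - (y - x + z) by ring.
exact: gen.
Qed.

Lemma chi_quot2 la a s b l : (0 < s)%N -> (0 < l)%N ->
  chi m n k u' la b l / chi m n k u' la a s =
  hemb (wexp (- (kcont la b l - kcont la a s)) (kpos la b l - kpos la a s)).
Proof.
move=> s0 l0; have am := kpos_mpower la a s; have lm := kpos_mpower la b l.
have am' := mpowerN am.
have E2 := etrans (congr1 (@GRing.inv _) (chiE la a s0)) (hemb_wexpV m n k _ am).
apply: etrans (congr2 *%R (chiE la b l0) E2) _.
apply: etrans (hembM _ _) (congr1 _ _).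
by apply: etrans (wexpD m n k _ _ lm am') _; congr (wexp _ _); lia.
Qed.

Let ratio_gen (T : comNzRingType) (pn pd G1 G2 G2' B1 B2 E yn yd : T) :
  pn * G2 = E * B2 -> pd * G1 = E * B1 -> G2 * G2' = 1 -> B2 * yd = B1 * yn ->
  pn * yd = pd * yn * (G1 * G2').
Proof.
move=> e2 e1 g b.
transitivity ((pn * G2) * yd * G2'); first by rewrite -[LHS]mulr1 -g; ring.
transitivity (E * (B2 * yd) * G2'); first by rewrite e2; ring.
rewrite b; transitivity ((E * B1) * yn * G2'); first by ring.
by rewrite -e1; ring.
Qed.

Lemma Gam_eq0 d y : ~~ (m%:Z %| d)%Z -> Gam d y = 0.
Proof. by move=> /negPf e; rewrite /Gam e. Qed.

Lemma dvd_mN d : (N%:Z %| d)%Z -> (m%:Z %| d)%Z.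
Proof. by apply: dvdz_trans; rewrite PoszM dvdz_mulr. Qed.

Local Notation K1 := (K1 Gam a1 a3 p v).
Local Notation K2 := (K2 Gam a1 a2 a3 p v).

Lemma ExpB x y : mpower 1 x -> mpower 1 y -> Exp (x - y) = Exp x * Exp (- y) :> A.
Proof. by move=> x1 y1; apply: ExpD => //; apply: mpowerN. Qed.

Let ynum1 la a s b l : A := kpos la a s - kpos la b l + a3.
Let yden1 la a s b l : A := kpos la a s - kpos la b l - a1.
Let ynum2 la a s b l : A := kpos la b l - kpos la a s - a2.
Let yden2 la a s b l : A := kpos la b l - kpos la a s.

Let if_gen (T : comNzRingType) (c : bool) (e x1 x2 yn yd : T) :
  x2 * yd = x1 * yn ->
  (if c then x2 else e) * (if c then yd else 1) =
  (if c then x1 else e) * (if c then yn else 1).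
Proof. by case: c. Qed.

(** [psi_ratio] and [pd_Gam] share the prefactor [Exp (- (hn * (y + a1)))], which cancels. The two
    values of [Bfac] leave the Yangian factor, up to a common scalar, if [N] divides [D - 1], and
    are equal constants otherwise. If [m] does not divide [D - 1] there is no factor on either side
    and [Gam] is 0. *)
Lemma ratio1 la a s b l : let D := kcont la b l - kcont la a s in
  let y := kpos la b l - kpos la a s in
  (if (m%:Z %| D - 1)%Z then pn (D - 1) (- (y + a1)) else 1) *
  (if (N%:Z %| D - 1)%Z then yden1 la a s b l else 1) =
  (if (m%:Z %| D - 1)%Z then pd (D - 1) (- (y + a1)) else 1) *
  (if (N%:Z %| D - 1)%Z then ynum1 la a s b l else 1) *
  Exp (K1 b l (lam la b l) a s (lam la a s)).
Proof.
move=> D y; have y1 : mpower 1 y.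
  by apply: mpowerB; apply: kpos_mpower.
have ya : mpower 1 (y + a1) by apply: mpowerD => //; apply: a1_mpower.
have yb : mpower 1 (y - a3) by apply: mpowerB => //; apply: a3_mpower.
case: (boolP (m%:Z %| D - 1)%Z) => md; last first.
  have nN : (N%:Z %| D - 1)%Z = false.
    by apply/negbTE; apply: contra md; apply: dvd_mN.
  rewrite nN /K1 /= -/(kcont la b l) -/(kcont la a s) -/D !Gam_eq0 // subrr Exp0.
  by rewrite !mulr1.
have -> : K1 b l (lam la b l) a s (lam la a s) =
  Gam (D - 1) (y + a1) - Gam (D - 1) (y - a3) by [].
rewrite ExpB; try exact: Gam_mpower.
have e2 := psi_ratio m_gt0 n_gt0 kn md ya.
have e1 := pd_Gam m_gt0 n_gt0 kn md ya.
have eya : y + a1 + a2 = y - a3.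
  have gen (T : comNzRingType) (z x e : T) : z + x + e = z - (- x - e) by ring.
  exact: gen.
rewrite eya in e2.
apply: (ratio_gen e2 e1); first exact/ExpN/Gam_mpower.
rewrite /Bfac; apply: if_gen.
have gen (T : comNzRingType) (nn x z c e : T) :
  nn * (z - x - e) * (x - z - c) = nn * (z - x + c) * (x - z + e) by ring.
exact: gen.
Qed.

Lemma ratio2 la a s b l : let D := kcont la b l - kcont la a s in
  let y := kpos la b l - kpos la a s in
  (if (m%:Z %| D)%Z then pn (- D) y else 1) *
  (if (N%:Z %| D)%Z then yden2 la a s b l else 1) =
  (if (m%:Z %| D)%Z then pd (- D) y else 1) *
  (if (N%:Z %| D)%Z then ynum2 la a s b l else 1) *
  Exp (K2 b l (lam la b l) a s (lam la a s)).
Proof.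
move=> D y; have y1 : mpower 1 y.
  by apply: mpowerB; apply: kpos_mpower.
have ya : mpower 1 (- y) by apply: mpowerN.
have yb : mpower 1 (y - a2) by apply: mpowerB => //; apply: a2_mpower.
case: (boolP (m%:Z %| D)%Z) => md; last first.
  have nN : (N%:Z %| D)%Z = false.
    by apply/negbTE; apply: contra md; apply: dvd_mN.
  rewrite nN /K2 /= -/(kcont la b l) -/(kcont la a s) -/D !Gam_eq0 // subrr Exp0.
  by rewrite !mulr1.
have -> : K2 b l (lam la b l) a s (lam la a s) = Gam D y - Gam D (y - a2) by [].
rewrite ExpB; try exact: Gam_mpower.
have md' : (m%:Z %| - D)%Z by rewrite dvdz_oppr.
have e2 := psi_ratio m_gt0 n_gt0 kn md' ya.
have e1 := pd_Gam m_gt0 n_gt0 kn md' ya.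
have eya : - y + a2 = - (y - a2).
  have gen (T : comNzRingType) (z e : T) : - z + e = - (z - e) by ring.
  exact: gen.
rewrite eya [- - y]opprK (Gam_sym m_gt0 n_gt0 kn) in e2.
rewrite [- - y]opprK (Gam_sym m_gt0 n_gt0 kn) in e1.
apply: (ratio_gen e2 e1); first exact/ExpN/Gam_mpower.
rewrite /Bfac dvdz_oppr; apply: if_gen.
have gen (T : comNzRingType) (nn x z c : T) :
  nn * - (z - x - c) * (z - x) = nn * - (z - x) * (z - x - c) by ring.
exact: gen.
Qed.

Definition Sk P la b l : A :=
  Srow Gam a1 a2 a3 p v P (cutoff la) la b l (lam la b l).

Lemma Sk_mpower P la b l : mpower 1 (Sk P la b l).
Proof.
exact: (@Srow_m r A (@mpower RR 1) Gam a1 a2 a3 p v (@mpower_0 RR 1)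
  (@mpowerD RR 1) (@mpowerN RR 1)
  (@mpowerMl RR 1) (@Gam_mpower RR m n k) erefl (a1_mpower RR m n)
  (a2_mpower RR m n) v_mpower).
Qed.

Lemma tor_prodE (psi : R -> R) (ps : int -> A -> A) P la b l j :
  (forall d y, psi (hemb (wexp d y)) = hemb (ps d y)) ->
  (0 < l)%N -> (kcont la b l == j + 1 %[mod m%:Z])%Z ->
  tor_prod m n k p' u' psi P la b l j =
  hemb (rowprod (cutoff la) (fun a s => P a s b l)
    (fun a s => if (m%:Z %| kcont la b l - kcont la a s - 1)%Z then
       ps (kcont la b l - kcont la a s - 1) (- (kpos la b l - kpos la a s + a1))
     else 1)
    (fun a s => if (m%:Z %| kcont la b l - kcont la a s)%Z then
       ps (- (kcont la b l - kcont la a s)) (kpos la b l - kpos la a s)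
     else 1)).
Proof.
move=> psiE l0 hj; rewrite /tor_prod pprod_rowprod.
apply: etrans (esym (rmorph_rowprod (@hemb RR) _ _ _ _)).
apply: eq_rowprod => a s s0 _.
  rewrite (@content_mod m r p la a s j) (eqz_mod_shift (kcont la a s) hj).
  case: ifP => _; last exact: (esym (rmorph1 (@hemb RR))).
  exact: etrans (congr1 psi (chi_quot1 la a b s0 l0)) (psiE _ _).
have hj' : (kcont la b l == j + 1 + 0 %[mod m%:Z])%Z by rewrite addr0.
rewrite (@content_mod m r p la a s (j + 1)) (eqz_mod_shift (kcont la a s) hj') subr0.
case: ifP => _; last exact: (esym (rmorph1 (@hemb RR))).
exact: etrans (congr1 psi (chi_quot2 la a b s0 l0)) (psiE _ _).
Qed.

Definition ynumA P la b l : A := rowprod (cutoff la) (fun a s => P a s b l)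
  (fun a s => if (N%:Z %| kcont la b l - kcont la a s - 1)%Z
    then ynum1 la a s b l else 1)
  (fun a s => if (N%:Z %| kcont la b l - kcont la a s)%Z
    then ynum2 la a s b l else 1).

Definition ydenA P la b l : A := rowprod (cutoff la) (fun a s => P a s b l)
  (fun a s => if (N%:Z %| kcont la b l - kcont la a s - 1)%Z
    then yden1 la a s b l else 1)
  (fun a s => if (N%:Z %| kcont la b l - kcont la a s)%Z
    then yden2 la a s b l else 1).

Lemma yang_pprodE P la b l j (F1 F2 : 'I_r -> nat -> R) (f1 f2 : 'I_r -> nat -> A) :
  (forall a s, F1 a s = hemb (f1 a s)) -> (forall a s, F2 a s = hemb (f2 a s)) ->
  (kcont la b l == j + 1 %[mod N%:Z])%Z ->
  pprod N p la (fun a s => P a s b l) j F1 F2 =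
  hemb (rowprod (cutoff la) (fun a s => P a s b l)
    (fun a s => if (N%:Z %| kcont la b l - kcont la a s - 1)%Z
       then f1 a s else 1)
    (fun a s => if (N%:Z %| kcont la b l - kcont la a s)%Z
       then f2 a s else 1)).
Proof.
move=> e1 e2 hj; rewrite pprod_rowprod.
apply: etrans (esym (rmorph_rowprod (@hemb RR) _ _ _ _)).
apply: eq_rowprod => a s s0 _.
  rewrite contentE (eqz_mod_shift (kcont la a s) hj).
  by case: ifP => _; [apply: e1|apply: (esym (rmorph1 (@hemb RR)))].
have hj' : (kcont la b l == j + 1 + 0 %[mod N%:Z])%Z by rewrite addr0.
rewrite contentE (eqz_mod_shift (kcont la a s) hj') subr0.
by case: ifP => _; [apply: e2|apply: (esym (rmorph1 (@hemb RR)))].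
Qed.

Lemma yang_numE P la b l j : (kcont la b l == j + 1 %[mod N%:Z])%Z ->
  yang_num m n p vy P la b l j = hemb (ynumA P la b l).
Proof.
apply: yang_pprodE => a s.
  by rewrite !xposE h3E // -rmorphB -rmorphD.
by rewrite !xposE h2E // -!rmorphB.
Qed.

Lemma yang_denE P la b l j : (kcont la b l == j + 1 %[mod N%:Z])%Z ->
  yang_den m n p vy P la b l j = hemb (ydenA P la b l).
Proof.
apply: yang_pprodE => a s.
  by rewrite !xposE h1E // -!rmorphB.
by rewrite !xposE -rmorphB.
Qed.

(** Cross-multiplied, because the quotients exist in R only under non-resonance. *)
Lemma tor_yang P la b l i j : (0 < l)%N ->
  (kcont la b l == i + 1 %[mod N%:Z])%Z -> (kcont la b l == j + 1 %[mod m%:Z])%Z ->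
  tor_num m n k p' u' P la b l j * yang_den m n p vy P la b l i =
  tor_den m n k p' u' P la b l j * yang_num m n p vy P la b l i *
  hemb (Exp (Sk P la b l)).
Proof.
move=> l0 hi hj; rewrite (yang_numE _ hi) (yang_denE _ hi).
have hn := tor_prodE P (psi_numE k m_gt0 n_gt0) l0 hj.
have hd := tor_prodE P (psi_denE m n k) l0 hj.
apply: etrans (congr2 *%R hn erefl) _; apply: etrans (hembM _ _) _; apply: esym.
apply: etrans (congr2 *%R (congr2 *%R hd erefl) erefl) _.
apply: etrans (congr2 *%R (hembM _ _) erefl) _; apply: etrans (hembM _ _) _.
congr hemb; apply: esym; rewrite /Sk /Srow Exp_rowsum; last first.
- move=> a s; exact: (@K2_m r A (@mpower RR 1) Gam a1 a2 a3 p v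
  (@mpowerD RR 1) (@mpowerN RR 1)
  (@mpowerMl RR 1) (@Gam_mpower RR m n k) erefl (a1_mpower RR m n)
  (a2_mpower RR m n) v_mpower).
- move=> a s; exact: (@K1_m r A (@mpower RR 1) Gam a1 a2 a3 p v
  (@mpowerD RR 1) (@mpowerN RR 1)
  (@mpowerMl RR 1) (@Gam_mpower RR m n k) erefl (a1_mpower RR m n)
  (a2_mpower RR m n) v_mpower).
apply: etrans (rowprodM _ _ _ _ _ _) _; apply: esym.
apply: etrans (congr2 *%R (rowprodM _ _ _ _ _ _) erefl) _.
apply: etrans (rowprodM _ _ _ _ _ _) _.
by apply: eq_rowprod => a s _ _; [apply/esym/ratio1|apply/esym/ratio2].
Qed.

End Comparison.

(** * Non-vanishing of the Yangian coefficients *)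

Section RowProductZeros.
Variables (r : nat) (T : idomainType).
Implicit Types (P : 'I_r -> nat -> bool) (F G : 'I_r -> nat -> T).

Lemma rowprod_eq0 M P F1 F2 a s : (0 < s)%N -> (s < M.+2)%N -> P a s ->
  F2 a s = 0 -> rowprod M P F1 F2 = 0.
Proof.
move=> s0 sM Ps Fs; rewrite /rowprod; apply/eqP; rewrite mulf_eq0.
apply/orP; right; apply/eqP; rewrite (bigD1 a) //= big_mkcond.
by rewrite (bigD1_seq s) ?mem_index_iota ?iota_uniq ?s0 //= Ps Fs !mul0r.
Qed.

Lemma rowprod_neq0 M P F1 F2 :
  (forall a s, (0 < s)%N -> (s < M.+1)%N -> P a s -> F1 a s != 0) ->
  (forall a s, (0 < s)%N -> (s < M.+2)%N -> P a s -> F2 a s != 0) ->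
  rowprod M P F1 F2 != 0.
Proof.
have nz K (F : 'I_r -> nat -> T) :
    (forall a s, (0 < s)%N -> (s < K)%N -> P a s -> F a s != 0) ->
    \prod_(a < r) \prod_(1 <= s < K | P a s) F a s != 0.
  move=> Fn; apply/prodf_neq0 => a _; rewrite big_nat_cond.
  elim/big_ind: _ => [|x y|s /andP[/andP[s0 sK] Ps]].
  - exact: oner_neq0.
  - exact: mulf_neq0.
  - exact: Fn.
by move=> h1' h2'; apply: mulf_neq0; apply: nz.
Qed.

End RowProductZeros.

Lemma path_nseq (x : nat) t s : path geq x s -> path geq x (nseq t x ++ s).
Proof. by move=> xs; elim: t => //= t ->; rewrite /= leqnn. Qed.

(** The shape needed in [ynum_neq0]: a block of long rows, one row that can be lengthened, and a
    tail of ones that makes the partition as high as desired. *)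
Lemma part_stair l y z M : (0 < l)%N -> (0 < z)%N -> (z <= y)%N ->
  is_part (nseq l y ++ z :: nseq M 1%N).
Proof.
move=> l0 z0 zy; apply/andP; split; last first.
  rewrite mem_cat in_cons !mem_nseq.
  by apply/negP => /or3P[/andP[_ /eqP e]|/eqP e|/andP[_ /eqP e]] //; lia.
case: l l0 => // l _; apply: path_nseq; rewrite /= zy /=.
have := path_nseq M (isT : path geq 1%N [::]); rewrite cats0.
by case: M => //= M ->; rewrite z0.
Qed.

Lemma incr_nth_cat l y z (t : seq nat) :
  incr_nth (nseq l y ++ z :: t) l = nseq l y ++ z.+1 :: t.
Proof. by elim: l => //= l ->. Qed.

Lemma pos_next (r : nat) (A : comNzRingType) (f g : A) (v : 'I_r -> A) a s x :
  (0 < s)%N -> box_pos f g v a s.+1 x = box_pos f g v a s x + g.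
Proof.
by case: s => // s _; rewrite /box_pos -[s.+2.-1]/(s.+1) -[s.+1.-1]/s -natr1; ring.
Qed.

Lemma pos_longer (r : nat) (A : comNzRingType) (f g : A) (v : 'I_r -> A) a s x :
  box_pos f g v a s x.+1 = box_pos f g v a s x + f.
Proof. by rewrite /box_pos -natr1; ring. Qed.

Section NonVanishing.
Variables (RR : realType) (m n : nat) (k : int) (r : nat).
Hypotheses (m_gt0 : (0 < m)%N) (n_gt0 : (0 < n)%N) (kn : coprimez k n%:Z).
Local Notation C := (RR[i]).
Local Notation A := (hseries RR).
Local Notation R := (hloc RR).
Local Notation w := (omega RR m n k).
Local Notation N := (m * n)%N.
Local Notation a1 := (h1A RR m n).
Local Notation a3 := (h3A RR m n).
Variables (p : 'I_r -> nat) (v : 'I_r -> A).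
Hypothesis v_mpower : forall a, mpower 1 (v a).
Let p' a := (p a %% m)%N.
Let u' a : R := hcst (w ^- p a) * hexp (n%:R * hemb (v a)).
Let vy a : R := hemb (v a).
Local Notation kpos := (row_pos m n v).
Local Notation kcont := (row_cont p).
Implicit Types (la : mpart r) (a b : 'I_r) (s l : nat) (j : int).
Hypothesis nonres : yang_nonresonant m n p vy.

(** The coefficient of hbar_2, which occurs only in [a3], gives [j = 0]; that of hbar_1 then gives
    [i = 0]. *)
Lemma a1_a3_indep (i j : int) : i%:~R * a1 + j%:~R * a3 = 0 -> i = 0 /\ j = 0.
Proof.
have cE (z : int) (x : A) t t' :
    fcoef (fcoef (z%:~R * x) t) t' = z%:~R * fcoef (fcoef x t) t'.
  by rewrite -(rmorph_int (@hsC RR)) /hsC !fcoefCM.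
have dE (c : C) (x : A) t t' :
    fcoef (fcoef (hsC c * x) t) t' = c * fcoef (fcoef x t) t'.
  by rewrite /hsC !fcoefCM.
have N0 : (N%:R^-1 : C) != 0.
  by rewrite invr_eq0 Num.Theory.pnatr_eq0 -lt0n muln_gt0 m_gt0.
move=> e.
have e10 : fcoef (fcoef (i%:~R * a1 + j%:~R * a3) 0) 1 = 0 by rewrite e.
have e01 : fcoef (fcoef (i%:~R * a1 + j%:~R * a3) 1) 0 = 0 by rewrite e.
move: e10 e01; rewrite !fcoefD !cE /h3A !fcoefB !fcoefN !dE /=.
rewrite !mulr1 !mulr0 oppr0 addr0 !add0r => e10 /eqP.
rewrite mulrN oppr_eq0 mulf_eq0 (negPf N0) orbF intr_eq0 => /eqP j0.
move: e10; rewrite j0 mul0r addr0 => /eqP.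
by rewrite mulf_eq0 (negPf N0) orbF intr_eq0 => /eqP.
Qed.

Lemma kpos_diff la b s l : (0 < s)%N -> (0 < l)%N ->
  kpos la b s - kpos la b l =
  ((lam la b s)%:Z - (lam la b l)%:Z)%:~R * a1 + (s%:Z - l%:Z)%:~R * a3.
Proof.
case: s => // s _; case: l => // l _; rewrite /row_pos /box_pos /=.
have -> : (s.+1%:Z - l.+1%:Z) = s%:Z - l%:Z by lia.
rewrite !intrB -!pmulrn.
move: (lam la b s.+1)%:R (lam la b l.+1)%:R (s%:R) (l%:R) (v b) a1 a3.
have gen (T : comNzRingType) (x y z t f g h : T) :
  x * g + z * h + f - (y * g + t * h + f) = (x - y) * g + (z - t) * h by ring.
by move=> *; apply: gen.
Qed.

(** Two rows with congruent contents in the same position would produce a zero factor of [yang_den],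
    against non-resonance. The bound on [s] is the range of the second product. *)
Lemma pos_collision P la b l a s : P = @prec r \/ P = @succ r ->
  addable la b l -> P a s b l -> (0 < s)%N -> (s < (cutoff la).+2)%N ->
  (N%:Z %| kcont la b l - kcont la a s)%Z -> kpos la b l != kpos la a s.
Proof.
move=> hP al Ps s0 sM hN; apply/eqP => e.
have ej : (kcont la b l == kcont la b l - 1 + 1 %[mod N%:Z])%Z by rewrite subrK.
have [] := nonres al (eqxx _) hP.
rewrite (@yang_denE RR m n r m_gt0 n_gt0 p v P la b l _ ej) hemb_neq0.
move=> /negP[]; apply/eqP; apply: (rowprod_eq0 _ s0 sM Ps).
by rewrite hN e subrr.
Qed.

Lemma prec_succ_neq P a s b l : P = @prec r \/ P = @succ r -> P a s b l ->
  a = b -> s != l.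
Proof.
by case=> -> h e; move: h; rewrite e /succ /prec ltnn eqxx /= ltn_neqAle => /andP[];
  rewrite // eq_sym.
Qed.

Lemma prec_succ_row P a s s' b l l' : P = @prec r \/ P = @succ r -> a != b ->
  P a s b l = P a s' b l'.
Proof.
by case=> -> /negPf nab; rewrite /succ /prec ?nab // eq_sym nab.
Qed.

(** Within one partition, a zero gives by [a1_a3_indep] two neighbouring rows whose lengths
    contradict either the addability of the box or the monotonicity of the parts. Between two
    partitions, one of them is changed so that the zero becomes a collision of positions. *)
Lemma ynum_neq0 P la b l : P = @prec r \/ P = @succ r -> addable la b l ->
  ynumA m n p v P la b l != 0.
Proof.
move=> hP al; have l0 := addable_gt0 al; apply: rowprod_neq0 => a s s0 sM Ps.
  case: ifP => [hN|_]; last exact: oner_neq0.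
  apply/eqP => e; have [ab|nab] := eqVneq a b.
    have sl := prec_succ_neq hP Ps ab; subst a.
    move: e; rewrite kpos_diff // -{2}[a3]mul1r -addrA -mulrDl -[1]/(1%:~R) -intrD.
    move=> /a1_a3_indep[e1 e2].
    have {}e2 : s%:Z - l%:Z + 1 = 0 := e2.
    have {}e1 : (lam la b s)%:Z - (lam la b l)%:Z = 0 := e1.
    have sl' : s.+1 = l by lia.
    by have := addable_lt al s0; rewrite -sl' ltnSn => /(_ isT); rewrite sl'; lia.
  (* Repeating row s of the a-th partition turns the zero of the numerator
     into a zero of a denominator. *)
  have [la' [al' cM lb la1]] : exists la', [/\ addable la' b l,
      (s <= cutoff la')%N, la' b = la b & lam la' a s.+1 = lam la a s].
    (* An empty row is followed by an empty row, so that [la] itself serves. *)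
    have [z|nz] := posnP (lam la a s).
      exists la; split=> //; apply/eqP; rewrite z -leqn0 -z.
      exact: lam_geq.
    have pt : is_part (nseq s.+1 (lam la a s)).
      rewrite /is_part mem_nseq /= eq_sym -lt0n nz andbT.
      by have := path_nseq s (isT : path geq (lam la a s) [::]); rewrite cats0.
    have ea : with_part la a (nseq s.+1 (lam la a s)) a =
        nseq s.+1 (lam la a s) :> seq nat.
      by rewrite /with_part ffunE eqxx insubdK.
    have eb : with_part la a (nseq s.+1 (lam la a s)) b = la b.
      by rewrite /with_part ffunE eq_sym (negPf nab).
    exists (with_part la a (nseq s.+1 (lam la a s))); split=> //.
    - by rewrite /addable eb.
    - apply: ltnW; apply: leq_trans (leq_bigmax a).
      by rewrite ea size_nseq.
    - by rewrite {1}/lam ea nth_nseq ltnSn.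
  have lbl : lam la' b l = lam la b l by rewrite /lam lb.
  have Ps' : P a s.+1 b l by rewrite (prec_succ_row s.+1 s l l hP nab).
  have := pos_collision hP al' Ps' (ltn0Sn s).
  rewrite !ltnS => /(_ cM).
  have -> : (kcont la' b l - kcont la' a s.+1) = kcont la b l - kcont la a s - 1.
    by rewrite /row_cont lbl la1 /box_cont; lia.
  move=> /(_ hN) /eqP; apply.
  have -> : kpos la' b l = kpos la b l by rewrite /row_pos lbl.
  have -> : kpos la' a s.+1 = kpos la a s + a3.
    by rewrite /row_pos la1 pos_next.
  move: e; have gen (T : comNzRingType) (x y z : T) : x - y + z = 0 -> y = x + z.
    by move=> h; rewrite -[y]add0r -h; ring.
  exact: gen.
case: ifP => [hN|_]; last exact: oner_neq0.
apply/eqP => e; have [ab|nab] := eqVneq a b.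
  have sl := prec_succ_neq hP Ps ab; subst a.
  have e' : kpos la b l - kpos la b s + a1 + a3 = 0.
    rewrite -e; have gen (T : comNzRingType) (x y z f : T) :
      x - y + f + (- f - z) = x - y - z by ring.
    exact: gen.
  have e'' : ((lam la b l)%:Z - (lam la b s)%:Z + 1)%:~R * a1 +
      (l%:Z - s%:Z + 1)%:~R * a3 = 0.
    rewrite -e' kpos_diff //; set x := (_ - _); set y := (l%:Z - s%:Z).
    rewrite !intrD !mulrDl !mul1r; move: (x%:~R * a1) (y%:~R * a3) a1 a3.
    by move=> *; rewrite addrACA addrA.
  have [{}e1 {}e2] := a1_a3_indep e''.
  have e1' : (lam la b l)%:Z - (lam la b s)%:Z + 1 = 0 := e1.
  have e2' : l%:Z - s%:Z + 1 = 0 := e2.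
  have ls : (l <= s)%N by lia.
  have := lam_geq la b l0 ls; move: e1'; clear; set x1 := lam la b l.
  by set x2 := lam la b s; lia.
(* Likewise with a box shifted to the next row of the b-th partition. *)
pose x := lam la b l.
(* Row [l.+1] gets length [x.+1], below rows of length [x.+2], so that it can grow. Its content is
   the old one and its position is raised by [a1 + a3 = - a2]; the ones bring row [s] within the
   cutoff. *)
pose t := nseq l x.+2 ++ x.+1 :: nseq (cutoff la) 1%N.
have pt : is_part t by apply: part_stair.
have sz : size (nseq l x.+2) = l by rewrite size_nseq.
have pit : is_part (incr_nth t l) by rewrite /t incr_nth_cat; apply: part_stair.
pose la' := with_part la b t.
have eb : la' b = t :> seq nat by rewrite /la' /with_part ffunE eqxx insubdK.
have ea : la' a = la a by rewrite /la' /with_part ffunE (negPf nab).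
have al' : addable la' b l.+1 by rewrite /addable eb.
have lb : lam la' b l.+1 = x.+1.
  by rewrite /lam eb /t nth_cat sz ltnn subnn.
have las : lam la' a s = lam la a s by rewrite /lam ea.
have Ps' : P a s b l.+1 by rewrite (prec_succ_row s s l.+1 l hP nab).
have cM : (cutoff la < cutoff la')%N.
  have st : (cutoff la <= size (la' b))%N.
    have et : size t = (l + (cutoff la).+1)%N.
      by rewrite /t size_cat size_nseq -cat1s size_cat size_nseq.
    by rewrite eb et addnS; apply: leq_trans (leqnSn _); apply: leq_addl.
  by rewrite ltnS; apply: leq_trans st (leq_bigmax b).
have := pos_collision hP al' Ps' s0 _.
move=> /(_ ltac:(lia)).
have -> : (kcont la' b l.+1 - kcont la' a s) = kcont la b l - kcont la a s.
  by rewrite /row_cont lb las /box_cont /x; lia.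
move=> /(_ hN) /eqP; apply.
have -> : kpos la' a s = kpos la a s by rewrite /row_pos las.
have -> : kpos la' b l.+1 = kpos la b l + a1 + a3.
  by rewrite /row_pos lb pos_next // pos_longer.
move: e; have gen (T : comNzRingType) (f g y z : T) : y - z - g = 0 ->
    y + f + (- f - g) = z.
  by move=> h; transitivity (z + (y - z - g)); [ring|rewrite h addr0].
exact: gen.
Qed.

End NonVanishing.

Section Coefficients.
Variables (RR : realType) (m n : nat) (k : int) (r : nat).
Hypotheses (m_gt0 : (0 < m)%N) (n_gt0 : (0 < n)%N) (kn : coprimez k n%:Z).
Local Notation A := (hseries RR).
Local Notation R := (hloc RR).
Local Notation w := (omega RR m n k).
Local Notation N := (m * n)%N.
Variables (p : 'I_r -> nat) (v : 'I_r -> A).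
Hypothesis v_mpower : forall a, mpower 1 (v a).
Let p' a := (p a %% m)%N.
Let u' a : R := hcst (w ^- p a) * hexp (n%:R * hemb (v a)).
Let vy a : R := hemb (v a).
Local Notation kcont := (row_cont p).
Implicit Types (la : mpart r) (a b : 'I_r) (s l : nat) (j : int).

Let quot_gen (T : idomainType) (TN TD YN YD X : T) :
  TN * YD = TD * YN * X -> TD != 0 -> YD != 0 ->
  (exists y, y * TD = TN) -> (exists y, y * YD = YN) -> YN != 0 ->
  exdiv TN TD = exdiv YN YD * X /\ exdiv YN YD != 0.
Proof.
move=> e td yd [et e1] [ey e2] yn.
rewrite (exdiv_unique td e1) (exdiv_unique yd e2); split.
  apply: (mulIf (mulf_neq0 td yd)).
  transitivity (et * TD * YD); first by ring.
  by rewrite e1 e -e2; ring.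
by apply: contraNneq yn => y0; rewrite -e2 y0 mul0r.
Qed.

Lemma tor_yang_coef P la b l i j : P = @prec r \/ P = @succ r ->
  tor_nonresonant m n k p' u' -> yang_nonresonant m n p vy ->
  addable la b l ->
  (kcont la b l == i + 1 %[mod N%:Z])%Z -> (kcont la b l == j + 1 %[mod m%:Z])%Z ->
  exdiv (tor_num m n k p' u' P la b l j) (tor_den m n k p' u' P la b l j) =
  exdiv (yang_num m n p vy P la b l i) (yang_den m n p vy P la b l i) *
    hemb (Exp (Sk m n k p v P la b l)) /\
  exdiv (yang_num m n p vy P la b l i) (yang_den m n p vy P la b l i) != 0.
Proof.
move=> hP tn yn al hi hj; have l0 := addable_gt0 al.
have hj' : (j == content p' la b l - 1 %[mod m%:Z])%Z.
  have : (content p' la b l == j + 1 %[mod m%:Z])%Z.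
    by rewrite (@content_mod m r p la b l (j + 1)).
  by rewrite !eqz_mod_dvd -dvdz_oppr; congr (_ %| _)%Z; ring.
have hi' : (i == content p la b l - 1 %[mod N%:Z])%Z.
  move: hi; rewrite -[kcont la b l]/(content p la b l).
  by rewrite !eqz_mod_dvd -dvdz_oppr; congr (_ %| _)%Z; ring.
have [td te] := tn _ _ _ _ al hj' P hP; have [yd ye] := yn _ _ _ _ al hi' P hP.
apply: (quot_gen (tor_yang m_gt0 n_gt0 kn v_mpower P l0 hi hj) td yd te ye).
rewrite (@yang_numE RR m n r m_gt0 n_gt0 p v P la b l i hi) hemb_neq0.
exact: (ynum_neq0 m_gt0 n_gt0 kn yn hP al).
Qed.

(** Only [w ^ d] and the divisibility of [d] by [m] and [N] enter. This passes from the indices of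
    G_{i,j}, which are residues, to contents, which are integers. *)
Lemma Gam_period d d' (y : A) : (N%:Z %| d - d')%Z -> Gam m n k d y = Gam m n k d' y.
Proof.
move=> hd; have ed : d = d' + (d - d') by ring.
have ew : w ^ d = w ^ d'.
  by rewrite ed expfzDr ?omega_neq0 // (omegaN RR k m_gt0 n_gt0 hd) ?mulr1.
have eN : (N%:Z %| d)%Z = (N%:Z %| d')%Z by rewrite ed rpredDr.
have em : (m%:Z %| d)%Z = (m%:Z %| d')%Z.
  by rewrite ed rpredDr //; apply: dvd_mN hd.
have eH : Hd RR m n k d = Hd RR m n k d'.
  by apply: (congr2 (@exdiv _)); rewrite /num /den ?eN ew.
exact: (congr2 (fun (c : bool) H => if c then ev (plog H) y else 0) em eH).
Qed.

End Coefficients.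

Section LogProducts.
Variables (K : comNzRingType) (r : nat).
Implicit Types (la : mpart r) (P : 'I_r -> nat -> bool).

Lemma logd_prod I (t : seq I) (Q : pred I) (L F : I -> fps K) :
  (forall i, Q i -> logd (L i) (F i)) ->
  logd (\sum_(i <- t | Q i) L i) (\prod_(i <- t | Q i) F i).
Proof.
move=> h; elim/big_rec2: _ => [|i f l Qi lf]; first exact: logd1.
by apply: logdM => //; apply: h.
Qed.

Lemma logd_pprod N p la P j (L1 L2 F1 F2 : 'I_r -> nat -> fps K) :
  (forall a s, logd (L1 a s) (F1 a s)) -> (forall a s, logd (L2 a s) (F2 a s)) ->
  logd (psum N p la P j L1 L2) (pprod N p la P j F1 F2).
Proof.
by move=> h1 h2; apply: logdM; apply: logd_prod => a _; apply: logd_prod.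
Qed.

Lemma fcoef_psum N p la P j (L1 L2 : 'I_r -> nat -> fps K) i :
  fcoef (psum N p la P j L1 L2) i =
  psum N p la P j (fun a s => fcoef (L1 a s) i) (fun a s => fcoef (L2 a s) i).
Proof.
rewrite fcoefD !fcoef_sum; congr (_ + _); apply: eq_bigr => a _;
  by rewrite fcoef_sum.
Qed.

Lemma pprod_ind (Q : fps K -> Prop) N p la P j F1 F2 : Q 1 ->
  (forall f g, Q f -> Q g -> Q (f * g)) ->
  (forall a s, Q (F1 a s)) -> (forall a s, Q (F2 a s)) ->
  Q (pprod N p la P j F1 F2).
Proof.
by move=> q1 qM h1 h2; apply: (qM); do 2!(elim/big_ind: _ => // ? _).
Qed.

End LogProducts.

Lemma raddf_psum (U V : zmodType) (f : {additive U -> V}) (r : nat) N p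
    (la : mpart r) P j (F1 F2 : 'I_r -> nat -> U) :
  f (psum N p la P j F1 F2) =
  psum N p la P j (fun a s => f (F1 a s)) (fun a s => f (F2 a s)).
Proof.
rewrite raddfD !raddf_sum; congr (_ + _); apply: eq_bigr => a _;
  by rewrite raddf_sum.
Qed.

(** * Eigenvalues of the Yangian series *)

Section NearOne.
Variables (K : comNzRingType) (h : K).

(** The second clause makes the division by [h2] in [yang_xi] exact, hbar_2 not being among the
    inverted elements of R. *)
Definition near1 (f : fps K) := fcoef f 0 = 1 /\ exists g, f = 1 + fconst h * g.

Lemma near1_1 : near1 1.
Proof. by split=> //; exists 0; rewrite mulr0 addr0. Qed.

Lemma near1M f g : near1 f -> near1 g -> near1 (f * g).
Proof.
move=> [f0 [f' ef]] [g0 [g' eg]]; split; first by rewrite fcoefM0 f0 g0 mulr1.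
by exists (f' + g' + fconst h * f' * g'); rewrite ef eg; ring.
Qed.

Lemma near1_factor a b c : a - b = h * c ->
  near1 ((1 - fconst b * fvar K) * fgeom a).
Proof.
move=> e; split.
  by rewrite fcoefM0 fcoefB fcoefCM /= mulr0 subr0 mulr1.
exists (fconst c * fvar K * fgeom a).
have -> : fconst b = fconst a - fconst h * fconst c.
  by rewrite -rmorphM -e /= -rmorphB opprB addrC subrK.
transitivity (fgeom a * (1 - fconst a * fvar K) +
    fconst h * fconst c * fvar K * fgeom a); first by ring.
by rewrite fgeomK; ring.
Qed.

End NearOne.

Section DifferenceSums.
Variables (RR : realType) (m n r : nat).
Local Notation A := (hseries RR).
Local Notation R := (hloc RR).
Local Notation N := (m * n)%N.
Local Notation a1 := (h1A RR m n).
Local Notation a2 := (h2A RR m n).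
Local Notation a3 := (h3A RR m n).
Variables (p : 'I_r -> nat) (v : 'I_r -> A).
Hypotheses (m_gt0 : (0 < m)%N) (n_gt0 : (0 < n)%N).
Hypothesis v_mpower : forall a, mpower 1 (v a).
Let vy a : R := hemb (v a).
Local Notation kpos := (row_pos m n v).
Implicit Types (la : mpart r) (a b : 'I_r) (s l : nat) (j : int) (f g : A -> A).

Let kposm la a s : mpower 1 (kpos la a s).
Proof. exact: kpos_mpower. Qed.

(* xi_j (z) has on |la> the eigenvalue prod (1 - be / z) / (1 - al / z) over
   certain pairs (al, be); dsum la j f is the sum of the f al - f be. *)
Definition dsum la j f : A := psum N p la (fun _ _ => true) j
  (fun a s => f (kpos la a s - a1) - f (kpos la a s + a3))
  (fun a s => f (kpos la a s) - f (kpos la a s + a2)).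

Let al1 la a s : mpower 1 (kpos la a s - a1).
Proof. by apply: mpowerB => //; apply: a1_mpower. Qed.
Let be1 la a s : mpower 1 (kpos la a s + a3).
Proof. by apply: mpowerD => //; apply: a3_mpower. Qed.
Let be2 la a s : mpower 1 (kpos la a s + a2).
Proof. by apply: mpowerD => //; apply: a2_mpower. Qed.

Lemma eq_dsum la j f g : (forall y, mpower 1 y -> f y = g y) ->
  dsum la j f = dsum la j g.
Proof.
by move=> fg; apply: eq_psum => a s _ _ _; rewrite !fg.
Qed.

Lemma dsumZ la j c f : dsum la j (fun y => c * f y) = c * dsum la j f.
Proof.
rewrite /dsum /psum mulrDr; congr (_ + _); rewrite mulr_sumr;
  by apply: eq_bigr => a _; rewrite mulr_sumr; apply: eq_bigr => s _;
  rewrite mulrBr.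
Qed.

Lemma psum_m d la P j (F1 F2 : 'I_r -> nat -> A) :
  (forall a s, mpower d (F1 a s)) -> (forall a s, mpower d (F2 a s)) ->
  mpower d (psum N p la P j F1 F2).
Proof.
by move=> h1 h2; apply: mpowerD; do 2!apply: mpower_sum => ? _.
Qed.

Lemma ssum_psum la P j (F1 F2 : nat -> 'I_r -> nat -> A) :
  (forall a s, summable (fun t => F1 t a s)) ->
  (forall a s, summable (fun t => F2 t a s)) ->
  ssum (fun t => psum N p la P j (F1 t) (F2 t)) =
  psum N p la P j (fun a s => ssum (fun t => F1 t a s))
                  (fun a s => ssum (fun t => F2 t a s)).
Proof.
have hs (F : nat -> 'I_r -> nat -> A) K Q :
    (forall a s, summable (fun t => F t a s)) ->
    summable (fun t => \sum_(a < r) \sum_(1 <= s < K | Q a s) F t a s) /\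
    ssum (fun t => \sum_(a < r) \sum_(1 <= s < K | Q a s) F t a s) =
    \sum_(a < r) \sum_(1 <= s < K | Q a s) ssum (fun t => F t a s).
  move=> Fs; have Fs' a : summable (fun t => \sum_(1 <= s < K | Q a s) F t a s).
    by move=> t; apply: mpower_sum => s _; apply: Fs.
  split; first by move=> t; apply: mpower_sum => a _; apply: Fs'.
  rewrite ssum_sum; last by move=> a _; apply: Fs'.
  by apply: eq_bigr => a _; rewrite ssum_sum.
move=> h1 h2; rewrite /psum ssumD; first congr (_ + _).
- exact: (hs _ _ _ h1).2.
- exact: (hs _ _ _ h2).2.
- exact: (hs _ _ _ h1).1.
- exact: (hs _ _ _ h2).1.
Qed.

Lemma ssum_dsum la j (f : nat -> A -> A) :
  (forall y, mpower 1 y -> summable (f^~ y)) ->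
  ssum (fun t => dsum la j (f t)) = dsum la j (fun y => ssum (f^~ y)).
Proof.
move=> fs; rewrite /dsum ssum_psum; last first.
- by move=> a s t; apply: mpowerB; apply: fs.
- by move=> a s t; apply: mpowerB; apply: fs.
by apply: eq_psum => a s _ _ _; rewrite ssumB //; apply: fs.
Qed.

Lemma dsum_mpower d la j f :
  (forall y y', mpower 1 y -> mpower 1 y' -> mpower d (f y - f y')) ->
  mpower d (dsum la j f).
Proof. by move=> h; apply: psum_m => a s; apply: h. Qed.

Lemma dsum_const la j c : dsum la j (fun=> c) = 0.
Proof.
rewrite /dsum (eq_psum (G1 := fun _ _ => 0) (G2 := fun _ _ => 0));
  try by move=> *; rewrite subrr.
by rewrite /psum big1 ?add0r; [rewrite big1|] => // a _; rewrite big1.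
Qed.

Let sub_gen (T : comNzRingType) (x y z t : T) : x - y - (z - t) = x - z - (y - t).
Proof. by ring. Qed.

Lemma dsumB la j f g :
  dsum la j (fun y => f y - g y) = dsum la j f - dsum la j g.
Proof.
rewrite /dsum !psum_rowsum rowsumB; apply: eq_rowsum => a s _ _; case: ifP => _;
  rewrite ?subr0 //; apply: sub_gen.
Qed.

Lemma evA_dsum la j (f : A -> fps A) x : mpower 1 x ->
  evA (FPS (fun t => dsum la j (fun y => fcoef (f y) t))) x =
  dsum la j (fun y => evA (f y) x).
Proof.
move=> x1; rewrite /evA -ssum_dsum => [|y y1]; last exact: evA_summable.
by apply: eq_ssum => t /=; rewrite mulrC -dsumZ; apply: eq_dsum => y _; rewrite mulrC.
Qed.

Let logd_factor (K : comNzRingType) (a b : K) :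
  logd (FPS (fun i => a ^+ i.+1 - b ^+ i.+1)) ((1 - fconst b * fvar K) * fgeom a).
Proof. exact: logd_quot. Qed.

Lemma logd_xi la j :
  logd (FPS (fun i => hemb (dsum la j (fun y => y ^+ i.+1))))
    (xi_series m n p vy la j).
Proof.
have e : FPS (fun i => hemb (dsum la j (fun y => y ^+ i.+1))) =
  psum N p la (fun _ _ => true) j
    (fun a s => FPS (fun i => (xpos m n vy la a s - h1 RR m n) ^+ i.+1 -
                              (xpos m n vy la a s + h3 RR m n) ^+ i.+1))
    (fun a s => FPS (fun i => xpos m n vy la a s ^+ i.+1 -
                              (xpos m n vy la a s + h2 RR m n) ^+ i.+1)).
  apply: fpsP => i; rewrite fcoef_psum /dsum [LHS]/= (raddf_psum (@hemb RR)).
  have hX (x : A) t : hemb (x ^+ t) = hemb x ^+ t by rewrite (rmorphXn (@hemb RR)).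
  have hB (x y : A) : hemb (x - y) = hemb x - hemb y by rewrite (rmorphB (@hemb RR)).
  have hD (x y : A) : hemb (x + y) = hemb x + hemb y by rewrite (rmorphD (@hemb RR)).
  have ex a s : xpos m n vy la a s = hemb (kpos la a s).
    by apply: xposE.
  have e11 a s : xpos m n vy la a s - h1 RR m n = hemb (kpos la a s - a1).
    by rewrite hB; apply: (congr2 (fun x y => x - y) (ex a s)); apply: h1E.
  have e12 a s : xpos m n vy la a s + h3 RR m n = hemb (kpos la a s + a3).
    by rewrite hD; apply: (congr2 (fun x y => x + y) (ex a s)); apply: h3E.
  have e22 a s : xpos m n vy la a s + h2 RR m n = hemb (kpos la a s + a2).
    by rewrite hD; apply: (congr2 (fun x y => x + y) (ex a s)); apply: h2E.
  have fin (x y : A) (x' y' : R) : x' = hemb x -> y' = hemb y ->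
      hemb (x ^+ i.+1 - y ^+ i.+1) = x' ^+ i.+1 - y' ^+ i.+1.
    move=> -> ->; apply: etrans (hB _ _) _.
    exact: (congr2 (fun z t => z - t) (hX _ _) (hX _ _)).
  by apply: eq_psum => a s _ _ _; apply: fin.
by rewrite e; apply: logd_pprod => a s; apply: logd_factor.
Qed.

Lemma a2_neq0 : a2 != 0.
Proof.
apply/eqP => e; have : fcoef (fcoef a2 1) 0 = 0 by rewrite e.
rewrite /h2A /hsC !fcoefCM /= mulr1 => /eqP; rewrite invr_eq0.
by rewrite Num.Theory.pnatr_eq0 -[_ == _]negbK -lt0n muln_gt0 m_gt0 n_gt0.
Qed.

Lemma xi_series_near1 la j : near1 (h2 RR m n) (xi_series m n p vy la j).
Proof.
have hB (x y : A) : hemb (x - y) = hemb x - hemb y by rewrite (rmorphB (@hemb RR)).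
have hD (x y : A) : hemb (x + y) = hemb x + hemb y by rewrite (rmorphD (@hemb RR)).
have h1' := h1E RR m_gt0 n_gt0; have h2' := h2E RR m_gt0 n_gt0.
have h3' := h3E RR m_gt0 n_gt0.
apply: (@pprod_ind _ _ (near1 (h2 RR m n))) => [||a s|a s].
- exact: near1_1.
- exact: near1M.
- apply: (near1_factor (c := 1)); rewrite mulr1.
  have gen (T : comNzRingType) (x f g : T) : x - f - (x + (- f - g)) = g by ring.
  have e3 : h3 RR m n = - h1 RR m n - h2 RR m n.
    by rewrite h3' h1' h2' /h3A hB (rmorphN (@hemb RR)).
  by rewrite e3; apply: gen.
- apply: (near1_factor (c := -1)); rewrite mulrN1 opprD addrA subrr sub0r.
  by [].
Qed.

Lemma xi_series0 la j : fcoef (xi_series m n p vy la j) 0 = 1.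
Proof. by case: (xi_series_near1 la j). Qed.

Lemma h2_neq0 : h2 RR m n != 0.
Proof. by rewrite h2E // hemb_neq0; apply: a2_neq0. Qed.

Lemma xi_seriesS la j i : h2 RR m n *
  exdiv (fcoef (xi_series m n p vy la j) i.+1) (h2 RR m n) =
  fcoef (xi_series m n p vy la j) i.+1.
Proof.
have [_ [g e]] := xi_series_near1 la j.
have eg : fcoef g i.+1 * h2 RR m n = fcoef (xi_series m n p vy la j) i.+1.
  by rewrite e fcoefD fcoefCM [fcoef 1 _]/= add0r mulrC.
by rewrite mulrC; apply: (exdivK h2_neq0 eg).
Qed.

(** The eigenvalue of t_{j,i}, obtained by integrating the logarithmic derivative of xi_j. *)
Definition tval la j i : A :=
  hsC i.+1%:R^-1 * dsum la j (fun y => y ^+ i.+1).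

Lemma plog_xi la j i :
  fcoef (plog (xi_series m n p vy la j)) i.+1 = hemb (tval la j i).
Proof.
have e := logd_plog (@natR_unit RR) (xi_series0 la j) (logd_xi la j).
have ei : fcoef (plog (xi_series m n p vy la j)) i.+1 * i.+1%:R =
    hemb (dsum la j (fun y => y ^+ i.+1)).
  transitivity (fcoef (fderiv (plog (xi_series m n p vy la j))) i).
    by rewrite fcoef_deriv mulr_natr.
  by rewrite e.
apply: (mulIf (natR_neq0 RR i)); apply: etrans ei _; apply: esym.
rewrite -(hcst_nat RR i.+1); apply: etrans (hembM _ _) (congr1 _ _).
have e1 : hsC i.+1%:R^-1 * hsC i.+1%:R = 1 :> A.
  by rewrite -(rmorphM (@hsC RR)) mulVf ?natC_neq0 // (rmorph1 (@hsC RR)).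
have gen (T : comNzRingType) (x y z : T) : x * z = 1 -> x * y * z = y.
  by move=> xz; rewrite mulrAC xz mul1r.
exact: gen.
Qed.

End DifferenceSums.

Lemma hseries_toZ (RR : realType) (c : hloc RR) u l :
  hseries_to u l -> hseries_to (fun i => c * u i) (c * l).
Proof.
move=> ul d; have [e eP] := order_geM_loss c; have [K KP] := ul (d + e)%N.
by exists K => t /KP h; rewrite -mulr_sumr -mulrBr; apply: eP.
Qed.

(** * Eigenvalues of B, gamma and the square root in g *)

Section DiagonalOperators.
Variables (RR : realType) (m n : nat) (k : int) (r : nat).
Hypotheses (m_gt0 : (0 < m)%N) (n_gt0 : (0 < n)%N) (kn : coprimez k n%:Z).
Local Notation C := (RR[i]).
Local Notation A := (hseries RR).
Local Notation R := (hloc RR).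
Local Notation N := (m * n)%N.
Local Notation a2 := (h2A RR m n).
Local Notation hn := (half_n RR n).
Local Notation Gam := (@Gam RR m n k).
Variables (p : 'I_r -> nat) (v : 'I_r -> A).
Hypothesis v_mpower : forall a, mpower 1 (v a).
Let vy a : R := hemb (v a).
Let xi := yang_xi m n p vy.
Local Notation dsum := (dsum m n p v).
Local Notation tval := (tval m n p v).
Implicit Types (la : mpart r) (i j : 'I_N).

Lemma yang_xi_dg j t :
  xi j t = dg (fun la => exdiv (fcoef (xi_series m n p vy la j) t.+1) (h2 RR m n)).
Proof. by rewrite dgE. Qed.

Lemma xi_gen_dfps i : xi_gen xi i = dfps (fun la => xi_series m n p vy la i).
Proof.
apply: fpsP => -[|t]; rewrite [LHS]/= [RHS]/=.
  apply: etrans (dg1 RR r) (congr1 _ _); apply/funext => la; apply: esym.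
  exact: xi_series0.
rewrite yang_xi_dg dgZ; congr dg; apply/funext => la.
exact: xi_seriesS.
Qed.

Lemma tcoef_dg i t : tcoef xi i t = dg (fun la => hemb (tval la i t)).
Proof.
rewrite /tcoef xi_gen_dfps flog_dfps [LHS]/=; congr dg; apply/funext => la.
exact: plog_xi.
Qed.

Lemma tval_mpower la j t : mpower t.+1 (tval la j t).
Proof.
apply: mpowerMl; apply: dsum_mpower => // y y' y1 y1'.
by apply: mpowerB; apply: mpowerX.
Qed.

Lemma endo_sum_tcoef i (c : nat -> A) :
  endo_sum (fun t => hemb (c t) *: tcoef xi i t) =
  dg (fun la => hemb (ssum (fun t => c t * tval la i t))).
Proof.
rewrite -esE; under eq_fun do rewrite tcoef_dg dgZ.
apply: es_dg => la; have cs : summable (fun t => c t * tval la i t).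
  by move=> t; apply/mpowerMl/(@mpowerW _ _ t.+1)/tval_mpower.
have := hseries_to_ssum cs; congr hseries_to; apply/funext => t.
by rewrite (rmorphM (@hemb RR)).
Qed.

Lemma ssum_tval la j (c : nat -> A) :
  ssum (fun t => c t * tval la j t) =
  dsum la j (fun y => ssum (fun t => c t * hsC t.+1%:R^-1 * y ^+ t.+1)).
Proof.
rewrite -ssum_dsum //; last first.
  by move=> y y1 t; apply/mpowerMl/(@mpowerW _ _ t.+1)/mpowerX.
by apply: eq_ssum => t; rewrite dsumZ // mulrA.
Qed.

Definition Bval la j (W : A) : A :=
  ssum (fun t => (W ^+ t * hsC t`!%:R^-1) * tval la j t).

Lemma Bser_dg i (W : A) : Bser xi i (hemb W) = dg (fun la => hemb (Bval la i W)).
Proof.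
rewrite -endo_sum_tcoef; congr endo_sum; apply/funext => t; congr (_ *: _).
rewrite natR_inv ?fact_gt0 // -[hcst _]/(hemb (hsC _)) -rmorphXn.
exact: hembM.
Qed.

(** The factor [W] supplies the missing power: the series of [(W y)^(s+1) / (s+1)!] is
    [Exp (W y) - 1], and the constant 1 drops out of [dsum]. *)
Lemma Bval_spec la j W : W * Bval la j W = dsum la j (fun y => Exp (W * y)).
Proof.
rewrite /Bval ssum_tval -dsumZ //.
have gen : dsum la j (fun y => Exp (W * y) - 1) = dsum la j (fun y => Exp (W * y)).
  by rewrite dsumB dsum_const subr0.
rewrite -gen; apply: eq_dsum => // y y1.
have W1 : mpower 1 (W * y) by apply: mpowerMl.
have es := evA_summable W1 (cmap (eser RR)).
have es' : summable (fun t => fcoef (cmap (eser RR)) t.+1 * (W * y) ^+ t.+1).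
  by move=> t; apply: mpowerW (es t.+1).
have e0 : fcoef (cmap (eser RR)) 0 * (W * y) ^+ 0 = 1.
  by rewrite expr0 mulr1 /= invr1 (rmorph1 (@hsC RR)).
have eE := etrans (ssum_rec es es') (congr1 (fun z => z + _) e0).
have one_gen (T : comNzRingType) (x : T) : 1 + x - 1 = x by ring.
apply: esym; apply: etrans (congr1 (fun z => z - 1) eE) _.
apply: etrans (one_gen _ _) _; apply: esym; rewrite -ssumM; last first.
  by move=> t; apply/mpowerMl/(@mpowerW _ _ t.+1)/mpowerX.
apply: eq_ssum => t.
have e : hsC t`!%:R^-1 * hsC t.+1%:R^-1 = hsC (t.+1)`!%:R^-1 :> A.
  rewrite -(rmorphM (@hsC RR)); congr (hsC _).
  by rewrite factS natrM invfM mulrC.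
have gen2 (T : comNzRingType) (x y' z u : T) s :
    x * (x ^+ s * y' * z * u ^+ s.+1) = y' * z * (x * u) ^+ s.+1.
  by rewrite exprMn !exprS; ring.
exact: etrans (gen2 _ _ _ _ _ _) (congr1 (fun z => z * _) e).
Qed.

Definition gamval la i j : fps A :=
  FPS (fun t => dsum la j (fun y => fcoef (shift (Gser RR k i j) (- y)) t)).

(** In B_j(- d/dv) the power sums of [tval] assemble, by Taylor's formula, into shifts of G by
    [- y], where [y] runs over the pairs of [dsum]. *)
Lemma gamma_dg i j t :
  fcoef (gamma k xi i j) t = dg (fun la => hemb (fcoef (gamval la i j) t)).
Proof.
rewrite [LHS]/=; set G := Gser RR k i j.
pose c s : A := - ((-1) ^+ s * hsC s`!%:R^-1 *
                   hsC (fcoef (iter s.+1 (@fderiv C) G) t)).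
transitivity (endo_sum (fun s => hemb (c s) *: tcoef xi j s)).
  congr endo_sum; apply/funext => s; congr (_ *: _).
  rewrite natR_inv ?fact_gt0 // /c (rmorphN (@hemb RR)); congr (- _).
  by rewrite 2!(rmorphM (@hemb RR)) (rmorphXn (@hemb RR)) (rmorphN1 (@hemb RR)).
rewrite endo_sum_tcoef; congr dg; apply/funext => la; congr hemb.
rewrite ssum_tval [RHS]/=.
(* The series starts with one derivative. The missing Taylor term does not depend on [y] and drops
   out of [dsum]. *)
have <- : dsum la j (fun y => fcoef (shift G (- y)) t - hsC (fcoef G t)) =
    dsum la j (fun y => fcoef (shift G (- y)) t).
  by rewrite dsumB dsum_const subr0.
apply: eq_dsum => // y y1.
have ss := shift_summable G t (mpowerN y1).
have ss' : summable (fun s => hsC (tayc G t s.+1) * (- y) ^+ s.+1).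
  by move=> s; apply: mpowerW (ss s.+1).
have e0 : hsC (tayc G t 0) * (- y) ^+ 0 = hsC (fcoef G t).
  by rewrite expr0 mulr1 /tayc addn0 bin0 mulr1n.
have eE := etrans (ssum_rec ss ss') (congr1 (fun z => z + _) e0).
have gen1 (T : comNzRingType) (x z : T) : x + z - x = z by ring.
apply: esym; apply: etrans (congr1 (fun z => z - _) eE) _.
apply: etrans (gen1 _ _ _) _; apply: esym.
apply: eq_ssum => s; rewrite -taylor_coef /c.
rewrite 2!(rmorphM (@hsC RR)) [(- y) ^+ _]exprNn.
have gen (T : comNzRingType) (x g f z u : T) q :
    - ((-1) ^+ q * x * g) * z * u = g * (x * z) * ((-1) ^+ q.+1 * u).
  by rewrite exprS; ring.
exact: gen.
Qed.

(** Every shifted coefficient agrees with the unshifted one modulo the maximal ideal, hence so do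
    any two shifts. *)
Lemma gamval_mpower la i j t : mpower 1 (fcoef (gamval la i j) t).
Proof.
apply: dsum_mpower => // y y' y1 y1'.
set G := Gser RR k i j.
suff h z : mpower 1 z -> mpower 1 (fcoef (shift G z) t - hsC (fcoef G t)).
  have gen (T : comNzRingType) (x z e : T) : x - z = x - e - (z - e) by ring.
  have e := gen _ (fcoef (shift G (- y)) t) (fcoef (shift G (- y')) t)
    (hsC (fcoef G t)).
  rewrite e; exact: mpowerB (h _ (mpowerN y1)) (h _ (mpowerN y1')).
move=> z1; have ss := shift_summable G t z1.
have e0 : hsC (tayc G t 0) * z ^+ 0 = hsC (fcoef G t).
  by rewrite expr0 mulr1 /tayc addn0 bin0 mulr1n.
have := @ssum_trunc _ _ 1 1 ss; rewrite big_nat1 e0.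
by apply=> s s1; apply: mpowerW (ss s).
Qed.

Definition gexpval la i : fps A := FPS (fun t =>
  hsC 2%:R^-1 * \sum_(j < N | (j == i %[mod m])%N) fcoef (gamval la i j) t).

Lemma gexpval_mpower la i t : mpower 1 (fcoef (gexpval la i) t).
Proof.
by apply: mpowerMl; apply: mpower_sum => j _; apply: gamval_mpower.
Qed.

Definition hmap (f : fps A) : fps R := FPS (fun t => hemb (fcoef f t)).

Lemma hmapM f g : hmap (f * g) = hmap f * hmap g.
Proof.
apply: fpsP => t; rewrite [RHS]fcoefME [LHS]/= (rmorph_sum (@hemb RR)).
by apply: eq_bigr => s _; rewrite (rmorphM (@hemb RR)).
Qed.

Lemma hmap1 : hmap 1 = 1.
Proof.
by apply: fpsP => -[|t]; rewrite /= ?mulr1n ?mulr0n ?(rmorph1 (@hemb RR)) ?(rmorph0 (@hemb RR)).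
Qed.

Lemma hmapX f s : hmap (f ^+ s) = hmap f ^+ s.
Proof. by elim: s => [|s IH]; rewrite ?hmap1 // !exprS hmapM IH. Qed.

Lemma gexponent_dfps i : gexponent k xi i = dfps (fun la => hmap (gexpval la i)).
Proof.
apply: fpsP => t; rewrite [RHS]/=.
transitivity ((2%:R : R)^-1 *:
    \sum_(j < N | (j == i %[mod m])%N) fcoef (gamma k xi i j) t); first by [].
under eq_bigr do rewrite gamma_dg.
rewrite dg_sum dgZ; congr dg; apply/funext => la.
by rewrite natR_inv // (rmorphM (@hemb RR)) (rmorph_sum (@hemb RR)).
Qed.

Definition gs : A := Exp (hsC 2%:R^-1 * Gam 0 a2).

Lemma half_mpower x : mpower 1 x -> mpower 1 (hsC 2%:R^-1 * x : A).
Proof. exact: mpowerMl. Qed.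

Lemma hsC_half : hsC 2%:R^-1 + hsC 2%:R^-1 = 1 :> A.
Proof.
rewrite -(rmorphD (@hsC RR)) -mulr2n -[_ *+ 2]mulr_natr mulVf ?(rmorph1 (@hsC RR)) //.
exact: natC_neq0.
Qed.

Lemma Exp_half x : mpower 1 x -> Exp (hsC 2%:R^-1 * x) ^+ 2 = Exp x :> A.
Proof.
move=> x1; have hx := half_mpower x1.
by rewrite expr2 -(ExpD hx hx) -mulrDl hsC_half mul1r.
Qed.

(** [Exp_Gam] at [d = 0], [y = a2] reads [Exp (Gam 0 a2) * (q - q^-1) = n * a2 = hbar_2 / m], so
    [gs] is a square root; the opposite root is excluded by its constant term -1. *)
Lemma gsqrtE : gsqrt RR m = hemb gs.
Proof.
have G1 : mpower 1 (Gam 0 a2) by apply/Gam_mpower/a2_mpower.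
have h2m := hn_mpower n (a2_mpower RR m n).
pose D : A := m%:R * (Exp (hn * a2) - Exp (- (hn * a2))).
have hD : m%:R * (qq RR m - (qq RR m)^-1) = hemb D.
  rewrite (qqE RR m_gt0 n_gt0) (hemb_inv (ExpN h2m)).
  by rewrite (rmorphM (@hemb RR)) (rmorph_nat (@hemb RR)) (rmorphB (@hemb RR)).
have Dspec : gs ^+ 2 * D = hs2 RR.
  have eD : Exp (Gam 0 a2) * (Exp (hn * a2) - hsC (omega RR m n k ^ 0) *
      Exp (- (hn * a2))) = n%:R * a2.
    by apply: etrans (Exp_Gam m_gt0 n_gt0 kn (dvdz0 m) (a2_mpower RR m n)) _;
      rewrite dvdz0.
  have e1 : hsC (omega RR m n k ^ 0) = 1 by rewrite expr0z (rmorph1 (@hsC RR)).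
  rewrite (Exp_half G1) /D.
  have gen (T : comNzRingType) (x y' z e c o f : T) : o = 1 ->
      x * (y' - o * z) = c * e -> x * (f * (y' - z)) = f * c * e.
    by move=> ->; rewrite mul1r mulrCA => ->; rewrite mulrA.
  apply: etrans (gen _ _ _ _ _ _ _ _ e1 eD) _.
  rewrite -natrM /h2A mulrA -(rmorph_nat (@hsC RR)) -(rmorphM (@hsC RR)).
  rewrite mulfV ?(rmorph1 (@hsC RR)); first exact: mul1r.
  by rewrite Num.Theory.pnatr_eq0 -lt0n muln_gt0 m_gt0.
have D0 : D != 0.
  apply/eqP => e; move: Dspec; rewrite e mulr0 => /esym e'.
  have : fcoef (fcoef (hs2 RR) 1) 0 = 0 by rewrite e'.
  by move=> /eqP; rewrite /= oner_eq0.
have gs1 : mpower 1 (gs - 1) by apply/Exp_mpower/half_mpower.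
have spec : hemb gs ^+ 2 * (m%:R * (qq RR m - (qq RR m)^-1)) = hb2 RR /\
    order_ge 1 (hemb gs - 1).
  split; first by rewrite hD -(rmorphXn (@hemb RR)) hembM Dspec.
  rewrite -(rmorph1 (@hemb RR)) -(rmorphB (@hemb RR)).
  exact/order_ge_hemb.
rewrite /gsqrt; case: xgetP => [c _ [e1 e2]|/(_ (hemb gs))[] //].
have [f1 f2] := spec.
have : c ^+ 2 = hemb gs ^+ 2.
  by apply: (mulIf (_ : hemb D != 0)); rewrite ?hemb_neq0 // -hD e1 f1.
move/eqP; rewrite eqf_sqr => /orP[/eqP//|/eqP ec].
have e0 : hemb (gs + 1) = - (c - 1).
  rewrite ec opprB opprK addrC (rmorphD (@hemb RR)).
  by congr (_ + _); apply: rmorph1.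
have : order_ge 1 (hemb (gs + 1)) by rewrite e0; apply: order_geN.
move/order_ge_hemb => gs2; have e3 : (gs + 1) - (gs - 1) = hsC 2%:R.
  have gen (T : comNzRingType) (x : T) : x + 1 - (x - 1) = 2%:R by ring.
  by rewrite gen (rmorph_nat (@hsC RR)).
have := mpowerB gs2 gs1; rewrite e3 => /(_ 0%N 0%N isT) /=.
by rewrite !mulr1n => /eqP; rewrite (negPf (natC_neq0 RR 1)).
Qed.

End DiagonalOperators.

(** * Box operators weighted by diagonal series *)

Section WeightedShifts.
Variables (RR : realType) (r : nat).
Local Notation A := (hseries RR).
Local Notation R := (hloc RR).
Local Notation M := (fock RR r).
Implicit Types (la mu : mpart r) (b : 'I_r) (l s : nat).

Definition boxsum (rng : mpart r -> 'I_r -> seq nat)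
    (Q : mpart r -> 'I_r -> nat -> bool) (T : mpart r -> 'I_r -> nat -> mpart r)
    (c : mpart r -> 'I_r -> nat -> R) la : M :=
  \sum_(b < r) \sum_(l <- rng la b | Q la b l) c la b l *: kt RR (T la b l).

(** The diagonal coefficients act on the shape reached, hence [g (T la b l)]; summed against the
    powers of [X] they evaluate this series at [X]. *)
Lemma es_boxsum rng Q T c (X : mpart r -> 'I_r -> nat -> A) (g : mpart r -> fps A) :
  (forall la b l, mpower 1 (X la b l)) ->
  es (fun s => dg (fun mu => hemb (fcoef (g mu) s)) *
     lx (boxsum rng Q T (fun la b l => c la b l * hemb (X la b l) ^+ s))) =
  lx (boxsum rng Q T
     (fun la b l => c la b l * hemb (evA (g (T la b l)) (X la b l)))).
Proof.
move=> X1; pose u s la b l : R :=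
  c la b l * hemb (fcoef (g (T la b l)) s * X la b l ^+ s).
have e s : dg (fun mu => hemb (fcoef (g mu) s)) *
    lx (boxsum rng Q T (fun la b l => c la b l * hemb (X la b l) ^+ s)) =
    lx (boxsum rng Q T (u s)).
  apply: ap_eq => la.
  rewrite apM.
  apply: etrans (congr1 (ap _) (ap_lx _ la)) _.
  apply: etrans _ (esym (ap_lx _ la)).
  rewrite /boxsum.
  rewrite ap_sumr.
  apply: eq_bigr => b _.
  rewrite ap_sumr.
  apply: eq_bigr => l _.
  rewrite apZ.
  rewrite ap_dg.
  rewrite scalerA.
  congr (_ *: _).
  apply: etrans (esym (mulrA _ _ _)) _.
  apply: (congr1 (fun z => c la b l * z)).
  rewrite -(rmorphXn (@hemb RR)).
  apply: etrans (hembM _ _) _.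
  by apply: congr1; exact: mulrC.
under eq_fun do rewrite e.
apply: es_lx => la; apply: fock_to_sum => b _; apply: fock_to_sum => l _.
apply: fock_to_kt; apply: hseries_toZ; apply: hseries_to_ssum.
exact: evA_summable.
Qed.

End WeightedShifts.

(** * The value of g at a box *)

Section GEigenvalues.
Variables (RR : realType) (m n : nat) (k : int) (r : nat).
Hypotheses (m_gt0 : (0 < m)%N) (n_gt0 : (0 < n)%N) (kn : coprimez k n%:Z).
Local Notation A := (hseries RR).
Local Notation R := (hloc RR).
Local Notation N := (m * n)%N.
Local Notation E := (fock_endo RR r).
Local Notation a1 := (h1A RR m n).
Local Notation a2 := (h2A RR m n).
Local Notation a3 := (h3A RR m n).
Local Notation Gam := (@Gam RR m n k).
Local Notation gs := (gs RR m n k).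
Variables (p : 'I_r -> nat) (v : 'I_r -> A).
Hypothesis v_mpower : forall a, mpower 1 (v a).
Let vy a : R := hemb (v a).
Let xi := yang_xi m n p vy.
Local Notation dsum := (dsum m n p v).
Local Notation gexpval := (@gexpval RR m n k r p v).
Implicit Types (la : mpart r) (a b : 'I_r) (s l : nat) (i j : 'I_N).

Lemma gser_dfps i :
  gser k xi i = dfps (fun la => hmap (fconst gs * compexp (gexpval la i))).
Proof.
apply: fpsP => t; rewrite [LHS]/= [RHS]/= (gsqrtE RR m_gt0 n_gt0 kn).
have e s : (s`!%:R : R)^-1 *: fcoef (gexponent k xi i ^+ s) t =
    dg (fun la => hemb (hsC s`!%:R^-1 * fcoef (gexpval la i ^+ s) t)).
  rewrite (gexponent_dfps k m_gt0 n_gt0 p v_mpower) dfpsX [fcoef _ _]/=.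
  rewrite natR_inv ?fact_gt0 // dgZ; congr dg; apply/funext => la.
  by rewrite -hmapX [RHS](rmorphM (@hemb RR)).
under eq_fun do rewrite e.
rewrite -esE (es_dg (l := fun la => hemb (fcoef (compexp (gexpval la i)) t))).
  rewrite dgZ; congr dg; apply/funext => la; rewrite hembM; congr hemb.
  by rewrite -fcoefCM.
move=> la; apply: hseries_to_ssum; apply: compexp_summable => s.
exact: gexpval_mpower.
Qed.

Definition gfps (l : int) i la : fps A :=
  cmap (pexpX (l%:~R * n%:R)) * (fconst gs * compexp (gexpval la i)).

Lemma gcoef_dg (l : int) i s :
  gcoef k xi l i s = dg (fun la => hemb (fcoef (gfps l i la) s)).
Proof.
have e : fexpX E (l%:~R * n%:R : R) =
    dfps (fun _ : mpart r => hmap (cmap (pexpX (l%:~R * n%:R)))).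
  apply: fpsP => t; rewrite [LHS]/= [RHS]/= (dg1 RR r) dgZ; congr dg.
  apply/funext => la; rewrite mulr1 natR_inv ?fact_gt0 //.
  rewrite (rmorphM (@hsC RR)) (rmorphM (@hemb RR)); congr (_ * _).
  rewrite (rmorphXn (@hsC RR)) (rmorphXn (@hemb RR)); congr (_ ^+ _).
  rewrite (rmorphM (@hsC RR)) (rmorphM (@hemb RR)).
  rewrite (rmorph_nat (@hsC RR)) (rmorph_nat (@hemb RR)).
  by rewrite (rmorph_int (@hsC RR)) (rmorph_int (@hemb RR)).
transitivity (fcoef (dfps (fun la => hmap (gfps l i la))) s); last by [].
congr (fcoef _ s); rewrite e gser_dfps dfpsM; congr dfps; apply/funext => la.
by rewrite -hmapM.
Qed.

Lemma evA_gfps (l : int) i la x : mpower 1 x ->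
  evA (gfps l i la) x =
  Exp (hsC (l%:~R * n%:R) * x) * (gs * Exp (evA (gexpval la i) x)).
Proof.
move=> x1; apply: etrans (evAM x1 _ _) _; apply: congr2; first exact: ev_pexpX.
apply: etrans (evAM x1 _ _) _; apply: congr2; first exact: evA_const.
by apply: Exp_evA => // s; apply: gexpval_mpower.
Qed.

Lemma evA_gexpval i la x : mpower 1 x -> evA (gexpval la i) x =
  hsC 2%:R^-1 * \sum_(j < N | (j == i %[mod m])%N)
    dsum la j (fun y => ev (Gser RR k i j) (x - y)).
Proof.
move=> x1; transitivity (evA (fconst (hsC 2%:R^-1) *
    \sum_(j < N | (j == i %[mod m])%N) @gamval RR m n k r p v la i j) x).
  congr evA; apply: fpsP => t; rewrite [RHS]fcoefCM fcoef_sum.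
  by [].
apply: etrans (evAM x1 _ _) _; apply: congr2; first exact: evA_const.
apply: etrans (evA_sum x1 _ _ _) _; apply: eq_bigr => j _.
apply: etrans (evA_dsum m n p v_mpower _ _ _ x1) _.
apply: (eq_dsum m n p v_mpower) => y y1.
exact: evA_shift x1 (mpowerN y1).
Qed.

Local Notation Sall la b l kk := (Srow Gam a1 a2 a3 p v
  (fun (_ : 'I_r) (_ : nat) (_ : 'I_r) (_ : nat) => true) (cutoff la) la b l kk).

Lemma Gser_Gam i j (d : int) (y : A) : (j == i %[mod m])%N ->
  (N%:Z %| i%:Z - j%:Z - d)%Z -> ev (Gser RR k i j) y = Gam d y.
Proof.
move=> ji Nd; have mij : (m%:Z %| i%:Z - j%:Z)%Z.
  by rewrite -eqz_mod_dvd eqz_mod_nat eq_sym.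
rewrite -(Gam_period k m_gt0 n_gt0 y Nd) (GamE _ _ _ mij).
rewrite /Gser flog_regular (Hser_Hd _ m_gt0 n_gt0) //.
Qed.

(** The arguments [x - (y - a1)] and [x - (y + a3)] are those of [K1], and similarly for [K2].
    [Gser_Gam] replaces indices by contents, [psum_fibre] sums over the fibre, and the residue
    condition modulo [m] disappears because [Gam] is 0 where it fails. *)
Lemma dsum_Srow i la b l kk : (box_cont p b l kk == i%:Z + 1 %[mod N%:Z])%Z ->
  \sum_(j < N | (j == i %[mod m])%N)
    dsum la j (fun y => ev (Gser RR k i j) (box_pos a1 a3 v b l kk - y)) =
  Sall la b l kk.
Proof.
move=> hi; set x := box_pos _ _ _ _ _ _.
have mN : (m %| N)%N by apply: dvdn_mulr.
have N_gt0 : (0 < N)%N by rewrite muln_gt0 m_gt0.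
have gen (T : comNzRingType) (z y h : T) : z - (y - h) = z - y + h by ring.
have gen' (T : comNzRingType) (z y h : T) : z - (y + h) = z - y - h by ring.
have mN' : (m%:Z %| N%:Z)%Z by [].
have hi' : (box_cont p b l kk == i%:Z + 1 %[mod m%:Z])%Z.
  exact: (@eqz_mod_dvdn m N mN _ _ hi).
have hi'' : (box_cont p b l kk == i%:Z + 1 + 0 %[mod m%:Z])%Z by rewrite addr0.
have hd (j : 'I_N) a s : (j == i %[mod m])%N ->
    (content p la a s == j%:Z %[mod N%:Z])%Z ->
    (N%:Z %| i%:Z - j%:Z - (box_cont p b l kk - box_cont p a s (lam la a s) - 1))%Z.
  move=> _; move: hi; rewrite !eqz_mod_dvd => h1 h2.
  have h3 := rpredB h1 h2; move: h3; rewrite -[content _ _ _ _]/(box_cont p a s (lam la a s)).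
  rewrite -[X in is_true X -> _]dvdz_oppr => h3.
  suff -> : i%:Z - j%:Z - (box_cont p b l kk - box_cont p a s (lam la a s) - 1) =
    - (box_cont p b l kk - (i%:Z + 1) - (box_cont p a s (lam la a s) - j%:Z)) by exact: h3.
  lia.
have hd' (j : 'I_N) a s : (j == i %[mod m])%N ->
    (content p la a s == j%:Z + 1 %[mod N%:Z])%Z ->
    (N%:Z %| i%:Z - j%:Z - (box_cont p b l kk - box_cont p a s (lam la a s)))%Z.
  move=> _; move: hi; rewrite !eqz_mod_dvd => h1 h2.
  have h3 := rpredB h1 h2; move: h3; rewrite -[content _ _ _ _]/(box_cont p a s (lam la a s)).
  rewrite -[X in is_true X -> _]dvdz_oppr => h3.
  suff -> : i%:Z - j%:Z - (box_cont p b l kk - box_cont p a s (lam la a s)) =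
    - (box_cont p b l kk - (i%:Z + 1) - (box_cont p a s (lam la a s) - (j%:Z + 1))) by exact: h3.
  lia.
have zz (z z' : A) : z = 0 -> z' = 0 -> z - z' = 0.
  by move=> -> ->; apply: subrr.
apply: etrans (@psum_fibre m N N_gt0 mN r _ p la (fun _ _ => true) i _ _
  (fun a s => K1 Gam a1 a3 p v b l kk a s (lam la a s))
  (fun a s => K2 Gam a1 a2 a3 p v b l kk a s (lam la a s)) _ _) _; last first.
- rewrite psum_rowsum; apply: eq_rowsum => a s s0 _.
    rewrite (eqz_mod_shift _ hi'); case: ifP => // /negbT h.
    rewrite /K1; have e y := Gam_eq0 n k y h.
    apply: esym; apply: zz; exact: e.
  rewrite (eqz_mod_shift _ hi''); case: ifP => // /negbT h.
  rewrite subr0 in h; rewrite /K2; have e y := Gam_eq0 n k y h.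
  by apply: esym; apply: zz; exact: e.
- move=> j a s ji s0 hs; have Nd := hd' j a s ji hs; rewrite /K2.
  apply: congr2; first exact: Gser_Gam.
  by apply: congr1; rewrite gen'; apply: Gser_Gam.
- move=> j a s ji s0 hs; have Nd := hd j a s ji hs; rewrite /K1.
  apply: congr2; first by rewrite gen; apply: Gser_Gam.
  by apply: congr1; rewrite gen'; apply: Gser_Gam.
Qed.

Local Notation kpos := (row_pos m n v).
Local Notation kcont := (row_cont p).
Local Notation Sk := (Sk m n k p v).
Local Notation hf := (hsC 2%:R^-1).
Let cor : A := corr Gam a1 a3.

Let Sall_Sk la b l : addable la b l ->
  Sall la b l (lam la b l) =
  Sk (@prec r) la b l + Sk (@succ r) la b l + (cor - Gam 0 a2).
Proof.
by move=> al; apply: (Srow_all a1 a2 a3 p v (@Gam_sym RR m n k m_gt0 n_gt0 kn) (Gam00 RR m n k) al).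
Qed.

(** The two shapes give the same value by [Srow_all_add]. Thus e, where g_i acts after the box is
    added, and f, where it acts after the removal, receive the same factor. *)
Lemma evA_gexpval_box i la b l : addable la b l ->
  (kcont la b l == i%:Z + 1 %[mod N%:Z])%Z ->
  forall mu, mu = la \/ mu = add_box la b l ->
  evA (gexpval mu i) (kpos la b l) =
  hf * (Sk (@prec r) la b l + Sk (@succ r) la b l + (cor - Gam 0 a2)).
Proof.
move=> al hi mu hmu; rewrite -(Sall_Sk al).
apply: etrans (evA_gexpval i mu (kpos_mpower m n v_mpower la b l)) _.
apply: congr1; apply: etrans (@dsum_Srow i mu b l (lam la b l) hi) _.
case: hmu => ->; first exact: erefl.
exact: (Srow_all_add p v (@Gam_sym RR m n k m_gt0 n_gt0 kn) (erefl a3) (hsC_half RR) al).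
Qed.

End GEigenvalues.

(** * Raising and lowering operators *)

Section BoxOperators.
Variables (RR : realType) (m n : nat) (k : int) (r : nat).
Hypotheses (m_gt0 : (0 < m)%N) (n_gt0 : (0 < n)%N) (kn : coprimez k n%:Z).
Local Notation A := (hseries RR).
Local Notation R := (hloc RR).
Local Notation N := (m * n)%N.
Local Notation w := (omega RR m n k).
Local Notation a1 := (h1A RR m n).
Local Notation a2 := (h2A RR m n).
Local Notation a3 := (h3A RR m n).
Local Notation Gam := (@Gam RR m n k).
Local Notation wexp := (wexp m n k).
Variables (p : 'I_r -> nat) (v : 'I_r -> A).
Hypothesis v_mpower : forall a, mpower 1 (v a).
Let p' a := (p a %% m)%N.
Let u' a : R := hcst (w ^- p a) * hexp (n%:R * hemb (v a)).
Let vy a : R := hemb (v a).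
Let xi := yang_xi m n p vy.
Local Notation kpos := (row_pos m n v).
Local Notation kcont := (row_cont p).
Local Notation Sk := (Sk m n k p v).
Local Notation gfps := (gfps k p v).
Local Notation hf := (hsC 2%:R^-1).
Local Notation cor := (corr Gam a1 a3).
Local Notation addrows := (fun (la : mpart r) (b : 'I_r) => index_iota 1 (size (la b)).+2).
Local Notation remrows := (fun (la : mpart r) (b : 'I_r) => index_iota 1 (size (la b)).+1).
Implicit Types (la mu : mpart r) (a b : 'I_r) (s l : nat) (i j : 'I_N) (z : int).

Lemma hemb_wexpXz d (y : A) z : mpower 1 y ->
  hemb (wexp d y) ^ z = hemb (wexp (d * z) (z%:~R * y)).
Proof.
move=> y1; case: z => t.
  by rewrite -exprnP -(rmorphXn (@hemb RR)) (wexpX _ _ _ _ _ y1).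
rewrite NegzE -exprnN -(rmorphXn (@hemb RR)) (wexpX _ _ _ _ _ y1).
rewrite hemb_wexpV; last exact: mpowerMl.
by rewrite -mulrN rmorphN -mulNr.
Qed.

Definition ycoef P (i : nat) la b l : R :=
  if (content p la b l == i%:Z + 1 %[mod N%:Z])%Z
  then exdiv (yang_num m n p vy P la b l i) (yang_den m n p vy P la b l i) else 0.

Lemma yang_coefE P i s la b l :
  yang_coef m n p vy P i s la b l = ycoef P i la b l * hemb (kpos la b l) ^+ s.
Proof.
rewrite /yang_coef /ycoef; case: ifP => _; last by rewrite mul0r.
by apply: (congr1 (fun x => exdiv _ _ * x ^+ s)); apply: xposE.
Qed.

Lemma yang_xp_lx i s : yang_xp m n p vy i s =
  lx (boxsum addrows (@addable r) (@add_box r)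
    (fun la b l => ycoef (@prec r) i la b l * hemb (kpos la b l) ^+ s)).
Proof.
rewrite lxE; apply: (congr1 (@lin_ext R (mpart r))).
apply/funext => la; rewrite /boxsum ktE.
by apply: eq_bigr => b _; apply: eq_bigr => l _; rewrite yang_coefE.
Qed.

Local Notation constY :=
  (if N == 1%N then - h3 RR m n / h1 RR m n else 1 : R).

Lemma yang_xm_lx i s : yang_xm m n p vy i s =
  lx (boxsum remrows (@removable r) (@rem_box r)
    (fun la b l => (constY * ycoef (@succ r) i (rem_box la b l) b l) *
       hemb (kpos (rem_box la b l) b l) ^+ s)).
Proof.
rewrite lxE; apply: (congr1 (@lin_ext R (mpart r))).
apply/funext => la; rewrite /boxsum ktE.
apply: eq_bigr => b _; apply: eq_bigr => l _; rewrite yang_coefE.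
by congr (_ *: _); exact: mulrA.
Qed.

Lemma es_xp z i : endo_sum (fun s => gcoef k xi z i s * yang_xp m n p vy i s) =
  lx (boxsum addrows (@addable r) (@add_box r)
    (fun la b l => ycoef (@prec r) i la b l *
       hemb (evA (gfps z i (add_box la b l)) (kpos la b l)))).
Proof.
rewrite -esE -(es_boxsum addrows (@addable r) (@add_box r)
  (ycoef (@prec r) i) (gfps z i) (kpos_mpower m n v_mpower)).
congr es; apply/funext => s; rewrite yang_xp_lx.
by rewrite (gcoef_dg m_gt0 n_gt0 kn p v_mpower).
Qed.

Lemma es_xm z i : endo_sum (fun s => gcoef k xi z i s * yang_xm m n p vy i s) =
  lx (boxsum remrows (@removable r) (@rem_box r)
    (fun la b l => (constY * ycoef (@succ r) i (rem_box la b l) b l) *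
       hemb (evA (gfps z i (rem_box la b l)) (kpos (rem_box la b l) b l)))).
Proof.
rewrite -esE -(es_boxsum remrows (@removable r) (@rem_box r)
  (fun la b l => constY * ycoef (@succ r) i (rem_box la b l) b l) (gfps z i)
  (fun la b l => kpos_mpower m n v_mpower (rem_box la b l) b l)).
congr es; apply/funext => s; rewrite yang_xm_lx.
by rewrite (gcoef_dg m_gt0 n_gt0 kn p v_mpower).
Qed.

Hypothesis tor_nr : tor_nonresonant m n k p' u'.
Hypothesis yang_nr : yang_nonresonant m n p vy.

(** [gs] removes the term [- Gam 0 a2] of the exponent, and the powers of [w] and the exponential
    combine to chi ^ z, since [i] is congruent to the content minus 1 modulo [N]. *)
Lemma hemb_evA_gfps z i la b l mu : addable la b l ->
  (kcont la b l == i%:Z + 1 %[mod N%:Z])%Z -> mu = la \/ mu = add_box la b l ->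
  hsC (w ^ (- z * i%:Z)) * evA (gfps z i mu) (kpos la b l) =
  wexp ((1 - kcont la b l) * z) (z%:~R * kpos la b l) *
  Exp (hf * (Sk (@prec r) la b l + Sk (@succ r) la b l + cor)).
Proof.
move=> al hi hmu; have x1 := kpos_mpower m n v_mpower la b l.
set x := kpos la b l; set S := Sk _ _ _ _ + _.
have S1 : mpower 1 S by apply: mpowerD; apply: Sk_mpower.
have G1 := Gam_mpower m n k 0 (a2_mpower RR m n).
have c1 : mpower 1 cor.
  by apply: mpowerB; apply: Gam_mpower; [apply: a1_mpower|apply/mpowerN/a3_mpower].
have e1 : gs RR m n k * Exp (evA (gexpval k p v mu i) x) = Exp (hf * (S + cor)).
  rewrite (evA_gexpval_box m_gt0 n_gt0 kn v_mpower al hi hmu) -/S /gs.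
  have S1' : mpower 1 (hf * (S + (cor - Gam 0 a2))).
    by apply: mpowerMl; apply: mpowerD S1 _; apply: mpowerB c1 G1.
  apply: etrans (esym (ExpD (mpowerMl _ G1) S1')) _.
  apply: congr1; have gen (T : comNzRingType) (h' g' s' c' : T) :
    h' * g' + h' * (s' + (c' - g')) = h' * (s' + c') by ring.
  exact: gen.
apply: etrans (congr1 (fun y => hsC _ * y) (etrans
  (evA_gfps k p v_mpower z i mu x1) (congr1 (fun y => Exp _ * y) e1))) _.
have e2 : hsC (z%:~R * n%:R) * x = n%:R * (z%:~R * x).
  rewrite (rmorphM (@hsC RR)) (rmorph_int (@hsC RR)) (rmorph_nat (@hsC RR)).
  have gen (T : comNzRingType) (a b' c : T) : a * b' * c = b' * (a * c) by ring.
  exact: gen.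
have e3 : w ^ (- z * i%:Z) = w ^ ((1 - kcont la b l) * z).
  have hd : ((m * n)%N%:Z %| (1 - kcont la b l) * z - - z * i%:Z)%Z.
    have -> : (1 - kcont la b l) * z - - z * i%:Z = (kcont la b l - (i%:Z + 1)) * (- z).
      by ring.
    by apply: dvdz_mulr; rewrite -eqz_mod_dvd.
  have ed : (1 - kcont la b l) * z = - z * i%:Z + ((1 - kcont la b l) * z - - z * i%:Z).
    by ring.
  by rewrite [in RHS]ed expfzDr ?omega_neq0 // (omegaN RR k m_gt0 n_gt0 hd) mulr1.
apply: etrans (mulrA _ _ _) _; apply: (congr1 (fun y => y * _)).
exact: congr2 (congr1 _ e3) (congr1 _ e2).
Qed.

(** Only the [i] congruent to the content minus 1 modulo [N] contributes. There [tor_yang_coef]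
    exchanges the Yangian for the toroidal coefficient, which costs [Exp (- Sk P la b l)]. *)
Lemma box_coef P z (i0 : nat) la b l mu : P = @prec r \/ P = @succ r ->
  addable la b l -> mu = la \/ mu = add_box la b l ->
  \sum_(i < N | (i == i0 %[mod m])%N)
    hcst (w ^ (- z * i%:Z)) *
      (ycoef P i la b l * hemb (evA (gfps z i mu) (kpos la b l))) =
  tor_coef m n k p' u' P i0%:Z z la b l *
  hemb (Exp (hf * (Sk (@prec r) la b l + Sk (@succ r) la b l + cor) - Sk P la b l)).
Proof.
move=> hP al hmu; have l0 := addable_gt0 al.
have x1 := kpos_mpower m n v_mpower la b l.
have shift1 d (t : nat) : (content p la b l == t%:Z + 1 %[mod d])%Z =
    (content p la b l - 1 == t%:Z %[mod d])%Z.
  by rewrite !eqz_mod_dvd opprD addrA addrAC.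
set X := exdiv (tor_num m n k p' u' P la b l i0) (tor_den m n k p' u' P la b l i0).
set H := hf * _; set S := Sk P la b l.
have S1 : mpower 1 S by apply: Sk_mpower.
have H1 : mpower 1 H.
  apply: mpowerMl; apply: mpowerD; first by apply: mpowerD; apply: Sk_mpower.
  by apply: mpowerB; apply: Gam_mpower; [apply: a1_mpower|apply/mpowerN/a3_mpower].
have mN : (m %| N)%N by apply: dvdn_mulr.
have N_gt0 : (0 < N)%N by rewrite muln_gt0 m_gt0.
have Fi (i : 'I_N) : (i == i0 %[mod m])%N ->
    (content p la b l - 1 == i%:Z %[mod N%:Z])%Z ->
    hcst (w ^ (- z * i%:Z)) *
      (exdiv (yang_num m n p vy P la b l i) (yang_den m n p vy P la b l i) *
       hemb (evA (gfps z i mu) (kpos la b l))) =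
    X * chi m n k u' la b l ^ z * hemb (Exp (H - S)).
  rewrite -shift1 => ii0 hi.
  have hj : (kcont la b l == i0%:Z + 1 %[mod m%:Z])%Z.
    have := @eqz_mod_dvdn m N mN _ _ hi; rewrite shift1 => /eqP h.
    rewrite -[kcont la b l]/(content p la b l) shift1 h.
    by rewrite eqz_mod_nat.
  have [eX _] := tor_yang_coef m_gt0 n_gt0 kn v_mpower hP tor_nr yang_nr al hi hj.
  rewrite /X eX.
  rewrite (chiE m_gt0 n_gt0 kn p v_mpower la b l0) (hemb_wexpXz _ _ x1).
  have e := hemb_evA_gfps z al hi hmu.
  rewrite -[hcst _]/(hemb (hsC _)) mulrCA hembM e -/H.
  set Y := exdiv _ _.
  have eE : Exp H = Exp S * Exp (H - S).
    apply: etrans _ (ExpD S1 (mpowerB H1 S1)).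
    by apply: congr1; apply: esym; rewrite addrC subrK.
  rewrite eE.
  have gen (T : comNzRingType) (y a s t : T) : y * (a * (s * t)) = y * s * a * t by ring.
  apply: etrans (congr1 (fun y => Y * y) _) (gen _ Y _ _ _).
  exact: etrans (esym (hembM _ _)) (congr1 (fun y => hemb _ * y) (esym (hembM _ _))).
rewrite /tor_coef (@content_mod m r p) shift1.
apply: etrans _ (etrans (@sum_residue m N N_gt0 mN R _ i0 _ _ Fi) _).
  apply: eq_bigr => i _; rewrite /ycoef shift1; case: ifP => _; first by [].
  by rewrite mul0r mulr0.
by case: ifP => _; rewrite ?mul0r.
Qed.

End BoxOperators.

Section BoxSums.
Variables (RR : realType) (r : nat).
Local Notation R := (hloc RR).
Variables (rng : mpart r -> 'I_r -> seq nat) (Q : mpart r -> 'I_r -> nat -> bool).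
Variable T : mpart r -> 'I_r -> nat -> mpart r.
Implicit Types c : mpart r -> 'I_r -> nat -> R.
Local Notation bx c := (boxsum rng Q T c).

Lemma eq_boxsum c c' : (forall la b l, Q la b l -> c la b l = c' la b l) ->
  lx (bx c) = lx (bx c').
Proof.
move=> cc; apply: (congr1 (@lx RR r)); apply/funext => la.
by apply: eq_bigr => b _; apply: eq_bigr => l Ql; rewrite (cc _ _ _ Ql).
Qed.

Lemma sum_boxsum I (t : seq I) (P : pred I) (a : I -> R)
    (c : I -> mpart r -> 'I_r -> nat -> R) :
  \sum_(i <- t | P i) a i *: lx (bx (c i)) =
  lx (bx (fun la b l => \sum_(i <- t | P i) a i * c i la b l)).
Proof.
apply: ap_eq => la; apply: etrans (ap_suml _ _ _ _) _.
apply: etrans _ (esym (ap_lx _ la)).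
transitivity (\sum_(i <- t | P i) a i *: bx (c i) la).
  by apply: eq_bigr => i _; rewrite apZl; apply: congr1; apply: ap_lx.
under eq_bigr do rewrite scaler_sumr.
rewrite exchange_big; apply: eq_bigr => b _.
under eq_bigr do rewrite scaler_sumr.
rewrite exchange_big; apply: eq_bigr => l _; rewrite scaler_suml.
by apply: eq_bigr => i _; rewrite scalerA.
Qed.

Lemma dg_boxsum d c :
  dg d * lx (bx c) = lx (bx (fun la b l => d (T la b l) * c la b l)).
Proof.
apply: ap_eq => la; rewrite apM.
apply: etrans (congr1 (ap _) (ap_lx _ la)) _.
apply: etrans _ (esym (ap_lx _ la)); rewrite /boxsum ap_sumr.
apply: eq_bigr => b _; rewrite ap_sumr; apply: eq_bigr => l _.
rewrite apZ ap_dg scalerA; apply: (congr1 (fun x => x *: _)).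
exact: mulrC.
Qed.

Lemma boxsum_dg d c :
  lx (bx c) * dg d = lx (bx (fun la b l => d la * c la b l)).
Proof.
apply: ap_eq => la; rewrite apM.
apply: etrans (congr1 (ap _) (ap_dg _ la)) _.
apply: etrans _ (esym (ap_lx _ la)); rewrite apZ.
apply: etrans (congr1 (fun x => _ *: x) (ap_lx _ la)) _.
rewrite /boxsum scaler_sumr; apply: eq_bigr => b _.
by rewrite scaler_sumr; apply: eq_bigr => l _; rewrite scalerA.
Qed.

End BoxSums.

Lemma hden_unit (RR : realType) (nus : seq RR[i]) :
  hemb (hden nus) \is a GRing.unit.
Proof.
apply/unitrP; exists (HLoc (is_hlocP 1 nus)).
suff e : HLoc (is_hlocP 1 nus) * hemb (hden nus) = 1.
  by split => //; rewrite mulrC.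
apply: val_inj; rewrite [LHS]/=; rewrite rmorph1 mul1r mulVf //.
by rewrite tofrac_eq0 hden_neq0.
Qed.

(** * The scalar factors of f and of x^- *)

Section Intertwiner.
Variables (RR : realType) (m n : nat) (k : int) (r : nat).
Hypotheses (m_gt0 : (0 < m)%N) (n_gt0 : (0 < n)%N) (kn : coprimez k n%:Z).
Local Notation A := (hseries RR).
Local Notation R := (hloc RR).
Local Notation N := (m * n)%N.
Local Notation a1 := (h1A RR m n).
Local Notation a2 := (h2A RR m n).
Local Notation a3 := (h3A RR m n).
Local Notation Gam := (@Gam RR m n k).
Local Notation hn := (half_n RR n).
Local Notation cor := (corr Gam a1 a3).
Local Notation constT := (if m == 1%N
  then qq RR m * (1 - q3 RR m n k) / (1 - (q1 RR m n k)^-1) else 1).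
Local Notation constY := (if N == 1%N then - h3 RR m n / h1 RR m n else 1).

(** hbar_1 is the inverted element hbar_1 - nu hbar_2 with [nu = 0]. *)
Lemma h1_unit : h1 RR m n \is a GRing.unit.
Proof.
rewrite (h1E RR m_gt0 n_gt0) (rmorphM (@hemb RR)) unitrM; apply/andP; split.
  apply: hcst_unit; rewrite invr_eq0.
  by rewrite Num.Theory.pnatr_eq0 -lt0n muln_gt0 m_gt0.
have := @hden_unit RR [:: 0]; rewrite /hden big_seq1.
by rewrite (rmorph0 (@hsC RR)) mul0r subr0.
Qed.

Lemma cor_mpower : mpower 1 cor.
Proof.
by apply: mpowerB; apply: Gam_mpower; [apply: a1_mpower|apply/mpowerN/a3_mpower].
Qed.

Let Bf y := Bfac m n k (- 1) y : A.

(** For [m = 1], [N] divides -1 only if [n = 1]. Then [Bfac] at -1 is the identity, and the quotient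
    of its values is the factor [- h3 / h1] of x^-; otherwise it is the constant [1 - w ^ (- 1)], a
    unit. *)
Let Bf_const : m = 1%N -> constY * hemb (Bf a1) = hemb (Bf (- a3)) :> R /\
  hemb (Bf a1) \is a GRing.unit.
Proof.
move=> m1; have e : (N%:Z %| (- 1)%R)%Z = (N == 1%N).
  by rewrite -[(_ %| _)%Z]/(N %| 1)%N dvdn1.
rewrite /Bf /Bfac e; case: eqP => N1.
  have n1 : n = 1%N by move: N1; rewrite m1 mul1n.
  have u1 (y : A) : n%:R * y = y by rewrite n1 mul1r.
  rewrite 2!u1 -(h1E RR m_gt0 n_gt0) (rmorphN (@hemb RR)) (h3E RR m_gt0 n_gt0).
  by split; [apply: divrK; apply: h1_unit|apply: h1_unit].
split; first exact: mul1r.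
apply: hcst_unit; rewrite subr_eq0 eq_sym.
apply: (omega_neq1 RR m_gt0 n_gt0 kn); last by rewrite e; apply/eqP.
by rewrite m1 dvd1z.
Qed.

(* For m = 1 the kernel Gam (-1, .) does not vanish, and the normalisations of
   the operators f and x^- compensate for the resulting constant. *)
Lemma const_corr : constT = constY * hemb (Exp cor).
Proof.
have [m1|mN1] := eqVneq m 1%N; last first.
  have N1 : (N == 1%N) = false by rewrite muln_eq1 (negPf mN1).
  have nd : ~~ (m%:Z %| (- 1)%R)%Z.
    by rewrite -[(_ %| _)%Z]/(m %| 1)%N dvdn1.
  have c0 : cor = 0.
    have zz (z z' : A) : z = 0 -> z' = 0 -> z - z' = 0.
      by move=> -> ->; apply: subrr.
    by apply: zz; apply: Gam_eq0.
  rewrite N1 c0 Exp0; apply: esym; apply: etrans (mul1r _) _.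
  exact: (rmorph1 (@hemb RR)).
have md : (m%:Z %| (- 1)%R)%Z by rewrite m1 dvd1z.
have [eB uB] := Bf_const m1.
have a1m := a1_mpower RR m n; have a3m := a3_mpower RR m n.
have hn1 := hn_mpower n a1m; have hn3 := hn_mpower n a3m.
have hn2 := hn_mpower n (a2_mpower RR m n).
have g1 := Gam_mpower m n k (- 1) a1m.
have g3 := Gam_mpower m n k (- 1) (mpowerN a3m).
have e1 := pd_Gam m_gt0 n_gt0 kn md a1m.
have e3 := pd_Gam m_gt0 n_gt0 kn md (mpowerN a3m).
rewrite -/(Bf a1) in e1; rewrite -/(Bf (- a3)) opprK in e3.
set P1 := pd m n k (- 1) (- a1) in e1; set P3 := pd m n k (- 1) a3 in e3.
have onem (x : A) : 1 - hemb x = hemb (1 - x).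
  apply: etrans (congr1 (fun y => y - _) (esym (rmorph1 (@hemb RR)))) _.
  exact: (esym (rmorphB (@hemb RR) _ _)).
have q1' : 1 - (q1 RR m n k)^-1 = hemb P1.
  rewrite (q1E RR k m_gt0 n_gt0) (hemb_wexpV m n k 1 a1m).
  exact: onem.
have q3' : 1 - q3 RR m n k = hemb P3.
  rewrite (q3E RR k m_gt0 n_gt0); exact: onem.
have uP1 : hemb P1 \is a GRing.unit.
  have := uB; have -> : Bf a1 = P1 * Exp (Gam (- 1) a1) * Exp (hn * a1).
    have gen (T : comNzRingType) (x y z : T) : z * x = 1 -> y = x * y * z.
      by move=> h; rewrite mulrAC [x * z]mulrC h mul1r.
    by rewrite e1; apply: gen; apply: ExpN.
  by rewrite 2!(rmorphM (@hemb RR)) 2!unitrM => /andP[/andP[]].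
have t1 : Exp cor * P1 = Bf a1 * (Exp (- (hn * a1)) * Exp (- Gam (- 1) (- a3))).
  have gen (T : comNzRingType) (c g g' x y z : T) : c = g * g' -> x * g = y * z ->
      c * x = z * (y * g').
    by move=> -> h; rewrite mulrAC [g * x]mulrC h; ring.
  by apply: gen e1; apply: ExpB.
have t3 : Bf (- a3) * (Exp (- (hn * a1)) * Exp (- Gam (- 1) (- a3))) =
    Exp (hn * a2) * P3.
  have gen (T : comNzRingType) (x y y' g g' z x1 u : T) : x * g = y * z ->
      y * y' = 1 -> g * g' = 1 -> x1 * y' = u -> z * (x1 * g') = u * x.
    move=> h1 h2 h3 <-; have -> : z = y * z * y' by rewrite mulrAC h2 mul1r.
    by rewrite -h1 -[RHS]mul1r -h3; ring.
  apply: gen e3 _ (ExpN g3) _.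
    by rewrite mulrN opprK; apply: (ExpN hn3).
  apply: etrans (esym (ExpD (mpowerN hn1) (mpowerN hn3))) _; apply: congr1.
  have gen' (T : comNzRingType) (h x y : T) : - (h * x) + - (h * (- x - y)) = h * y.
    by ring.
  exact: gen'.
apply: (mulIr uP1); rewrite q1' q3'.
apply: etrans (divrK uP1 _) _; rewrite (qqE RR m_gt0 n_gt0).
have gen (T : comNzRingType) (x y z y' u t : T) : x * y = y' -> z = y * t ->
  u = y' * t -> u = x * z.
  by move=> <- -> ->; rewrite mulrA.
apply: etrans (hembM _ _) _; rewrite -mulrA; rewrite [in RHS](hembM (Exp cor) P1).
apply: (gen _ _ _ _ _ _ (hemb (Exp (- (hn * a1)) * Exp (- Gam (- 1) (- a3)))) eB).
  exact: etrans (congr1 (@hemb RR) t1) (esym (hembM _ _)).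
exact: etrans (congr1 (@hemb RR) (esym t3)) (esym (hembM _ _)).
Qed.

End Intertwiner.

(** * Intertwining of e and f *)

Section IntertwineBoxes.
Variables (RR : realType) (m n : nat) (k : int) (r : nat).
Hypotheses (m_gt0 : (0 < m)%N) (n_gt0 : (0 < n)%N) (kn : coprimez k n%:Z).
Local Notation A := (hseries RR).
Local Notation R := (hloc RR).
Local Notation N := (m * n)%N.
Local Notation w := (omega RR m n k).
Local Notation a1 := (h1A RR m n).
Local Notation a2 := (h2A RR m n).
Local Notation a3 := (h3A RR m n).
Local Notation Gam := (@Gam RR m n k).
Variables (p : 'I_r -> nat) (v : 'I_r -> A).
Hypothesis v_mpower : forall a, mpower 1 (v a).
Let p' a := (p a %% m)%N.
Let u' a : R := hcst (w ^- p a) * hexp (n%:R * hemb (v a)).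
Let vy a : R := hemb (v a).
Let xi := yang_xi m n p vy.
Local Notation Sk := (Sk m n k p v).
Local Notation hf := (hsC 2%:R^-1).
Local Notation cor := (corr Gam a1 a3).
Local Notation addrows := (fun (la : mpart r) (b : 'I_r) => index_iota 1 (size (la b)).+2).
Local Notation remrows := (fun (la : mpart r) (b : 'I_r) => index_iota 1 (size (la b)).+1).
Implicit Types (la mu : mpart r) (a b : 'I_r) (s l : nat) (z : int).
Hypothesis tor_nr : tor_nonresonant m n k p' u'.
Hypothesis yang_nr : yang_nonresonant m n p vy.

Definition ellA la : A := ell Gam a1 a2 a3 hf p v la.

Lemma ellA_mpower la : mpower 1 (ellA la).
Proof.
apply: (@ell_m r _ (@mpower RR 1) Gam a1 a2 a3 hf p v).
- exact: mpower_0.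
- exact: mpowerD.
- exact: mpowerN.
- by move=> x y; apply: mpowerMl.
- by move=> d y; apply: Gam_mpower.
- exact: erefl.
- exact: a1_mpower.
- exact: a2_mpower.
- exact: v_mpower.
Qed.

Definition cnorm la : R := hemb (Exp (ellA la)).

Lemma cnorm0 : cnorm (mpart0 r) = 1.
Proof.
rewrite /cnorm; have -> : ellA (mpart0 r) = 0 by apply: ell0.
rewrite Exp0; exact: (rmorph1 (@hemb RR)).
Qed.

Lemma cnorm_unit la : cnorm la \is a GRing.unit.
Proof. by apply: (hemb_unit (b := Exp (- ellA la))); apply/ExpN/ellA_mpower. Qed.

Let shift_mpower la b l :
  mpower 1 (hf * (Sk (@succ r) la b l - Sk (@prec r) la b l + cor)).
Proof.
apply: mpowerMl; apply: mpowerD; last exact: cor_mpower.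
by apply: mpowerB; apply: Sk_mpower.
Qed.

Lemma cnorm_add la b l : addable la b l -> cnorm (add_box la b l) =
  cnorm la * hemb (Exp (hf * (Sk (@succ r) la b l - Sk (@prec r) la b l + cor))).
Proof.
move=> al; apply: etrans _ (esym (hembM _ _)); apply: (congr1 (@hemb RR)).
apply: etrans _ (ExpD (ellA_mpower la) (shift_mpower la b l)).
apply: (congr1 (@Exp RR)); have h123 : a3 = - a1 - a2 := erefl.
exact: (@ell_add r _ Gam a1 a2 a3 hf p v (Gam_sym m_gt0 n_gt0 kn) h123
  (hsC_half RR) la b l al).
Qed.

Lemma tor_e_lx (i : 'I_m) z : tor_e n k p' u' i z =
  lx (boxsum addrows (@addable r) (@add_box r)
    (tor_coef m n k p' u' (@prec r) i z)).
Proof.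
rewrite lxE; apply: (congr1 (@lin_ext R (mpart r))).
by apply/funext => la; rewrite /boxsum ktE.
Qed.

Local Notation constT := (if m == 1%N
  then qq RR m * (1 - q3 RR m n k) / (1 - (q1 RR m n k)^-1) else 1).
Local Notation constY := (if N == 1%N then - h3 RR m n / h1 RR m n else 1).

Lemma tor_f_lx (i : 'I_m) z : tor_f n k p' u' i z =
  lx (boxsum remrows (@removable r) (@rem_box r)
    (fun mu b l => constT *
       tor_coef m n k p' u' (@succ r) i z (rem_box mu b l) b l)).
Proof.
rewrite lxE; apply: (congr1 (@lin_ext R (mpart r))).
by apply/funext => la; rewrite /boxsum ktE.
Qed.

Local Notation Ph := (Phi m n k (yang_xp m n p vy) (yang_xm m n p vy) xi).

Lemma Phi_e_lx (i : 'I_m) z : Ph (Gen_e i z) =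
  lx (boxsum addrows (@addable r) (@add_box r) (fun la b l =>
    tor_coef m n k p' u' (@prec r) i z la b l *
    hemb (Exp (hf * (Sk (@prec r) la b l + Sk (@succ r) la b l + cor) -
               Sk (@prec r) la b l)))).
Proof.
rewrite /Phi; under eq_bigr do rewrite (es_xp m_gt0 n_gt0 kn p v_mpower).
rewrite sum_boxsum; apply: eq_boxsum => la b l al.
have e := box_coef m_gt0 n_gt0 kn v_mpower tor_nr yang_nr z i (or_introl erefl) al
  (or_intror erefl).
exact: e.
Qed.

Lemma Phi_f_lx (i : 'I_m) z : Ph (Gen_f i z) =
  lx (boxsum remrows (@removable r) (@rem_box r) (fun mu b l =>
    constY * (tor_coef m n k p' u' (@succ r) i z (rem_box mu b l) b l *
    hemb (Exp (hf * (Sk (@prec r) (rem_box mu b l) b l +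
      Sk (@succ r) (rem_box mu b l) b l + cor) - Sk (@succ r) (rem_box mu b l) b l))))).
Proof.
rewrite /Phi; under eq_bigr do rewrite (es_xm m_gt0 n_gt0 kn p v_mpower).
rewrite sum_boxsum; apply: eq_boxsum => mu b l /andP[al _].
have := box_coef m_gt0 n_gt0 kn v_mpower tor_nr yang_nr z i (or_intror erefl) al
  (or_introl erefl).
move=> <-; rewrite mulr_sumr; apply: eq_bigr => j _.
rewrite -[X in _ * X]mulrA; exact: mulrCA.
Qed.

Lemma intertwine_e (i : 'I_m) z :
  dg cnorm * tor_e n k p' u' i z = Ph (Gen_e i z) * dg cnorm.
Proof.
rewrite tor_e_lx Phi_e_lx dg_boxsum boxsum_dg; apply: eq_boxsum => la b l al.
rewrite (cnorm_add al).
have e : hf * (Sk (@prec r) la b l + Sk (@succ r) la b l + cor) - Sk (@prec r) la b l =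
    hf * (Sk (@succ r) la b l - Sk (@prec r) la b l + cor).
  have gen (T : comNzRingType) (h x y c : T) : h + h = 1 ->
      h * (x + y + c) - x = h * (y - x + c).
    by move=> hh; rewrite -{2}[x]mul1r -hh; ring.
  exact: gen (hsC_half RR).
rewrite e; have gen (T : comNzRingType) (x y z' : T) : x * y * z' = x * (z' * y) by ring.
exact: gen.
Qed.

(** Here [cnorm] of the larger shape stands on the side of Phi. The exponent of [cnorm_add] and that
    of the coefficient of Phi add up to [corr], which [const_corr] identifies with the quotient of
    the two scalar factors. *)
Lemma intertwine_f (i : 'I_m) z :
  dg cnorm * tor_f n k p' u' i z = Ph (Gen_f i z) * dg cnorm.
Proof.
rewrite tor_f_lx Phi_f_lx dg_boxsum boxsum_dg; apply: eq_boxsum => mu b l.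
move=> /andP[al /eqP emu]; set la := rem_box mu b l in al emu *.
have ec := cnorm_add al; rewrite emu in ec; rewrite ec.
set S := Sk (@succ r) la b l; set P := Sk (@prec r) la b l.
have e : Exp cor = Exp (hf * (S - P + cor)) * Exp (hf * (P + S + cor) - S) :> A.
  apply: etrans _ (ExpD (shift_mpower la b l) _); last first.
    apply: mpowerB; last exact: Sk_mpower.
    apply: mpowerMl; apply: mpowerD; last exact: cor_mpower.
    by apply: mpowerD; apply: Sk_mpower.
  apply: congr1; have gen (T : comNzRingType) (h x y c : T) : h + h = 1 ->
      c = h * (y - x + c) + (h * (x + y + c) - y).
    move=> hh; rewrite -{1}[c]mul1r -{3}[y]mul1r -hh; ring.
  exact: gen (hsC_half RR).
rewrite (const_corr RR m_gt0 n_gt0 kn) e; set Y := constY.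
have gen (T : comNzRingType) (c y x1 x2 t : T) :
  c * (y * (x1 * x2) * t) = c * x1 * (y * (t * x2)) by ring.
apply: etrans (congr1 (fun x => _ * (_ * x * _)) (esym (hembM _ _))) _.
exact: gen.
Qed.

End IntertwineBoxes.

(** * Cartan generators *)

Section GenericPsi.
Variable K : idomainType.

Lemma logd_psi (u u' c : K) : u * u' = 1 ->
  logd (FPS (fun i => c ^+ i.+1 - (u' * u' * c) ^+ i.+1))
    ((fconst u - fconst (u' * c) * fvar K) * fgeom c).
Proof.
move=> uu'; have -> : fconst u - fconst (u' * c) * fvar K =
    fconst u * (1 - fconst (u' * u' * c) * fvar K).
  rewrite mulrBr mulr1 mulrA -rmorphM; congr (_ - fconst _ * _).
  by rewrite 2!mulrA uu' mul1r.
rewrite -[X in logd _ X]mulrA; apply: logdC; exact: logd_quot.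
Qed.

(** For [Q = q * q] this supplies the quotients by [q - q^-1] in the eigenvalues of h_{j,l}, an
    element that is not inverted in R. *)
Lemma dvd_exprz (Q : K) (z : int) : Q \is a GRing.unit ->
  exists y, Q ^ z - 1 = y * (Q - 1).
Proof.
move=> uQ; case: z => t.
  by exists (\sum_(i < t) Q ^+ i); rewrite -exprnP subrX1 mulrC.
exists (- (Q ^- t.+1 * \sum_(i < t.+1) Q ^+ i)).
rewrite NegzE -exprnN mulNr -mulrA [_ * (Q - 1)]mulrC -subrX1 mulrBr mulr1.
by rewrite mulVr ?unitrX // opprB.
Qed.

Lemma dvd_exprzB (Q a b : K) (z : int) : Q \is a GRing.unit ->
  b \is a GRing.unit -> a = Q * b -> exists y, a ^ z - b ^ z = y * (Q - 1).
Proof.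
move=> uQ ub ->; have [y e] := dvd_exprz z uQ; exists (y * b ^ z).
rewrite exprzMl // mulrAC -e mulrBl mul1r.
by [].
Qed.

Lemma dvd_psum (r : nat) N p (la : mpart r) P j (d : K)
    (F1 F2 : 'I_r -> nat -> K) :
  (forall a s, exists y, F1 a s = y * d) -> (forall a s, exists y, F2 a s = y * d) ->
  exists y, psum N p la P j F1 F2 = y * d.
Proof.
move=> e1 e2; pose Q (x : K) := exists y, x = y * d.
have Q0 : Q 0 by exists 0; rewrite mul0r.
have QD x y : Q x -> Q y -> Q (x + y).
  by move=> [x' ->] [y' ->]; exists (x' + y'); rewrite mulrDl.
have Qs (F : 'I_r -> nat -> K) M (S : 'I_r -> pred nat) : (forall a s, Q (F a s)) ->
    Q (\sum_(a < r) \sum_(1 <= s < M | S a s) F a s).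
  by move=> QF; elim/big_ind: _ => // a _; elim/big_ind: _.
exact: QD (Qs _ _ (fun a s => P a s && (content p la a s == j %[mod N%:Z])%Z) e1)
  (Qs _ _ (fun a s => P a s && (content p la a s == j + 1 %[mod N%:Z])%Z) e2).
Qed.

End GenericPsi.

Lemma psum_mod (r : nat) (V : zmodType) m p (la : mpart r) P j
    (F1 F2 : 'I_r -> nat -> V) :
  psum m (fun a => p a %% m)%N la P j F1 F2 = psum m p la P j F1 F2.
Proof.
rewrite /psum; congr (_ + _); apply: eq_bigr => a _; apply: eq_bigl => s;
  by rewrite (@content_mod m r p).
Qed.

(** [Exp x - 1] is [x] times the value of a series with constant term 1, which is non-zero in the
    domain [hseries]. *)
Lemma Exp_eq1 (RR : realType) (x : hseries RR) : mpower 1 x -> Exp x = 1 -> x = 0.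
Proof.
move=> x1; pose F : fps RR[i] := FPS (fun t => t.+1`!%:R^-1).
have -> : Exp x = 1 + x * ev F x.
  have e : eser RR = 1 + fvar RR[i] * F.
    apply: fpsP => -[|t]; rewrite fcoefD fcoefXM /=; first by rewrite invr1 addr0.
    by rewrite mulr0n add0r.
  rewrite /Exp e; apply: etrans (evD x1 _ _) _; apply: congr2.
    by apply: etrans (ev_const x1 1) _; apply: (rmorph1 (@hsC RR)).
  by apply: etrans (evM x1 _ _) _; apply: congr2 => //; apply: ev_var.
move=> e; have {}e : x * ev F x = 0.
  by apply: (addrI (1 : hseries RR)); rewrite e addr0.
apply/eqP; move/eqP: e; rewrite mulf_eq0 => /orP[//|/eqP F0].
have : mpower 1 (ev (F - 1) x).
  by apply: ev_mpower => //; rewrite fcoefB fcoef1 -[fcoef F 0]/(1%:R^-1) invr1 subrr.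
have -> : ev (F - 1) x = - 1.
  apply: etrans (evB x1 _ _) _; rewrite F0 add0r; congr (- _).
  by apply: etrans (ev_const x1 1) _; apply: (rmorph1 (@hsC RR)).
move=> /(_ 0%N 0%N isT) /= /eqP; rewrite !mulr1n oppr_eq0.
by rewrite oner_eq0.
Qed.

Section ExpCharacterization.
Variable K : idomainType.
Hypothesis natU : forall t, (t.+1%:R : K) \is a GRing.unit.

(** By [logd_unique], both sides are determined by constant term and logarithmic derivative. This
    turns the series equations of [tor_h_spec] into one equation per coefficient. *)
Lemma exp_char (f : fps K) (L g : nat -> K) c : logd (FPS L) f -> fcoef f 0 != 0 ->
  f = fconst c * pexp (FPS (fun i => if i is _.+1 then g i else 0)) <->
  fcoef f 0 = c /\ forall i, g i.+1 *+ i.+1 = L i.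
Proof.
move=> Lf f0; set G := FPS _; have G0 : fcoef G 0 = 0 by [].
have LG := logdC c (logd_pexp natU G0).
have cG : fcoef (fconst c * pexp G) 0 = c by rewrite fcoefCM pexp0 mulr1.
split=> [e|[fc gL]].
  split=> [|i]; first by rewrite e cG.
  rewrite -e in LG; have nz : f != 0 by apply: contraNneq f0 => ->.
  have : fderiv G = FPS L.
    by apply: (mulIf nz); rewrite -[LHS]LG; exact: Lf.
  by move=> /(congr1 (fun h => fcoef h i)).
apply: (logd_unique natU Lf); last by rewrite cG.
have <- : fderiv G = FPS L by apply: fpsP => i; rewrite -[RHS]gL.
exact: LG.
Qed.

Lemma fcoef0_pprod (r : nat) N p (la : mpart r) P j (F1 F2 : 'I_r -> nat -> fps K) :
  fcoef (pprod N p la P j F1 F2) 0 =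
  pprod N p la P j (fun a s => fcoef (F1 a s) 0) (fun a s => fcoef (F2 a s) 0).
Proof.
have fm : {morph (fun f : fps K => fcoef f 0) : x y / x * y >-> x * y}.
  exact: fcoefM0.
have f1 : fcoef (1 : fps K) 0 = 1 by rewrite fcoef1.
rewrite /pprod fcoefM0; congr (_ * _);
  by rewrite (big_morph _ fm f1); apply: eq_bigr => a _; apply: (big_morph _ fm f1).
Qed.

End ExpCharacterization.

Lemma Exp_psum (RR : realType) (r : nat) N p (la : mpart r) P j
    (F1 F2 : 'I_r -> nat -> hseries RR) :
  (forall a s, mpower 1 (F1 a s)) -> (forall a s, mpower 1 (F2 a s)) ->
  hemb (Exp (psum N p la P j F1 F2)) =
  pprod N p la P j (fun a s => hemb (Exp (F1 a s))) (fun a s => hemb (Exp (F2 a s))).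
Proof.
move=> m1 m2; rewrite psum_rowsum pprod_rowprod Exp_rowsum; last first.
- by move=> a s; case: ifP => _; [apply: m2|apply: mpower_0].
- by move=> a s; case: ifP => _; [apply: m1|apply: mpower_0].
rewrite (rmorph_rowprod (@hemb RR)).
have e (b : bool) (x : hseries RR) :
    hemb (Exp (if b then x else 0)) = if b then hemb (Exp x) else 1.
  case: b => //; rewrite Exp0; exact: (rmorph1 (@hemb RR)).
by apply: eq_rowprod => a s _ _; apply: e.
Qed.

(** * Eigenvalues of the toroidal Cartan generators *)

Section ToroidalCartan.
Variables (RR : realType) (m n : nat) (k : int) (r : nat).
Hypotheses (m_gt0 : (0 < m)%N) (n_gt0 : (0 < n)%N) (kn : coprimez k n%:Z).
Local Notation C := (RR[i]).
Local Notation A := (hseries RR).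
Local Notation R := (hloc RR).
Local Notation N := (m * n)%N.
Local Notation w := (omega RR m n k).
Local Notation a1 := (h1A RR m n).
Local Notation a2 := (h2A RR m n).
Local Notation a3 := (h3A RR m n).
Local Notation wexp := (wexp m n k).
Local Notation hn := (half_n RR n).
Local Notation q := (qq RR m).
Variables (p : 'I_r -> nat) (v : 'I_r -> A).
Hypothesis v_mpower : forall a, mpower 1 (v a).
Let p' a := (p a %% m)%N.
Let u' a : R := hcst (w ^- p a) * hexp (n%:R * hemb (v a)).
Local Notation kpos := (row_pos m n v).
Local Notation kcont := (row_cont p).
Local Notation dsum := (dsum m n p v).
Local Notation tt := (fun _ _ => true).
Implicit Types (la : mpart r) (a : 'I_r) (s : nat) (j z : int).

(** Poles [al] and zeros [be] of the factors of psi, as functions of z. They are the images of the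
    poles and zeros of the factors of xi under [y -> w^d exp (n y)]. *)
Let al1 la a s : R := hemb (wexp (- kcont la a s) (kpos la a s - a1)).
Let be1 la a s : R := hemb (wexp (- kcont la a s) (kpos la a s + a3)).
Let al2 la a s : R := hemb (wexp (1 - kcont la a s) (kpos la a s)).
Let be2 la a s : R := hemb (wexp (1 - kcont la a s) (kpos la a s + a2)).

Let x1 la a s : mpower 1 (kpos la a s). Proof. exact: kpos_mpower. Qed.
Let a1m : mpower 1 a1. Proof. exact: a1_mpower. Qed.
Let a2m : mpower 1 a2. Proof. exact: a2_mpower. Qed.
Let a3m : mpower 1 a3. Proof. exact: a3_mpower. Qed.

Let q2E : q * q = hemb (wexp 0 a2).
Proof.
have h := hn_mpower n a2m.
have e := qqE RR m_gt0 n_gt0.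
apply: etrans (congr2 (fun x y => x * y) e e) _.
apply: etrans (hembM _ _) _; apply: (congr1 (@hemb RR)).
apply: etrans (esym (ExpD h h)) _.
apply: etrans (congr1 (@Exp RR) (hnE n a2)) _.
apply: esym; apply: etrans (congr1 (fun c => hsC c * _) (expr0z w)) _.
apply: etrans (congr1 (fun x => x * _) (rmorph1 (@hsC RR))) _.
exact: mul1r.
Qed.

Let q_unit : q \is a GRing.unit.
Proof.
have h := ExpN (hn_mpower n a2m).
rewrite (qqE RR m_gt0 n_gt0).
exact: hemb_unit h.
Qed.

Let q2VE : q^-1 * q^-1 = hemb (wexp 0 (- a2)).
Proof.
apply: etrans (esym (invrM q_unit q_unit)) _.
apply: etrans (congr1 (fun x => x^-1) q2E) _.
apply: etrans (hemb_wexpV m n k 0 a2m) _.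
exact: (congr1 (fun d => hemb (wexp d (- a2))) (oppr0 _)).
Qed.

Let mul_wexp (d d' d'' : int) (y y' y'' : A) : mpower 1 y -> mpower 1 y' ->
  d + d' = d'' -> y + y' = y'' ->
  hemb (wexp d y) * hemb (wexp d' y') = hemb (wexp d'' y'').
Proof.
move=> m1 m2 <- <-; apply: etrans (hembM _ _) _; apply: (congr1 (@hemb RR)).
exact: wexpD.
Qed.

Let al1E la a s : (0 < s)%N -> chi m n k u' la a s / q1 RR m n k = al1 la a s.
Proof.
move=> s0; rewrite (chiE m_gt0 n_gt0 kn p v_mpower la a s0) (q1E RR k m_gt0 n_gt0).
rewrite (hemb_wexpV m n k 1 a1m).
apply: (mul_wexp (x1 la a s) (mpowerN a1m)); last exact: erefl.
by ring.
Qed.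

Let al2E la a s : (0 < s)%N -> chi m n k u' la a s = al2 la a s.
Proof. exact: (chiE m_gt0 n_gt0 kn p v_mpower). Qed.

Let be1E la a s : q^-1 * q^-1 * al1 la a s = be1 la a s.
Proof.
apply: etrans (congr1 (fun x => x * _) q2VE) _.
apply: (mul_wexp (mpowerN a2m) (mpowerB (x1 la a s) a1m) (add0r _)).
have gen (T : comNzRingType) (x y z : T) : - y + (x - z) = x + (- z - y) by ring.
exact: gen.
Qed.

Let be2E la a s : q * q * al2 la a s = be2 la a s.
Proof.
apply: etrans (congr1 (fun x => x * _) q2E) _.
exact: (mul_wexp a2m (x1 la a s) (add0r _) (addrC _ _)).
Qed.

Let al1_unit la a s : al1 la a s \is a GRing.unit.
Proof. exact: hemb_wexp_unit (mpowerB (x1 la a s) a1m). Qed.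
Let be1_unit la a s : be1 la a s \is a GRing.unit.
Proof. exact: hemb_wexp_unit (mpowerD (x1 la a s) a3m). Qed.
Let al2_unit la a s : al2 la a s \is a GRing.unit.
Proof. exact: hemb_wexp_unit (x1 la a s). Qed.
Let inv_gen (K : comUnitRingType) (x y a b : K) : x * y = 1 ->
  a \is a GRing.unit -> x * x * a = b -> y * y * a^-1 = b^-1.
Proof.
move=> xy ua <-; have yx : y * x = 1 by rewrite mulrC.
have ux : x \is a GRing.unit by apply/unitrP; exists y.
have -> : y = x^-1 by rewrite -[LHS]mul1r -(mulVr ux) -mulrA xy mulr1.
by rewrite invrM ?unitrM ?ux // invrM // mulrC.
Qed.

(* Coefficients of the logarithmic derivatives of psi^+ (for e = 1) and psi^-
   (for e = -1). *)
Definition psiL la j (e : int) i : R := psum m p' la tt j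
  (fun a s => al1 la a s ^ (e * i.+1%:Z) - be1 la a s ^ (e * i.+1%:Z))
  (fun a s => al2 la a s ^ (e * i.+1%:Z) - be2 la a s ^ (e * i.+1%:Z)).

Let qV : q * q^-1 = 1. Proof. exact: mulrV. Qed.
Let Vq : q^-1 * q = 1. Proof. exact: mulVr. Qed.

Lemma logd_plus la j : logd (FPS (psiL la j 1)) (psi_plus m n k p' u' la j).
Proof.
have h := logd_pprod m p' la tt j
  (fun a s => logd_psi (chi m n k u' la a s / q1 RR m n k) qV)
  (fun a s => logd_psi ((chi m n k u' la a s)^-1)^-1 Vq).
apply: etrans h _; apply: (congr1 (fun f => f * _)); apply: fpsP => i.
apply: etrans (fcoef_psum _ _ _ _ _ _ _ _) _.
apply: eq_psum => a s s0 _ _; rewrite [LHS]/= mul1r.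
  by rewrite (al1E la a s0) be1E.
by rewrite invrK (al2E la a s0) be2E.
Qed.

Lemma logd_minus la j : logd (FPS (psiL la j (- 1))) (psi_minus m n k p' u' la j).
Proof.
have h := logd_pprod m p' la tt j
  (fun a s => logd_psi (chi m n k u' la a s / q1 RR m n k)^-1 Vq)
  (fun a s => logd_psi (chi m n k u' la a s)^-1 qV).
apply: etrans h _; apply: (congr1 (fun f => f * _)); apply: fpsP => i.
apply: etrans (fcoef_psum _ _ _ _ _ _ _ _) _.
have powV (x : R) : x ^ (- 1 * i.+1%:Z) = x^-1 ^+ i.+1 by rewrite mulN1r exprVn exprnN.
apply: eq_psum => a s s0 _ _.
  have e := congr1 (fun x => x^-1) (al1E la a s0).
  have e' := etrans (congr1 (fun x => q * q * x) e)
    (inv_gen Vq (al1_unit la a s) (be1E la a s)).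
  apply: etrans _ (esym (congr2 (fun x y => x - y) (powV _) (powV _))).
  by rewrite [LHS]/= e' e.
have e := congr1 (fun x => x^-1) (al2E la a s0).
have e' := etrans (congr1 (fun x => q^-1 * q^-1 * x) e)
  (inv_gen qV (al2_unit la a s) (be2E la a s)).
apply: etrans _ (esym (congr2 (fun x y => x - y) (powV _) (powV _))).
by rewrite [LHS]/= e' e.
Qed.

(** For [z <> 0] this is, by [Bval_spec], the eigenvalue of [z (q - q^-1)] times the image of
    h_{j,z} under Phi. *)
Definition hval la (j : nat) (z : int) : A :=
  \sum_(i < N | (i == j %[mod m])%N)
    hsC (w ^ (- z * i%:Z)) * dsum la i (fun y => Exp (hsC (z%:~R * n%:R) * y)).

Let omega_period (d d' : int) : (N%:Z %| d' - d)%Z -> w ^ d = w ^ d'.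
Proof.
move=> hd; have ed : d' = d + (d' - d) by ring.
by rewrite [in RHS]ed expfzDr ?omega_neq0 // (omegaN RR k m_gt0 n_gt0 hd) mulr1.
Qed.

Let wexp_term (d z : int) (i : nat) (y : A) : (N%:Z %| d + i%:Z)%Z ->
  hsC (w ^ (- z * i%:Z)) * Exp (hsC (z%:~R * n%:R) * y) =
  wexp (d * z) (z%:~R * y).
Proof.
move=> hd; apply: congr2; apply: congr1.
  apply: omega_period; have -> : d * z - - z * i%:Z = (d + i%:Z) * z by ring.
  exact: dvdz_mulr.
rewrite (rmorphM (@hsC RR)) (rmorph_int (@hsC RR)) (rmorph_nat (@hsC RR)).
have gen (T : comNzRingType) (a b' c : T) : a * b' * c = b' * (a * c) by ring.
exact: gen.
Qed.

Lemma hemb_hval la (j : nat) z : hemb (hval la j z) = psum m p' la tt j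
  (fun a s => al1 la a s ^ z - be1 la a s ^ z)
  (fun a s => al2 la a s ^ z - be2 la a s ^ z).
Proof.
have mN : (m %| N)%N by apply: dvdn_mulr.
have N_gt0 : (0 < N)%N by rewrite muln_gt0 m_gt0.
pose W (d : int) (y : A) := wexp (d * z) (z%:~R * y).
pose G1 a s := W (- kcont la a s) (kpos la a s - a1) -
  W (- kcont la a s) (kpos la a s + a3).
pose G2 a s := W (1 - kcont la a s) (kpos la a s) -
  W (1 - kcont la a s) (kpos la a s + a2).
have -> : hval la j z = psum m p la tt j G1 G2.
  rewrite -(@psum_fibre m N N_gt0 mN r A p la tt j
    (fun i a s =>
      hsC (w ^ (- z * i%:Z)) * Exp (hsC (z%:~R * n%:R) * (kpos la a s - a1)) -
      hsC (w ^ (- z * i%:Z)) * Exp (hsC (z%:~R * n%:R) * (kpos la a s + a3)))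
    (fun i a s =>
      hsC (w ^ (- z * i%:Z)) * Exp (hsC (z%:~R * n%:R) * kpos la a s) -
      hsC (w ^ (- z * i%:Z)) * Exp (hsC (z%:~R * n%:R) * (kpos la a s + a2)))
    G1 G2).
  - by apply: eq_bigr => i _; rewrite -dsumZ.
  - move=> i a s _ s0 hc; have hd : (N%:Z %| - kcont la a s + i%:Z)%Z.
      by rewrite addrC -dvdz_oppr opprB -eqz_mod_dvd.
    rewrite /G1 /W -(wexp_term z (kpos la a s - a1) hd).
    by rewrite -(wexp_term z (kpos la a s + a3) hd).
  - move=> i a s _ s0 hc; have hd : (N%:Z %| 1 - kcont la a s + i%:Z)%Z.
      by rewrite addrAC [1 + _]addrC -dvdz_oppr opprB -eqz_mod_dvd.
    rewrite /G2 /W -(wexp_term z (kpos la a s) hd).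
    by rewrite -(wexp_term z (kpos la a s + a2) hd).
rewrite (raddf_psum (@hemb RR)) psum_mod.
have e (d : int) (y y' : A) : mpower 1 y -> mpower 1 y' ->
    hemb (W d y - W d y') = hemb (wexp d y) ^ z - hemb (wexp d y') ^ z.
  move=> y1 y1'; apply: etrans (rmorphB (@hemb RR) _ _) _.
  apply: esym; apply: (congr2 (fun x y => x - y)).
    exact: hemb_wexpXz.
  exact: hemb_wexpXz.
apply: eq_psum => a s s0 _ _; apply: e.
- exact: mpowerB (x1 la a s) a1m.
- exact: mpowerD (x1 la a s) a3m.
- exact: x1.
- exact: mpowerD (x1 la a s) a2m.
Qed.

(** The exponent of [q] in the constant term of psi^+, hence the integer by which h_{j,0} acts. The
    infinite products reduce to finite ones, so this is a difference of two finite row counts. *)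
Definition hcount la j : int := psum m p' la tt j (fun _ _ => 1) (fun _ _ => -1).

Let pprod_const la j (y : A) : mpower 1 y ->
  pprod m p' la tt j (fun _ _ => hemb (Exp y)) (fun _ _ => hemb (Exp (- y))) =
  hemb (Exp (y *~ hcount la j)).
Proof.
move=> y1; rewrite -(Exp_psum m p' la tt j (F1 := fun _ _ => y) (F2 := fun _ _ => - y)).
- by rewrite /hcount (raddf_psum ( *~%R y)).
- by [].
- by move=> _ _; apply: mpowerN.
Qed.

Let psi_gen0 (K : comNzRingType) (x b c : K) :
  fcoef ((fconst x - fconst b * fvar K) * fgeom c) 0 = x.
Proof. by rewrite fcoefM0 fcoefB fcoefCM /= mulr0 subr0 mulr1n mulr1. Qed.

Let hn2 : mpower 1 (hn * a2). Proof. by have h := hn_mpower n a2m; apply: h. Qed.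

Lemma psi_plus0 la j : fcoef (psi_plus m n k p' u' la j) 0 =
  hemb (Exp ((hn * a2) *~ hcount la j)).
Proof.
apply: etrans (fcoef0_pprod _ _ _ _ _ _ _) _.
apply: etrans _ (pprod_const la j hn2).
by apply: (congr2 (pprod m p' la tt j)); apply/funext => a; apply/funext => s;
  apply: etrans (psi_gen0 _ _ _) _; [apply: qqE|apply: qqV].
Qed.

Lemma psi_minus0 la j : fcoef (psi_minus m n k p' u' la j) 0 =
  hemb (Exp (- ((hn * a2) *~ hcount la j))).
Proof.
apply: etrans (fcoef0_pprod _ _ _ _ _ _ _) _.
rewrite -mulNrz; apply: etrans _ (pprod_const la j (mpowerN hn2)).
apply: (congr2 (pprod m p' la tt j)); apply/funext => a; apply/funext => s;
  apply: etrans (psi_gen0 _ _ _) _.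
  exact: qqV.
by rewrite opprK; apply: qqE.
Qed.

Let count_mpower z : mpower 1 ((hn * a2) *~ z).
Proof.
case: z => t; first exact: mpowerMn hn2.
by rewrite NegzE mulrNz; apply/mpowerN/mpowerMn.
Qed.

Let hexp_count z : hexp (hb2 RR / (2 * m)%:R * z%:~R) = hemb (Exp ((hn * a2) *~ z)).
Proof.
rewrite -(hexp_hemb (count_mpower z)); congr hexp.
rewrite (hb2_half RR m_gt0 n_gt0) mulrzr.
exact: (esym (raddfMz (@hemb RR) _ _)).
Qed.

Let hexp_countN z :
  hexp (- (hb2 RR / (2 * m)%:R * z%:~R)) = hemb (Exp (- ((hn * a2) *~ z))).
Proof. by rewrite -mulrN -mulrNz -mulrNz; apply: hexp_count. Qed.

(** [q] is not a root of unity, so that the constant term of psi^+ determines the integer by which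
    h_{j,0} acts. *)
Let count_inj z z' : hemb (Exp ((hn * a2) *~ z)) = hemb (Exp ((hn * a2) *~ z')) ->
  z = z'.
Proof.
move=> /(@hemb_inj RR) e.
have nz : (n%:R / 2%:R : C) != 0.
  apply: mulf_neq0; last by rewrite invr_eq0; apply: natC_neq0.
  by rewrite -(prednK n_gt0); apply: natC_neq0.
have e1 : Exp ((hn * a2) *~ (z - z')) = 1.
  rewrite mulrzBr; apply: etrans (ExpD (count_mpower z) (mpowerN (count_mpower z'))) _.
  by rewrite e; apply: ExpN.
have := Exp_eq1 (count_mpower _) e1; rewrite -mulrzr => /eqP.
rewrite 2!mulf_eq0; have -> : (hn == 0) = false.
  by apply: negbTE; rewrite -(rmorph0 (@hsC RR)) (inj_eq (@hsC_inj RR)).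
rewrite (negPf (a2_neq0 RR m_gt0 n_gt0)) /=.
rewrite -(rmorph_int (@hsC RR)) -(rmorph0 (@hsC RR)) (inj_eq (@hsC_inj RR)).
by rewrite intr_eq0 subr_eq0 => /eqP.
Qed.

Let Exp_unit0 (y : A) : mpower 1 y -> hemb (Exp y) != 0.
Proof. by move=> y1; rewrite hemb_neq0; apply: Exp_neq0. Qed.

Lemma tor_h_specP la (j : nat) (h : int -> R) :
  tor_h_spec m n k p' u' la j h <->
  h 0 = (hcount la j)%:~R /\
  forall z, z != 0 -> z%:~R * ((q - q^-1) * h z) = hemb (hval la j z).
Proof.
have cm := count_mpower (hcount la j).
have nzp : fcoef (psi_plus m n k p' u' la j) 0 != 0.
  by rewrite psi_plus0; apply: Exp_unit0.
have nzm : fcoef (psi_minus m n k p' u' la j) 0 != 0.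
  by rewrite psi_minus0; apply/Exp_unit0/mpowerN.
have Pp c := exp_char (natR_unit RR) (fun i => (q - q^-1) * h i%:Z) c
  (logd_plus la j) nzp.
have Pm c := exp_char (natR_unit RR) (fun i => - ((q - q^-1) * h (- i%:Z))) c
  (logd_minus la j) nzm.
have Lp i : psiL la j 1 i = hemb (hval la j i.+1).
  by apply: esym; apply: etrans (hemb_hval la j _) _; rewrite /psiL mul1r.
have Lm i : psiL la j (- 1) i = hemb (hval la j (- i.+1%:Z)).
  by apply: esym; apply: etrans (hemb_hval la j _) _; rewrite /psiL mulN1r.
split.
  case=> [[z hz] ep em]; have [cp gp] := (Pp _).1 ep; have [_ gm] := (Pm _).1 em.
  have ez : z = hcount la j.
    apply: count_inj; apply: etrans (esym (hexp_count z)) _.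
    apply: etrans (congr1 (fun x => hexp (_ * x)) (esym hz)) _.
    exact: etrans (esym cp) (psi_plus0 la j).
  split=> [|[[|t]|t] // _]; first by rewrite hz ez.
    by rewrite -Lp -gp -mulr_natl.
  by rewrite NegzE -Lm -gm mulrNz -mulr_natl mulNr mulrN.
case=> h0 hz; split; first by exists (hcount la j).
  apply: (Pp _).2; split; first by rewrite h0 hexp_count; apply: psi_plus0.
  by move=> i; rewrite Lp -hz // -mulr_natl.
apply: (Pm _).2; split; first by rewrite h0 hexp_countN; apply: psi_minus0.
by move=> i; rewrite Lm -hz ?oppr_eq0 // mulrNz -mulr_natl mulNr mulrN.
Qed.

(** In each pair, [al] and [be] differ by a factor [q * q], so [q * q - 1] divides the difference of
    their powers; it equals [q - q^-1] up to the unit [q]. *)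
Lemma tor_h_exists la (j : nat) : exists h, tor_h_spec m n k p' u' la j h.
Proof.
have step (z : int) : exists x : R,
    z != 0 -> z%:~R * ((q - q^-1) * x) = hemb (hval la j z).
  have [->|z0] := eqVneq z 0; first by exists 0.
  have uz : (z%:~R : R) \is a GRing.unit.
    by case: z z0 => [[|t]|t] // _; rewrite ?NegzE ?mulrNz ?unitrN; apply: natR_unit.
  have uq2 : q * q \is a GRing.unit by rewrite unitrM q_unit.
  have uq2V : q^-1 * q^-1 \is a GRing.unit by rewrite unitrM unitrV q_unit.
  have gen (K : comUnitRingType) (x y y' b : K) : x \is a GRing.unit -> y = x * y' ->
      exists t, y * b = t * (x * (y' * b)).
    by move=> ux ->; exists 1; rewrite mul1r mulrA.
  have d1 a s : exists y, al1 la a s ^ z - be1 la a s ^ z = y * (q * q - 1).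
    have e : al1 la a s = (q * q) * be1 la a s.
      rewrite -be1E; have g (K : comUnitRingType) (x y c : K) : x * y = 1 ->
        c = x * x * (y * y * c) by move=> xy; rewrite -mulrA [x * (y * y * c)]mulrA [x * (y * y)]mulrA xy mul1r mulrA xy mul1r.
      exact: g.
    exact: (dvd_exprzB z uq2 (be1_unit la a s) e).
  have d2 a s : exists y, al2 la a s ^ z - be2 la a s ^ z = y * (q * q - 1).
    have [y e] := dvd_exprzB z uq2 (al2_unit la a s) (esym (be2E la a s)).
    by exists (- y); rewrite mulNr -e opprB.
  have [y e] := dvd_psum m p' la tt j d1 d2.
  rewrite (hemb_hval la j z) e; exists (z%:~R^-1 * (y * q)).
  have g (K : comUnitRingType) (x t c c' : K) : t \is a GRing.unit -> c * c' = 1 ->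
      t * ((c - c') * (t^-1 * (x * c))) = x * (c * c - 1).
    by move=> ut cc; rewrite mulrCA mulVKr // mulrCA mulrBl [c' * c]mulrC cc.
  by move=> _; exact: g uz qV.
have [h hP] := boolp.choice step.
exists (fun z => if z == 0 then (hcount la j)%:~R else h z).
by apply/tor_h_specP; split=> [|z z0]; rewrite ?eqxx // (negPf z0) hP.
Qed.

Lemma tor_h_eigenP la (j : nat) :
  tor_h_eigen m n k p' u' la j 0 = (hcount la j)%:~R /\
  forall z, z != 0 ->
    z%:~R * ((q - q^-1) * tor_h_eigen m n k p' u' la j z) = hemb (hval la j z).
Proof.
apply/tor_h_specP; rewrite /tor_h_eigen; case: xgetP => [h _ //|no].
by have [h hP] := tor_h_exists la j; case: (no h).
Qed.

Lemma qq_sub_neq0 : q - q^-1 != 0.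
Proof.
apply/eqP => e0; have e : q = q^-1 := subr0_eq e0.
rewrite (qqV RR m_gt0 n_gt0) (qqE RR m_gt0 n_gt0) in e.
have := @count_inj 1 (- 1); rewrite mulrNz => /(_ e).
by [].
Qed.

End ToroidalCartan.

Lemma scale_fock_inj (RR : realType) (r : nat) (d : hloc RR) : d != 0 ->
  injective (fun T : fock_endo RR r => d *: T).
Proof.
move=> d0 S T e; apply: ap_eq => la.
have := congr1 (fun U => ap U (kt RR la)) e; rewrite 2!apZl => e'.
apply: fockP => mu; apply: (mulfI d0).
by rewrite -2!fcoeffZ e'.
Qed.

Lemma exdivZ_unique (RR : realType) (r : nat) (x T : fock_endo RR r) (d : hloc RR) :
  d != 0 -> d *: T = x -> exdivZ x d = T.
Proof.
move=> d0 e; rewrite /exdivZ; case: xgetP => [S _ eS|no]; last by case: (no T).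
by apply: (scale_fock_inj d0); rewrite [LHS]eS.
Qed.

(** * Intertwining of the Cartan generators *)

Section IntertwineCartan.
Variables (RR : realType) (m n : nat) (k : int) (r : nat).
Hypotheses (m_gt0 : (0 < m)%N) (n_gt0 : (0 < n)%N) (kn : coprimez k n%:Z).
Local Notation A := (hseries RR).
Local Notation R := (hloc RR).
Local Notation N := (m * n)%N.
Local Notation w := (omega RR m n k).
Local Notation a2 := (h2A RR m n).
Variables (p : 'I_r -> nat) (v : 'I_r -> A).
Hypothesis v_mpower : forall a, mpower 1 (v a).
Let p' a := (p a %% m)%N.
Let u' a : R := hcst (w ^- p a) * hexp (n%:R * hemb (v a)).
Let vy a : R := hemb (v a).
Let xi := yang_xi m n p vy.
Local Notation dsum := (dsum m n p v).
Implicit Types (la : mpart r).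
Local Notation Ph := (Phi m n k (yang_xp m n p vy) (yang_xm m n p vy) xi).

(** The pairs have differences [(x - a1) - (x + a3) = a2] and [x - (x + a2) = - a2], so the first
    power sums merely count rows. *)
Lemma sum_dsum_id la (j : nat) :
  \sum_(i < N | (i == j %[mod m])%N) dsum la i (fun y => y ^+ 1) =
  a2 *~ hcount m p la j.
Proof.
have mN : (m %| N)%N by apply: dvdn_mulr.
have N_gt0 : (0 < N)%N by rewrite muln_gt0 m_gt0.
rewrite /hcount (raddf_psum ( *~%R a2)) psum_mod.
apply: (@psum_fibre m N N_gt0 mN r A p la) => i a s _ _ _.
  have gen (T : comNzRingType) (x y z : T) : x - y - (x + (- y - z)) = z by ring.
  exact: gen.
have gen (T : comNzRingType) (x y : T) : x - (x + y) = - y by ring.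
exact: gen.
Qed.

Lemma xi_coef1 la (j : int) :
  fcoef (xi_series m n p vy la j) 1 = hemb (dsum la j (fun y => y ^+ 1)).
Proof.
have := congr1 (fun f => fcoef f 0) (logd_xi p v m_gt0 n_gt0 la j).
rewrite fcoef_deriv mulr1n => ->.
apply: etrans (fcoefM0 _ _) _; rewrite [fcoef (FPS _) 0]/=.
apply: etrans (congr1 (fun x => _ * x) (xi_series0 p v m_gt0 n_gt0 la j)) _.
exact: mulr1.
Qed.

Lemma Phi_h (i0 : 'I_m) (l : int) :
  Ph (Gen_h i0 l) = dg (fun la => tor_h_eigen m n k p' u' la i0 l).
Proof.
have eig la := tor_h_eigenP m_gt0 n_gt0 kn p v_mpower la i0.
rewrite /Phi; case: ifP => [/eqP->|/negbT l0].
  have eX (i : 'I_N) : xi i 0 = dg (fun la =>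
      exdiv (fcoef (xi_series m n p vy la i) 1) (h2 RR m n)) := yang_xi_dg p v i 0.
  under eq_bigr do rewrite eX.
  rewrite dg_sum; congr dg; apply/funext => la; rewrite (eig la).1.
  have h20 := h2_neq0 RR m_gt0 n_gt0.
  (* Multiplication by [h2] undoes the exact division in [yang_xi]. *)
  apply: (mulfI h20); rewrite mulr_sumr.
  transitivity (\sum_(i < N | (i == i0 %[mod m])%N) hemb (dsum la i (fun y => y ^+ 1))).
    apply: eq_bigr => i _; apply: etrans (xi_seriesS p v m_gt0 n_gt0 _ _ _) _.
    exact: xi_coef1.
  apply: etrans (esym (rmorph_sum (@hemb RR) _ _ _)) _.
  apply: etrans (congr1 (@hemb RR) (sum_dsum_id la i0)) _.
  rewrite (h2E RR m_gt0 n_gt0) mulrzr; exact: (raddfMz (@hemb RR)).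
apply: exdivZ_unique; first exact: (qq_sub_neq0 RR m_gt0 n_gt0).
pose W : A := hsC (l%:~R * n%:R).
have eW : l%:~R * n%:R = hemb W.
  rewrite /W (rmorphM (@hsC RR)) (rmorphM (@hemb RR)).
  rewrite (rmorph_nat (@hsC RR)) (rmorph_nat (@hemb RR)).
  by rewrite (rmorph_int (@hsC RR)) (rmorph_int (@hemb RR)).
have eB (i : 'I_N) : hcst (w ^ (- l * i%:Z)) *: Bser xi i (l%:~R * n%:R) =
    dg (fun la => hcst (w ^ (- l * i%:Z)) * hemb (Bval p v la i W)).
  by rewrite eW (Bser_dg m_gt0 n_gt0 p v_mpower) dgZ.
under eq_bigr do rewrite eB.
rewrite dg_sum dgZ dgZ; congr dg; apply/funext => la.
have lR : (l%:~R : R) != 0.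
  rewrite -(rmorph_int (@hemb RR)) hemb_neq0 -(rmorph_int (@hsC RR)).
  rewrite -(rmorph0 (@hsC RR)) (inj_eq (@hsC_inj RR)) intr_eq0.
  exact: l0.
apply: (mulfI lR); apply: etrans ((eig la).2 _ l0) _.
rewrite mulrA eW mulr_sumr; apply: etrans (rmorph_sum (@hemb RR) _ _ _) _.
apply: eq_bigr => i _; rewrite -(Bval_spec p v_mpower).
have gen (T : comNzRingType) (x y z : T) : x * (y * z) = y * (x * z) by ring.
apply: etrans _ (gen _ _ _ _); apply: etrans (esym (hembM _ _)) _.
exact: (congr1 (fun x => hcst _ * x) (esym (hembM _ _))).
Qed.

Lemma tor_h_dg (i : 'I_m) (l : int) : tor_h n k p' u' i l =
  dg (fun la => tor_h_eigen m n k p' u' la i l).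
Proof. by rewrite dgE. Qed.

Lemma intertwine_h (d : mpart r -> R) (i : 'I_m) (l : int) :
  dg d * tor_h n k p' u' i l = Ph (Gen_h i l) * dg d.
Proof.
rewrite Phi_h tor_h_dg 2!dgM; congr dg; apply/funext => la; exact: mulrC.
Qed.

End IntertwineCartan.

(** * Uniqueness *)

Lemma boxsum_coef (RR : realType) (r : nat) (c : mpart r -> 'I_r -> nat -> hloc RR)
    (la : mpart r) (b : 'I_r) (l : nat) : addable la b l ->
  (boxsum (fun mu a => index_iota 1 (size (mu a)).+2) (@addable r) (@add_box r) c la)
    @_(add_box la b l) = c la b l.
Proof.
move=> al; rewrite /boxsum fcoeff_sum.
have term b' l' : addable la b' l' ->
    (c la b' l' *: kt RR (add_box la b' l'))@_(add_box la b l) =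
    if (b' == b) && (l' == l) then c la b l else 0.
  move=> al'; rewrite fcoeffZ fcoeff_kt; case: eqP => [e|ne].
    by case: (add_box_inj al' al e) => -> ->; rewrite !eqxx mulr1.
  rewrite mulr0; case: ifP => // /andP[/eqP eb /eqP el].
  by case: ne; rewrite eb el.
have inner b' : (\sum_(l' <- index_iota 1 (size (la b')).+2 | addable la b' l')
      c la b' l' *: kt RR (add_box la b' l'))@_(add_box la b l) =
    \sum_(l' <- index_iota 1 (size (la b')).+2 | addable la b' l')
      if (b' == b) && (l' == l) then c la b l else 0.
  by rewrite fcoeff_sum; apply: eq_bigr => l' al'; apply: term.
under eq_bigr do rewrite inner.
rewrite (bigD1 b) //= [X in _ + X]big1 ?addr0 => [|b' /negPf nb]; last first.
  by apply: big1 => l' _; rewrite nb.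
have lin : l \in index_iota 1 (size (la b)).+2.
  by rewrite mem_index_iota (addable_gt0 al) ltnS; apply: addable_size al.
rewrite big_mkcond (bigD1_seq l) ?iota_uniq //= al !eqxx [X in _ + X]big1 ?addr0 //.
by move=> l' /negPf->; rewrite andbF if_same.
Qed.

Lemma dg_bijective (RR : realType) (r : nat) (c : mpart r -> hloc RR) :
  (forall la, c la \is a GRing.unit) -> bijective (dg c : fock_endo RR r).
Proof.
move=> cU; have inv (d e : mpart r -> hloc RR) : (forall la, d la * e la = 1) ->
    cancel (dg e : fock_endo RR r) (dg d : fock_endo RR r).
  move=> de x; have : dg d * dg e = 1 :> fock_endo RR r.
    rewrite dgM (dg1 RR r); congr dg; apply/funext => la; exact: de.
  by move=> /(congr1 (fun T : fock_endo RR r => T x)).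
exists (dg (fun la => (c la)^-1)); apply: inv => la; first exact: mulVr.
exact: mulrV.
Qed.

Section Uniqueness.
Variables (RR : realType) (m n : nat) (k : int) (r : nat).
Hypotheses (m_gt0 : (0 < m)%N) (n_gt0 : (0 < n)%N) (kn : coprimez k n%:Z).
Local Notation A := (hseries RR).
Local Notation R := (hloc RR).
Local Notation N := (m * n)%N.
Local Notation w := (omega RR m n k).
Variables (p : 'I_r -> nat) (v : 'I_r -> A).
Hypothesis v_mpower : forall a, mpower 1 (v a).
Let p' a := (p a %% m)%N.
Let u' a : R := hcst (w ^- p a) * hexp (n%:R * hemb (v a)).
Let vy a : R := hemb (v a).
Let xi := yang_xi m n p vy.
Implicit Types (la : mpart r).
Local Notation Ph := (Phi m n k (yang_xp m n p vy) (yang_xm m n p vy) xi).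
Hypothesis tor_nr : tor_nonresonant m n k p' u'.
Hypothesis yang_nr : yang_nonresonant m n p vy.

(** The content of the box determines [i]. The toroidal coefficient is then the Yangian one,
    non-zero by [ynum_neq0], times an exponential. *)
Lemma tor_coef_neq0 la b l : addable la b l ->
  exists i : 'I_m, tor_coef m n k p' u' (@prec r) i 0 la b l != 0.
Proof.
move=> al; have N_gt0 : (0 < N)%N by rewrite muln_gt0 m_gt0.
have [i hi] := residue_exists m_gt0 (content p la b l - 1).
have [j hj] := residue_exists N_gt0 (content p la b l - 1).
have shift1 (d : int) (t : nat) : (content p la b l == t%:Z + 1 %[mod d])%Z =
    (content p la b l - 1 == t%:Z %[mod d])%Z.
  by rewrite !eqz_mod_dvd opprD addrA addrAC.
exists i; rewrite -shift1 in hi; rewrite -shift1 in hj.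
rewrite /tor_coef (@content_mod m r p) hi expr0z mulr1.
have [-> ny] := tor_yang_coef m_gt0 n_gt0 kn v_mpower (or_introl erefl)
  tor_nr yang_nr al hj hi.
apply: mulf_neq0; first exact: ny.
by rewrite hemb_neq0; apply/Exp_neq0/Sk_mpower.
Qed.

(** The coefficient at [la] plus a box of the relation for e_{i,0} expresses the constant there by
    the one at [la], with the same factors for [c] and [c']; for a suitable [i] the toroidal
    coefficient can be cancelled, and [mpart_ind] concludes. *)
Lemma intertwiner_unique (c c' : mpart r -> R) :
  c (mpart0 r) = c' (mpart0 r) ->
  (forall i : 'I_m, dg c * tor_e n k p' u' i 0 = Ph (Gen_e i 0) * dg c) ->
  (forall i : 'I_m, dg c' * tor_e n k p' u' i 0 = Ph (Gen_e i 0) * dg c') ->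
  c = c'.
Proof.
move=> c0 ce ce'; apply/funext; apply: mpart_ind => // la b l al IH.
have [i ti] := tor_coef_neq0 al.
have key d : dg d * tor_e n k p' u' i 0 = Ph (Gen_e i 0) * dg d ->
    d (add_box la b l) * tor_coef m n k p' u' (@prec r) i 0 la b l =
    d la * (tor_coef m n k p' u' (@prec r) i 0 la b l *
      hemb (Exp (hsC 2%:R^-1 * (Sk m n k p v (@prec r) la b l +
        Sk m n k p v (@succ r) la b l +
        corr (@Gam RR m n k) (h1A RR m n) (h3A RR m n)) -
        Sk m n k p v (@prec r) la b l))).
  rewrite tor_e_lx (Phi_e_lx m_gt0 n_gt0 kn v_mpower tor_nr yang_nr).
  rewrite dg_boxsum boxsum_dg => e.
  have e1 := etrans (esym (ap_lx _ la))
    (etrans (congr1 (fun T => ap T (kt RR la)) e) (ap_lx _ la)).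
  have e2 := congr1 (fun x => x@_(add_box la b l)) e1.
  exact: etrans (esym (boxsum_coef _ al)) (etrans e2 (boxsum_coef _ al)).
have e := key _ (ce i); rewrite IH -(key _ (ce' i)) in e.
exact: (mulIf ti) e.
Qed.

End Uniqueness.

Theorem theorem4p1 (RR : realType) (m n : nat) (k : int) (r : nat)
    (p : 'I_r -> 'I_(m * n)) (v : 'I_r -> hseries RR) :
  (0 < m)%N -> (0 < n)%N -> coprimez k n%:Z -> (0 < r)%N ->
  (forall a, mpower 1 (v a)) ->
  let p' := fun a => (p a %% m)%N in
  let u' := fun a => hcst (omega RR m n k ^- p a) * hexp (n%:R * hemb (v a)) in
  let py := fun a => nat_of_ord (p a) in
  let vy := fun a => hemb (v a) in
  tor_nonresonant m n k p' u' ->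
  yang_nonresonant m n py vy ->
  exists! c : mpart r -> hloc RR,
    [/\ c (mpart0 r) = 1,
        bijective (diag c)
      & forall (X : tor_gen m) (w : fock RR r),
          diag c (tor_act m n k p' u' X w) =
          Phi m n k (yang_xp m n py vy) (yang_xm m n py vy) (yang_xi m n py vy)
            X (diag c w)].
Proof.
move=> m_gt0 n_gt0 kn _ v1 p' u' py vy tor_nr yang_nr.
have act (c : mpart r -> hloc RR) (S T : fock_endo RR r) :
    dg c * S = T * dg c -> forall w, diag c (S w) = T (diag c w).
  by rewrite dgE => e w; have := congr1 (fun U : fock_endo RR r => U w) e.
have unact (c : mpart r -> hloc RR) (S T : fock_endo RR r) :
    (forall w, diag c (S w) = T (diag c w)) -> dg c * S = T * dg c.
  by rewrite dgE => e; apply: endoP => w; apply: e.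
exists (cnorm m n k py v); split.
  split.
  - exact: cnorm0.
  - have := dg_bijective (cnorm_unit m n k py v1).
    by rewrite dgE.
  - case=> i l; apply: act.
    + exact: (intertwine_h m_gt0 n_gt0 kn py v1).
    + exact: (intertwine_e m_gt0 n_gt0 kn v1 tor_nr yang_nr).
    + exact: (intertwine_f m_gt0 n_gt0 kn v1 tor_nr yang_nr).
move=> c [c0 _ cX].
apply: (intertwiner_unique m_gt0 n_gt0 kn v1 tor_nr yang_nr).
- by rewrite c0; apply: cnorm0.
- by move=> i; apply: (intertwine_e m_gt0 n_gt0 kn v1 tor_nr yang_nr).
- by move=> i; apply: unact (cX (Gen_e i 0)).
Qed.
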